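(* Let $1<\alpha<2$, $\varepsilon>0$, $\lambda>0$, $h>0$. Let $\hat u(x,t)=\Phi(x;q(t))$ be the parametric numerical solution of the fractional Burgers equation $u_t+\frac12(u^2)_x=-\varepsilon(-\Delta)^{\alpha/2}u$ with homogeneous Dirichlet boundary conditions, i.e. $\hat u$ evolves by the regularized projected dynamics $$\hat u_t(x,t)=P^{\lambda}_{q(t)}f^h(t,x,\hat u,D\hat u)$$ described in the context, where $f^h$ is the discrete vector field approximating $f(\hat u,D\hat u)=-\varepsilon(-\Delta)^{\alpha/2}\hat u-\hat u\hat u_x$. If $\hat u(\cdot,t)\in H^{\alpha/2}_0$ for all $t$, then for all $t\ge 0$ $$\|\hat u(\cdot,t)\|_{L^2}\le e^{-\lambda^*_\alpha\varepsilon t}\|\hat u(\cdot,0)\|_{L^2}+\int_0^t e^{-\lambda^*_\alpha\varepsilon(t-s)}\left(\delta^{\lambda,h}(s)+\|R^h(s,\cdot)\|_{L^2}\right)\mathrm{d}s,$$ where $\lambda^*_\alpha>0$ is the smallest eigenvalue of $(-\Delta)^{\alpha/2}$ with homogeneous Dirichlet boundary conditions, $\delta^{\lambda,h}$ is the least-squares residual and $R^h$ is the finite-difference truncation error.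
   Context: **Domain and operator.** $\Omega\subset\mathbb{R}$ is a bounded open interval, $L^2=L^2(\Omega)$ with inner product $\langle\cdot,\cdot\rangle$, and $H^{\alpha/2}_0=H^{\alpha/2}_0(\Omega)$. Homogeneous Dirichlet conditions mean that functions vanish on the boundary and are extended by zero outside $\Omega$. The fractional Laplacian is $$(-\Delta)^{\alpha/2}u(x)=\frac{1}{2\cos(\alpha\pi/2)}\left({}^{RL}_{-\infty}D^\alpha_x u(x)+{}^{RL}_xD^\alpha_{+\infty}u(x)\right),$$ the (normalized) sum of left and right Riemann--Liouville derivatives of order $\alpha$, equivalently the Fourier multiplier $|\xi|^\alpha$ on $\mathbb{R}$. With homogeneous Dirichlet conditions its smallest eigenvalue $\lambda_\alpha^*$ satisfies $\langle v,(-\Delta)^{\alpha/2}v\rangle\ge\lambda^*_\alpha\|v\|_{L^2}^2$. **Parametrization.** $\mathcal{Q}\subseteq\mathbb{R}^{N_P}$ is the parameter space with the Euclidean norm $\|\cdot\|_{\mathcal{Q}}$; $\Phi(\cdot;q)$, $q\in\mathcal{Q}$, is a parametric family of functions on $\Omega$, differentiable in $q$; $\mathcal{M}=\{\Phi(\cdot;q): q\in\mathcal{Q}\}$ and $T_q\mathcal{M}$ is its tangent space at $q$ (the span of the partial derivatives $\partial_{q_j}\Phi(\cdot;q)$). For a curve $q(t)$, $\hat u(x,t)=\Phi(x;q(t))$, and $\frac{\partial\hat u}{\partial q}(t)$ is the linear map $\gamma\mapsto\sum_j\gamma_j\,\partial_{q_j}\Phi(\cdot;q(t))$ into $L^2$.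 **Vector fields.** $f^h$ denotes the vector field obtained from $f$ by replacing fractional derivatives with a finite-difference approximation of grid size $h$; the truncation error is $$R^h(t,x)=f(t,x,\hat u,D\hat u)-f^h(t,x,\hat u,D\hat u).$$ **Projected dynamics.** At each time, $$\dot q(t)=\arg\min_{\gamma\in\mathcal{Q}}\left\|\frac{\partial\hat u}{\partial q}(t)\gamma-f^h(t,\cdot,\hat u,D\hat u)\right\|_{L^2}^2+\lambda^2\|\gamma\|_{\mathcal{Q}}^2,$$ and $P^\lambda_{q(t)}f^h:=\frac{\partial\hat u}{\partial q}(t)\,\dot q(t)$, so that $\hat u_t=P^\lambda_{q(t)}f^h$. The least-squares residual is $$\delta^{\lambda,h}(t)=\left(\left\|\frac{\partial\hat u}{\partial q}(t)\dot q(t)-f^h(t,\cdot,\hat u,D\hat u)\right\|_{L^2}^2+\lambda^2\|\dot q(t)\|_{\mathcal{Q}}^2\right)^{1/2}.$$ All quantities above are understood to be well defined: $q(t)$ is differentiable in time, $f$, $f^h$ and $R^h$ evaluated along $\hat u$ lie in $L^2$, and the time integrals make sense. *)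

(* Defs.v *)
From HB Require Import structures.
From mathcomp Require Import all_boot all_order all_algebra.
From mathcomp Require Import all_classical all_reals all_analysis.

Set Implicit Arguments.
Unset Strict Implicit.
Unset Printing Implicit Defensive.

Import Order.TTheory GRing.Theory Num.Theory.
Import numFieldNormedType.Exports.

Local Open Scope classical_set_scope.
Local Open Scope ring_scope.

Section L2.
Context {R : realType}.
Implicit Types (Omega : set R) (f g : R -> R).

Let mu := @lebesgue_measure R.

Definition inL2 Omega f : Prop := (f \_ Omega) \in Lfun mu 2%:E.

Definition L2norm Omega f : R := fine 'N[mu]_2%:E[EFin \o (f \_ Omega)].

End L2.

Section Sobolev.
Context {R : realType}.
Implicit Types (Omega : set R) (s : R) (u g phi : R -> R).

Let mu := @lebesgue_measure R.

Definition test_function Omega phi : Prop :=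
  (forall n x, derivable (derive1n n phi) x 1) /\
  (exists K, [/\ compact K, K `<=` Omega & forall x, ~ K x -> phi x = 0]).

(* g is the weak derivative of u on the open set Omega *)
Definition weak_derivative Omega u g : Prop :=
  [/\ locally_integrable Omega u, locally_integrable Omega g &
    forall phi, test_function Omega phi ->
      \int[mu]_(x in Omega) (u x * derive1 phi x) =
      - \int[mu]_(x in Omega) (g x * phi x)].

(* squared norm of H^s(R), 0 < s < 1, with the Gagliardo seminorm; on the
   diagonal x = y the integrand is 0, as 0 / 0 = 0 *)
Definition Hs_sqnorm s u : \bar R :=
  (\int[mu]_x ((u x) ^+ 2)%:E +
   \int[mu]_x \int[mu]_y
     ((u x - u y) ^+ 2 / (`|x - y| `^ (1 + s *+ 2)))%:E)%E.

(* H^s_0(Omega): the closure in H^s(R) of the test functions on Omega, each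
   extended by 0 outside Omega *)
Definition H0 s Omega u : Prop :=
  measurable_fun [set: R] u /\
  (forall e, 0 < e -> exists phi,
     test_function Omega phi /\ (Hs_sqnorm s (fun x => u x - phi x)%R < e%:E)%E).

End Sobolev.

Section FractionalLaplacian.
Context {R : realType}.
Implicit Types (Omega : set R) (alpha : R) (u w phi : R -> R).

Let mu := @lebesgue_measure R.

Definition Gamma (z : R) : R :=
  \int[mu]_(t in `]0, +oo[) (t `^ (z - 1) * expR (- t)).

(* Riemann-Liouville fractional integrals of order 2 - alpha, for
   1 < alpha < 2 *)
Definition RL_integral_left alpha u (x : R) : R :=
  (Gamma (2 - alpha))^-1 *
  \int[mu]_(y in `]-oo, x[) ((x - y) `^ (1 - alpha) * u y).

Definition RL_integral_right alpha u (x : R) : R :=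
  (Gamma (2 - alpha))^-1 *
  \int[mu]_(y in `]x, +oo[) ((y - x) `^ (1 - alpha) * u y).

(* The Riemann-Liouville derivatives of order alpha are the second derivatives
   of the integrals above. They are taken here in the sense of distributions on
   Omega, so that the sign (-1)^2 disappears. *)
Definition RL_deriv_left alpha Omega u phi : R :=
  \int[mu]_(x in Omega) (RL_integral_left alpha u x * derive1n 2 phi x).

Definition RL_deriv_right alpha Omega u phi : R :=
  \int[mu]_(x in Omega) (RL_integral_right alpha u x * derive1n 2 phi x).

Definition fracLap_distr alpha Omega u phi : R :=
  (2 * cos (alpha * pi / 2))^-1 *
  (RL_deriv_left alpha Omega u phi + RL_deriv_right alpha Omega u phi).

(* (-Delta)^(alpha/2) u = w on Omega, with w in L^2(Omega) *)
Definition fracLap alpha Omega u w : Prop :=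
  inL2 Omega w /\
  (forall phi, test_function Omega phi ->
     fracLap_distr alpha Omega u phi = \int[mu]_(x in Omega) (w x * phi x)).

Definition dirichlet_eigenvalue alpha Omega (l : R) : Prop :=
  exists v, [/\ H0 (alpha / 2) Omega v, L2norm Omega v != 0 &
                fracLap alpha Omega v (fun x => l * v x)].

Definition smallest_dirichlet_eigenvalue alpha Omega (l : R) : Prop :=
  dirichlet_eigenvalue alpha Omega l /\
  (forall m, dirichlet_eigenvalue alpha Omega m -> l <= m).

End FractionalLaplacian.

Section Burgers.
Context {R : realType}.
Implicit Types (u ux w : R -> R).

(* w stands for (-Delta)^(alpha/2) u or for an approximation of it, ux for the
   derivative of u *)
Definition burgers_field (eps : R) w u ux : R -> R :=
  fun x => - eps * w x - u x * ux x.

(* A general linear finite-difference operator on the grid x + h Z; the weights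
   c may depend on x. For h <> 0 and u vanishing outside a bounded set, the sum
   has finite support. *)
Definition finite_difference (h : R) (c : int -> R -> R) u : R -> R :=
  fun x => \sum_(k \in [set: int]) c k x * u (x + k%:~R * h).

End Burgers.

Section Projection.
Context {R : realType} {N : nat}.
Implicit Types (Omega : set R) (Q : set 'rV[R]_N) (gamma : 'rV[R]_N).

(* the library norm on 'rV[R]_N is the sup norm *)
Definition l2norm gamma : R := Num.sqrt (\sum_j (gamma 0 j) ^+ 2).

Definition tangent_map (d : 'I_N -> R -> R) gamma : R -> R :=
  fun x => \sum_j gamma 0 j * d j x.

(* Phi is differentiable on Q as a map into L^2(Omega), with the partial
   derivatives dPhi p j at p *)
Definition param_differentiable Omega Q (Phi : 'rV[R]_N -> R -> R)
    (dPhi : 'rV[R]_N -> 'I_N -> R -> R) : Prop :=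
  forall p, Q p ->
  [/\ inL2 Omega (Phi p), (forall j, inL2 Omega (dPhi p j)) &
   forall e, 0 < e -> exists2 d, 0 < d &
     forall p', Q p' -> l2norm (p' - p) < d ->
       L2norm Omega
         (fun x => Phi p' x - Phi p x - tangent_map (dPhi p) (p' - p) x)
       <= e * l2norm (p' - p)].

(* the derivative at t of a curve defined on A; one-sided at an end point *)
Definition curve_deriv_within (A : set R) (q : R -> 'rV[R]_N) (t : R) gamma :
    Prop :=
  forall j, (fun s => (q s 0 j - q t 0 j) / (s - t)) @ within A t^'
            --> gamma 0 j.

Definition least_squares Omega (lambda : R) (d : 'I_N -> R -> R) (g : R -> R)
    gamma : R :=
  L2norm Omega (fun x => tangent_map d gamma x - g x) ^+ 2 +
  lambda ^+ 2 * l2norm gamma ^+ 2.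

Definition is_argmin Q (J : 'rV[R]_N -> R) gamma : Prop :=
  Q gamma /\ (forall gamma', Q gamma' -> J gamma <= J gamma').

End Projection.

(* Main.v *)
(** The derivative of [||u||^2 / 2] is [<u, P f^h>], which splits into
    [<u, P f^h - f^h> - <u, R^h> + <u, f>].  The first two terms are at most
    [||u|| (delta + ||R^h||)] by Cauchy-Schwarz, and [<u, u u_x>] vanishes since
    [u^3] is [0] at both end points.  The remaining term needs the inequality
    [<u, (-Delta)^(alpha/2) u> >= lambda* ||u||^2]: on test functions the
    Riemann-Liouville pairing is a positive multiple of the Gagliardo energy,
    whose Rayleigh quotient attains its infimum because, as [alpha > 1],
    functions of bounded energy are equicontinuous; the infimum is thus a
    Dirichlet eigenvalue, hence at least [lambda*], and the bound passes to
    [H0] by density.  The residual is only measurable in time, so Gronwall's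
    inequality is proved by comparing [exp (lambda* eps t) ||u(t)||] with the
    integral of a lower semicontinuous majorant of its upper Dini derivative. *)

Require Import Defs.
From HB Require Import structures.
From mathcomp Require Import all_boot all_order all_algebra.
From mathcomp Require Import all_classical all_reals all_analysis.
From mathcomp Require Import measurable_realfun lebesgue_integral_under.
From mathcomp Require Import ring lra.

Set Implicit Arguments.
Unset Strict Implicit.
Unset Printing Implicit Defensive.

Import Order.TTheory GRing.Theory Num.Theory.
Import numFieldNormedType.Exports.

Local Open Scope classical_set_scope.
Local Open Scope ring_scope.

(** * Translation and reflection of integrals *)

Section Translation.
Context {R : realType}.
Notation mu := (@lebesgue_measure R).

(** No Fourier transform is used. Pairing with the kernel [z ^ (1 - al)] sees the two functions only
    through their cross-correlation, so Fubini reduces the operator to an integral in the shift [z],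
    and two integrations by parts produce the weight [z ^ (-1 - al)]. The boundary terms vanish at
    infinity because [al > 1] and at 0 because [al < 2]. Members of [H0] are determined only almost
    everywhere. Each is traded for a continuous representative, a uniform limit of test functions
    that are Cauchy in energy; this notion, [energy_lim], replaces a completed Hilbert space. No
    weak compactness is needed either: a minimizing sequence is Cauchy in energy by the
    parallelogram law once it converges uniformly. No bump function is written down. The assumed
    eigenfunction is approximated by test functions, one of them is nonzero, and its normalized
    square serves as the mollifier. The norm need not be differentiable where it vanishes, and the
    residual need not be integrable in time. The comparison is therefore one-sided, is needed only
    where the norm is positive, and uses integrals that may be infinite. *)

Lemma measurable_shiftR (c : R) :
  measurable_fun [set: measurableTypeR R] (fun x : measurableTypeR R => (x + c : measurableTypeR R)).
Proof. by apply: measurable_realfun.measurable_funD => //; exact: measurable_cst. Qed.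

Lemma measurable_oppR :
  measurable_fun [set: measurableTypeR R] (fun x : measurableTypeR R => (- x : measurableTypeR R)).
Proof. exact: measurable_realfun.oppr_measurable. Qed.

(** Lebesgue measure is determined by its values on half-open intervals, and translation preserves
    their length. *)
Lemma lebesgue_measure_shift (c : R) (A : set R) : measurable A ->
  mu A = pushforward mu (fun x : measurableTypeR R => (x + c : measurableTypeR R)) A.
Proof.
have mf := measurable_shiftR c.
move: A; apply: (@lebesgue_measure_unique R (measure_function_pushforward__canonical__measure_function_Measure mu mf)).
move=> _ [[x y] _ <-] /=.
rewrite /pushforward (_ : _ @^-1` _ = `](x - c), (y - c)]%classic).
  by rewrite !lebesgue_measure_itv /= !lte_fin ltrD2r; case: ifP => // _; rewrite -!EFinD; congr (_%:E); ring.
by apply/seteqP; split => z /=; rewrite !in_itv /= ltrBlDr lerBrDr.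
Qed.

Lemma ge0_integral_shift (c : R) (f : R -> \bar R) :
  measurable_fun [set: R] f -> (forall x, 0 <= f x)%E ->
  (\int[mu]_x f (x + c)%R = \int[mu]_x f x)%E.
Proof.
move=> mf f0.
have mc := measurable_shiftR c.
transitivity (\int[pushforward mu (fun x : measurableTypeR R => (x + c)%R : measurableTypeR R)]_x f x)%E.
  by rewrite ge0_integral_pushforward.
by apply: eq_measure_integral => //= A mA _; rewrite -[LHS]lebesgue_measure_shift.
Qed.

Lemma ge0_integral_opp (f : R -> \bar R) :
  measurable_fun [set: R] f -> (forall x, 0 <= f x)%E ->
  (\int[mu]_x f (- x)%R = \int[mu]_x f x)%E.
Proof.
move=> mf f0.
have mc := measurable_oppR.
transitivity (\int[pushforward mu (fun x : measurableTypeR R => (- x)%R : measurableTypeR R)]_x f x)%E.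
  by rewrite ge0_integral_pushforward.
by apply: eq_measure_integral => //= A mA _; rewrite -[RHS](lebesgue_measureN mA).
Qed.

Lemma measurable_shift_fun d (T : measurableType d) (c : R) (f : R -> T) :
  measurable_fun [set: R] f -> measurable_fun [set: R] (fun x => f (x + c)).
Proof. by move=> mf; apply: (measurableT_comp mf); exact: measurable_shiftR. Qed.

Lemma measurable_opp_fun d (T : measurableType d) (f : R -> T) :
  measurable_fun [set: R] f -> measurable_fun [set: R] (fun x => f (- x)).
Proof. by move=> mf; apply: (measurableT_comp mf); exact: measurable_oppR. Qed.

Lemma integrable_shift (c : R) (f : R -> \bar R) :
  mu.-integrable [set: R] f -> mu.-integrable [set: R] (fun x => f (x + c)).
Proof.
move=> /integrableP[mf fi]; apply/integrableP; split.
  exact: measurable_shift_fun.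
rewrite (@ge0_integral_shift c (fun x => `|f x|)%E) //.
by apply: measurableT_comp.
Qed.

Lemma integral_shift (c : R) (f : R -> \bar R) : measurable_fun [set: R] f ->
  (\int[mu]_x f (x + c)%R = \int[mu]_x f x)%E.
Proof.
move=> mf; rewrite integralE [RHS]integralE.
congr (_ - _)%E.
  have mp : measurable_fun [set: R] (f^\+)%E by exact: measurable_funepos.
  by rewrite -(ge0_integral_shift c mp (fun x => funepos_ge0 f x)); apply: eq_integral => x _; rewrite !funeposE.
have mp : measurable_fun [set: R] (f^\-)%E by exact: measurable_funeneg.
by rewrite -(ge0_integral_shift c mp (fun x => funeneg_ge0 f x)); apply: eq_integral => x _; rewrite !funenegE.
Qed.

Lemma integral_opp (f : R -> \bar R) : measurable_fun [set: R] f ->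
  (\int[mu]_x f (- x)%R = \int[mu]_x f x)%E.
Proof.
move=> mf; rewrite integralE [RHS]integralE.
congr (_ - _)%E.
  have mp : measurable_fun [set: R] (f^\+)%E by exact: measurable_funepos.
  by rewrite -(ge0_integral_opp mp (fun x => funepos_ge0 f x)); apply: eq_integral => x _; rewrite !funeposE.
have mp : measurable_fun [set: R] (f^\-)%E by exact: measurable_funeneg.
by rewrite -(ge0_integral_opp mp (fun x => funeneg_ge0 f x)); apply: eq_integral => x _; rewrite !funenegE.
Qed.

Lemma Rintegral_shift (c : R) (f : R -> R) : measurable_fun [set: R] f ->
  \int[mu]_x f (x + c) = \int[mu]_x f x.
Proof.
by move=> mf; congr fine; apply: (@integral_shift c (EFin \o f)); exact/measurable_EFinP.
Qed.

Lemma Rintegral_opp (f : R -> R) : measurable_fun [set: R] f ->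
  \int[mu]_x f (- x) = \int[mu]_x f x.
Proof.
by move=> mf; congr fine; apply: (@integral_opp (EFin \o f)); exact/measurable_EFinP.
Qed.

End Translation.

(** * Smooth functions and test functions *)

Section Smooth.
Context {R : realType}.
Implicit Types (f g : R -> R).

(** The first derivative is peeled off before the recursion, so that closure under sums and products
    follows by induction on the order, for all functions at once. [smoothP] links this to the
    iterated form [derive1n]. *)
Fixpoint nsmooth (n : nat) f : Prop :=
  if n is m.+1 then (forall x, derivable f x 1) /\ nsmooth m (derive1 f) else True.

Definition smooth f := forall n x, derivable (derive1n n f) x 1.

Lemma smoothP f : smooth f <-> forall n, nsmooth n f.
Proof.
split=> [sf n|].
  elim: n f sf => //= n IH f sf; split; first exact: (sf 0%N).
  by apply: IH => m x; rewrite -derive1Sn; exact: sf.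
move=> sf n; elim: n f sf => [|n IH] f sf x; first by have [] := sf 1%N.
by rewrite derive1Sn; apply: IH => m; have [] := sf m.+1.
Qed.

Lemma nsmoothW n f : nsmooth n.+1 f -> nsmooth n f.
Proof. by elim: n f => //= n IH f [df /IH]. Qed.

Lemma derive1D_fun f g : (forall x, derivable f x 1) -> (forall x, derivable g x 1) ->
  derive1 (fun x => f x + g x) = (fun x => derive1 f x + derive1 g x).
Proof. by move=> df dg; apply/funext => x; rewrite !derive1E deriveD. Qed.

Lemma derive1M_fun f g : (forall x, derivable f x 1) -> (forall x, derivable g x 1) ->
  derive1 (fun x => f x * g x) = (fun x => f x * derive1 g x + g x * derive1 f x).
Proof. by move=> df dg; apply/funext => x; rewrite !derive1E deriveM. Qed.

Lemma nsmoothD n f g : nsmooth n f -> nsmooth n g -> nsmooth n (fun x => f x + g x).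
Proof.
elim: n f g => //= n IH f g [df sf] [dg sg]; split=> [x|]; first exact: derivableD.
by rewrite (derive1D_fun df dg); exact: IH.
Qed.

Lemma nsmoothM n f g : nsmooth n f -> nsmooth n g -> nsmooth n (fun x => f x * g x).
Proof.
elim: n f g => // n IH f g sf sg; have [df df'] := sf; have [dg dg'] := sg.
split=> [x|]; first exact: derivableM.
rewrite /= (derive1M_fun df dg); apply: nsmoothD; apply: IH => //; exact: nsmoothW.
Qed.

Lemma nsmooth_cst n (c : R) : nsmooth n (fun=> c).
Proof.
elim: n c => //= n IH c; split=> [x|]; first exact: derivable_cst.
rewrite (_ : derive1 _ = fun=> 0) //; apply/funext => x; exact: derive1_cst.
Qed.

Lemma is_derive_affine f (k c x d : R) : is_derive (k * x + c) 1 f d ->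
  is_derive x 1 (fun y => f (k * y + c)) (k * d).
Proof.
move=> fd.
have gd : is_derive x 1 (fun y : R => k * y + c) k.
  have -> : (fun y : R => k * y + c) = (k \*: id) + cst c.
    by apply/funext => y /=; rewrite fctE.
  by apply: is_derive_eq; rewrite addr0 /GRing.scale /= mulr1.
apply: DeriveDef.
  apply/derivable1_diffP; apply: (@differentiable_comp _ _ _ _ (fun y : R => k * y + c) f).
    by apply/derivable1_diffP; case: gd.
  by apply/derivable1_diffP; case: fd.
rewrite -derive1E (@derive1_comp _ (fun y : R => k * y + c) f); [|by case: gd|by case: fd].
by rewrite !derive1E; case: fd => _ ->; case: gd => _ ->; rewrite mulrC.
Qed.

Lemma nsmooth_affine n f (k c : R) : nsmooth n f -> nsmooth n (fun x => f (k * x + c)).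
Proof.
elim: n f => //= n IH f [df sf].
have D (x : R) : is_derive x 1 (fun y => f (k * y + c)) (k * derive1 f (k * x + c)).
  by apply: is_derive_affine; rewrite derive1E; exact: derivableP.
split=> [x|]; first by case: (D x).
rewrite (_ : derive1 _ = fun x => k * derive1 f (k * x + c)); last first.
  by apply/funext => x; rewrite derive1E; case: (D x).
by apply: nsmoothM; [exact: nsmooth_cst|exact: IH].
Qed.

End Smooth.

Section TestFunctions.
Context {R : realType}.
Notation mu := (@lebesgue_measure R).
Variables a b : R.
Notation Om := (`]a, b[%classic : set R).
Notation tf := (test_function Om).
Implicit Types f g phi : R -> R.

Lemma tf_smooth phi : tf phi -> smooth phi.
Proof. by case. Qed.

Lemma tf_der phi x : tf phi -> derivable phi x 1.
Proof. by move=> [s _]; exact: (s 0%N). Qed.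

Lemma tf_is_derive phi (x : R) : tf phi -> is_derive x 1 phi (derive1 phi x).
Proof. by move=> /tf_der-/(_ x) h; rewrite derive1E; exact: derivableP. Qed.

Lemma tf_continuous phi : tf phi -> continuous phi.
Proof. by move=> tp x; apply: differentiable_continuous; apply/derivable1_diffP; exact: tf_der. Qed.

Lemma tf_out phi x : tf phi -> ~ Om x -> phi x = 0.
Proof. by move=> [_ [K [_ KO K0]]] nx; apply: K0 => /KO. Qed.

Lemma derive1_zero_near f (K : set R) : closed K -> (forall x, ~ K x -> f x = 0) ->
  forall x, ~ K x -> derive1 f x = 0.
Proof.
move=> cK f0 x nKx.
rewrite derive1E -(derive_cst (0 : R) x 1); apply: near_eq_derive.
have : nbhs x (~` K) by apply: open_nbhs_nbhs; split => //; exact: closed_openC.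
by apply: filterS => y /= /f0.
Qed.

Lemma tf_derive1 phi : tf phi -> tf (derive1 phi).
Proof.
move=> [s [K [cK KO K0]]]; split.
  by move=> n x; rewrite -derive1Sn; exact: s.
exists K; split=> //; apply: derive1_zero_near => //.
exact: (compact_closed (@Rhausdorff R)).
Qed.

Lemma tf_add phi psi : tf phi -> tf psi -> tf (fun x => phi x + psi x).
Proof.
move=> [/smoothP s1 [K1 [cK1 KO1 K01]]] [/smoothP s2 [K2 [cK2 KO2 K02]]]; split.
  by apply/smoothP => n; exact: nsmoothD.
exists (K1 `|` K2); split.
- exact: compactU.
- by rewrite subUset.
- by move=> x /not_orP[n1 n2]; rewrite K01// K02// addr0.
Qed.

Lemma tf_mul phi f : tf phi -> smooth f -> tf (fun x => phi x * f x).
Proof.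
move=> [/smoothP s1 [K1 [cK1 KO1 K01]]] /smoothP s2; split.
  by apply/smoothP => n; exact: nsmoothM.
by exists K1; split => // x n1; rewrite K01// mul0r.
Qed.

Lemma tf_scale (k : R) phi : tf phi -> tf (fun x => k * phi x).
Proof.
move=> tp; rewrite (_ : (fun x => _) = (fun x => phi x * k)); last by apply/funext => x; rewrite mulrC.
by apply: tf_mul => //; apply/smoothP => n; exact: nsmooth_cst.
Qed.

Lemma tf_sub phi psi : tf phi -> tf psi -> tf (fun x => phi x - psi x).
Proof.
move=> t1 t2; rewrite (_ : (fun x => _) = (fun x => phi x + (-1) * psi x)); last by apply/funext => x; rewrite mulN1r.
by apply: tf_add => //; exact: tf_scale.
Qed.

Lemma continuous_bounded_supp f : a <= b -> continuous f -> (forall x, ~ Om x -> f x = 0) ->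
  exists2 M : R, 0 <= M & forall x, `|f x| <= M.
Proof.
move=> ab cf f0.
have [c _ hc] := @EVT_max R (fun x => `|f x|) a b ab ltac:(by apply: continuous_subspaceT => x; apply: cvg_norm; exact: cf).
exists `|f c| => // x; have [xab|xab] := boolP (x \in `[a, b]); first exact: hc.
by rewrite f0 ?normr0// => /= /subset_itv_oo_cc; exact/negP.
Qed.

Lemma continuous_integrable_supp f : continuous f -> (forall x, ~ Om x -> f x = 0) ->
  mu.-integrable [set: R] (EFin \o f).
Proof.
move=> cf f0.
have : mu.-integrable `[a, b] (EFin \o f).
  by apply: continuous_compact_integrable; [exact: segment_compact|exact: continuous_subspaceT].
move/(@integrable_mkcond _ _ _ mu _ _ (measurable_itv `[a, b])).
apply: eq_integrable => // x _; rewrite patchE; case: ifPn => // /negP xab.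
rewrite /= f0// => xo; apply: xab; rewrite inE; exact: subset_itv_oo_cc.
Qed.

Lemma tf_integrable phi : tf phi -> mu.-integrable [set: R] (EFin \o phi).
Proof. by move=> tp; apply: continuous_integrable_supp; [exact: tf_continuous|move=> x; exact: tf_out]. Qed.

Lemma tf_bounded phi : a <= b -> tf phi -> exists2 M : R, 0 <= M & forall x, `|phi x| <= M.
Proof. by move=> ab tp; apply: continuous_bounded_supp => //; [exact: tf_continuous|move=> x; exact: tf_out]. Qed.

Lemma derive_bound_lipschitz f (df : R -> R) (M : R) : (forall x : R, is_derive x 1 f (df x)) ->
  (forall x, `|df x| <= M) -> forall x y, `|f x - f y| <= M * `|x - y|.
Proof.
move=> fd fM.
have cf : continuous f by move=> x; apply: differentiable_continuous; apply/derivable1_diffP; case: (fd x).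
suff H x y : x <= y -> `|f y - f x| <= M * `|y - x|.
  by move=> x y; case: (leP x y) => [/H|/ltW/H]; rewrite // distrC (distrC x).
rewrite le_eqVlt => /predU1P[->|xy]; first by rewrite !subrr !normr0 mulr0.
have [c _ ->] := @MVT R f df x y xy (fun z _ => fd z) (continuous_subspaceT cf).
by rewrite normrM ler_wpM2r.
Qed.

Lemma tf_lipschitz phi : a <= b -> tf phi ->
  exists2 M : R, 0 <= M & forall x y, `|phi x - phi y| <= M * `|x - y|.
Proof.
move=> ab tp; have [M M0 hM] := tf_bounded ab (tf_derive1 tp); exists M => //.
by apply: derive_bound_lipschitz hM => x; exact: tf_is_derive.
Qed.

End TestFunctions.

(** * Integrability of power weights, and positivity of the Gamma factor *)

Section PowerKernels.
Context {R : realType}.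
Notation mu := (@lebesgue_measure R).

Lemma is_derive_continuous (f : R -> R) (x d : R) : is_derive x 1 f d -> {for x, continuous f}.
Proof. by move=> [df _]; apply: differentiable_continuous; apply/derivable1_diffP. Qed.

Lemma FTC2_segment (F f : R -> R) (x y : R) : x < y ->
  (forall z, x <= z <= y -> is_derive z 1 F (f z)) ->
  (forall z, x <= z <= y -> {for z, continuous f}) ->
  (\int[mu]_(z in `[x, y]) (f z)%:E = (F y - F x)%:E)%E.
Proof.
move=> xy dF cf; rewrite EFinB; apply: continuous_FTC2 => //.
- apply: continuous_in_subspaceT => z; rewrite inE /= in_itv /= => zxy; exact: cf.
- split.
  + by move=> z; rewrite in_itv /= => /andP[/ltW xz /ltW zy]; case: (dF z); rewrite ?xz.
  + apply: cvg_at_right_filter; apply: (is_derive_continuous (dF x _)); by rewrite lexx ltW.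
  + apply: cvg_at_left_filter; apply: (is_derive_continuous (dF y _)); by rewrite lexx ltW.
- move=> z; rewrite in_itv /= => /andP[/ltW xz /ltW zy].
  by rewrite derive1E; case: (dF z) => [|_ ->//]; rewrite xz.
Qed.

Lemma powR_continuous_gt0 (p z : R) : 0 < z -> {for z, continuous (fun x : R => x `^ p)}.
Proof. by move=> z0; exact: (is_derive_continuous (is_derive1_powR p z0)). Qed.

Lemma integral_powR_segment (p x y : R) : p + 1 != 0 -> 0 < x -> x < y ->
  (\int[mu]_(z in `[x, y]) (z `^ p)%:E = ((y `^ (p + 1) - x `^ (p + 1)) / (p + 1))%:E)%E.
Proof.
move=> p1 x0 xy; rewrite mulrBl.
apply: (@FTC2_segment (fun z => z `^ (p + 1) / (p + 1))) => //.
  move=> z /andP[xz _]; have z0 : 0 < z := lt_le_trans x0 xz.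
  rewrite (_ : (fun _ => _) = (p + 1)^-1 *: (fun z => z `^ (p + 1))); last first.
    by apply/funext => w; rewrite fctE mulrC.
  have := is_derive1_powR (p + 1) z0; rewrite addrK => h.
  by apply: is_derive_eq; rewrite /GRing.scale /= mulrA mulVf// mul1r.
by move=> z /andP[xz _]; apply: powR_continuous_gt0; exact: lt_le_trans xz.
Qed.

Lemma measurable_powR_EFin (p : R) (D : set R) : measurable D ->
  measurable_fun D (fun z : R => (z `^ p)%:E).
Proof. by move=> mD; apply/measurable_EFinP; apply: measurable_funTS; exact: measurable_powR. Qed.

Lemma integrable_powR_near0 (p L : R) : -1 < p -> 0 < L ->
  mu.-integrable `]0, L] (fun z => (z `^ p)%:E).
Proof.
move=> p1 L0; have p10 : 0 < p + 1 by lra.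
apply/integrableP; split; first exact: measurable_powR_EFin.
under eq_integral do rewrite gee0_abs ?lee_fin ?powR_ge0//.
(* These segments exhaust []0, L]]; starting from 2 keeps each of them nondegenerate, as
   [integral_powR_segment] requires. *)
pose F (n : nat) := `[L / n.+2%:R, L]%classic : set R.
have L2 n : L / n.+2%:R < L by rewrite gtr_pMr// invf_lt1// ltr1n.
have UF : (`]0, L]%classic : set R) = \bigcup_n F n.
  apply/seteqP; split => [z|z [n _]]; rewrite /F /= !in_itv /=.
    move=> /andP[z0 zL]; have [n hn] := ltr_add_invr (divr_gt0 z0 L0).
    exists n => //=; rewrite in_itv /= zL andbT.
    move: hn; rewrite add0r ltr_pdivlMr// mulrC => /ltW; apply: le_trans.
    by rewrite ler_pM2l// lef_pV2 ?posrE// ler_nat.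
  move=> /andP[h ->]; rewrite andbT; apply: lt_le_trans h; exact: divr_gt0.
rewrite UF.
have cvgI : (\int[mu]_(z in F i) (z `^ p)%:E @[i --> \oo] --> \int[mu]_(z in \bigcup_i F i) (z `^ p)%:E)%E.
  apply: ge0_nondecreasing_set_cvg_integral.
  - apply/nondecreasing_seqP => n; rewrite subsetEset => z; rewrite /F /= !in_itv /= => /andP[h ->].
    rewrite andbT; apply: le_trans h; by rewrite ler_pM2l// lef_pV2 ?posrE// ler_nat.
  - by move=> i; exact: measurable_itv.
  - by move=> i; apply: measurable_powR_EFin; exact: measurable_itv.
  - by move=> i x _; rewrite lee_fin powR_ge0.
apply: (@le_lt_trans _ _ (L `^ (p + 1) / (p + 1))%:E); last exact: ltry.
rewrite -(cvg_lim (@ereal_hausdorff R) cvgI); apply: lime_le; first by apply/cvg_ex; eexists; exact: cvgI.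
apply: nearW => n; rewrite integral_powR_segment// ?gt_eqF// ?divr_gt0//.
by rewrite lee_fin ler_pM2r ?invr_gt0// gerBl powR_ge0.
Qed.

Lemma powR_cvgy0 (q : R) : q < 0 -> (fun z : R => z `^ q) @ +oo --> 0.
Proof.
move=> q0; apply/cvgrPdist_le => e e0; near=> z.
have z0 : 0 < z by near: z; apply: nbhs_pinfty_gt; rewrite num_real.
rewrite sub0r normrN ger0_norm ?powR_ge0//.
have -> : q = - (- q) by rewrite opprK.
rewrite powRN -[leRHS]invrK lef_pV2 ?posrE ?invr_gt0 ?powR_gt0//.
have -> : e^-1 = (e `^ q^-1) `^ (- q) by rewrite -powRrM mulrN mulVf ?lt_eqF// powRN powRr1// ltW.
have q0' : 0 <= - q by rewrite oppr_ge0 ltW.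
have ez : e `^ q^-1 <= z by near: z; apply: nbhs_pinfty_ge; rewrite num_real.
by apply: (ge0_ler_powR q0'); rewrite ?nnegrE ?powR_ge0// ltW.
Unshelve. all: by end_near. Qed.

Lemma integrable_powR_tail (p : R) : p < -1 ->
  mu.-integrable `[1, +oo[ (fun z => (z `^ p)%:E).
Proof.
move=> p1; have p10 : p + 1 < 0 by lra.
apply/integrableP; split; first by apply: measurable_powR_EFin; exact: measurable_itv.
under eq_integral do rewrite gee0_abs ?lee_fin ?powR_ge0//.
have D (z : R) : 0 < z -> is_derive z 1 (fun z : R => (p + 1)^-1 * z `^ (p + 1)) (z `^ p).
  move=> z0; have := is_derive1_powR (p + 1) z0; rewrite addrK => h.
  by apply: is_derive_eq; rewrite /GRing.scale /= mulrA mulVf ?lt_eqF// mul1r.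
rewrite (@ge0_continuous_FTC2y _ _ (fun z => (p + 1)^-1 * z `^ (p + 1)) 1 0).
- exact: ltry.
- by move=> x _; exact: powR_ge0.
- apply: continuous_in_subspaceT => z; rewrite inE /= in_itv /= andbT => z1.
  by apply: powR_continuous_gt0; exact: lt_le_trans z1.
- rewrite -[X in _ --> X](mulr0 (p + 1)^-1); apply: cvgMr; exact: powR_cvgy0.
- by move=> x x1; case: (D x (lt_trans ltr01 x1)).
- by apply: cvg_at_right_filter; exact: (is_derive_continuous (D 1 ltr01)).
- move=> z; rewrite in_itv /= andbT => z1.
  by rewrite derive1E; case: (D z (lt_trans ltr01 z1)).
Qed.

(** Quadratic vanishing of [h] at 0 improves the weight to [z ^ (1 - al)], integrable near 0 since
    [al < 2]; at infinity boundedness of [h] suffices since [al > 0]. *)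
Lemma integrable_powR_dominated (al C : R) (h : R -> R) : 0 < al -> al < 2 ->
  measurable_fun (`]0, +oo[%classic : set R) h ->
  (forall z : R, 0 < z -> `|h z| <= C * z ^+ 2) -> (forall z : R, 0 < z -> `|h z| <= C) ->
  mu.-integrable `]0, +oo[ (fun z => (z `^ (-1 - al) * h z)%:E).
Proof.
move=> al0 al2 mh h2 h0.
have C0 : 0 <= C by apply: le_trans (h0 1 ltr01); exact: normr_ge0.
pose g1 := (fun z : R => (z `^ (1 - al))%:E) \_ `]0, 1].
pose g2 := (fun z : R => (z `^ (-1 - al))%:E) \_ `[1, +oo[.
have i1 : mu.-integrable [set: R] g1.
  apply/(@integrable_mkcond _ _ _ mu _ _ (measurable_itv _)); apply: integrable_powR_near0 => //; lra.
have i2 : mu.-integrable [set: R] g2.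
  apply/(@integrable_mkcond _ _ _ mu _ _ (measurable_itv _)); apply: integrable_powR_tail => //; lra.
have i3 : mu.-integrable `]0, +oo[ (fun z => C%:E * (g1 z + g2 z))%E.
  have : mu.-integrable [set: R] (fun z => C%:E * (g1 z + g2 z))%E.
    by apply: integrableZl => //; exact: integrableD.
  by apply: integrableS => //; exact: measurable_itv.
apply: le_integrable i3; first exact: measurable_itv.
  apply/measurable_EFinP; apply: measurable_realfun.measurable_funM => //.
  by apply: measurable_funTS; exact: measurable_powR.
move=> z /=; rewrite in_itv /= andbT => z0.
have g10 w : (0 <= g1 w)%E by rewrite /g1 patchE; case: ifP => // _; rewrite lee_fin powR_ge0.
have g20 w : (0 <= g2 w)%E by rewrite /g2 patchE; case: ifP => // _; rewrite lee_fin powR_ge0.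
rewrite [leRHS]gee0_abs; last by rewrite mule_ge0// ?lee_fin// adde_ge0.
rewrite normrM (ger0_norm (powR_ge0 _ _)).
case: (leP z 1) => z1.
  have -> : g1 z = (z `^ (1 - al))%:E by rewrite /g1 patchE ifT// inE /= in_itv /= z0 z1.
  apply: (@le_trans _ _ (C%:E * (z `^ (1 - al))%:E)%E); last by rewrite lee_wpmul2l ?lee_fin// leeDl.
  rewrite -EFinM lee_fin.
  have -> : 1 - al = (-1 - al) + 2 by lra.
  rewrite [in leRHS]powRD; last by rewrite (gt_eqF z0) implybT.
  rewrite (_ : z `^ 2 = z ^+ 2); last by rewrite -powR_mulrn// ltW.
  by rewrite mulrCA ler_wpM2l ?powR_ge0// h2.
have -> : g2 z = (z `^ (-1 - al))%:E by rewrite /g2 patchE ifT// inE /= in_itv /= andbT ltW.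
apply: (@le_trans _ _ (C%:E * (z `^ (-1 - al))%:E)%E); last by rewrite lee_wpmul2l ?lee_fin// leeDr.
by rewrite -EFinM lee_fin mulrC ler_wpM2r ?powR_ge0// h0.
Qed.

(** [Gamma] is a real-valued integral, which would read 0 if it were infinite, so finiteness comes
    first: the integrand is [t ^ (-1 - al)] times the function [t ^ 2 * exp (- t)], which is bounded
    and quadratically small at 0. Positivity is read off the part over [[1, 2]]. *)
Lemma Gamma_gt0 (al : R) : 0 < al -> al < 2 -> 0 < Gamma (2 - al).
Proof.
move=> al0 al2.
have I : mu.-integrable `]0, +oo[ (fun t => (t `^ (2 - al - 1) * expR (- t))%:E).
  have : mu.-integrable `]0, +oo[ (fun z => (z `^ (-1 - al) * (z ^+ 2 * expR (- z)))%:E).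
    apply: (@integrable_powR_dominated _ 4) => //.
    - apply: measurable_funTS; apply: measurable_realfun.measurable_funM.
        exact: measurable_funX.
      by apply: continuous_measurable_fun => z; apply: continuous_comp; [exact: opp_continuous|exact: continuous_expR].
    - move=> z z0; have -> : `|z ^+ 2 * expR (- z)| = z ^+ 2 * expR (- z).
        by rewrite ger0_norm// mulr_ge0// ?expR_ge0// sqr_ge0.
      have e1 : expR (- z) <= 1 by rewrite -expR0 ler_expR oppr_le0 ltW.
      have e2 := sqr_ge0 z; have := expR_ge0 (- z); nra.
    - move=> z z0; have -> : `|z ^+ 2 * expR (- z)| = z ^+ 2 * expR (- z).
        by rewrite ger0_norm// mulr_ge0// ?expR_ge0// sqr_ge0.
      rewrite expRN ler_pdivrMr ?expR_gt0//.
      (* Squaring this gives [z ^+ 2 / 4 <= expR z], which is where the constant 4 comes from. *)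
      have e1 : 1 + z / 2 <= expR (z / 2) by exact: expR_ge1Dx.
      have -> : expR z = expR (z / 2) ^+ 2 by rewrite -expRM_natl; congr expR; field.
      nra.
  apply: eq_integrable => // z; rewrite inE /= in_itv /= andbT => z0; congr (_%:E).
  rewrite mulrA; congr (_ * _); rewrite -(powR_mulrn 2 (ltW z0)) -powRD.
    by congr (_ `^ _); lra.
  by rewrite (gt_eqF z0) implybT.
rewrite /Gamma /Rintegral fine_gt0// -ge0_fin_numE; last first.
  by apply: integral_ge0 => t _; rewrite lee_fin mulr_ge0 ?powR_ge0 ?expR_ge0.
rewrite (integrable_fin_num _ I) ?andbT//.
pose I12 : set R := `[1, 2]%classic.
apply: (@lt_le_trans _ _ (\int[mu]_(t in I12) ((2 : R) `^ (- 1) * expR (- 2))%:E)%E).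
  rewrite integral_cst; last exact: measurable_itv.
  rewrite /=.
  have -> : mu I12 = 1%:E.
    by rewrite /I12 lebesgue_measure_itv /= lte_fin ltr1n -EFinD; congr (_%:E); lra.
  rewrite -EFinM lte_fin mulr1.
  by rewrite mulr_gt0 ?powR_gt0 ?expR_gt0.
apply: (@le_trans _ _ (\int[mu]_(t in I12) (t `^ (2 - al - 1) * expR (- t))%:E)%E).
  apply: ge0_le_integral => //.
  - exact: measurable_itv.
  - apply: (measurable_int mu); apply: integrableS I => //; try exact: measurable_itv.
    by move=> t /=; rewrite /I12 /= !in_itv /= andbT => /andP[t1 _]; exact: lt_le_trans t1.
  - move=> t; rewrite /I12 /= in_itv /= => /andP[t1 t2]; rewrite lee_fin ler_pM ?powR_ge0 ?expR_ge0//; last by rewrite ler_expR lerN2.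
    apply: (@le_trans _ _ (t `^ (-1))); last by apply: ler_powR => //; lra.
    rewrite !powRN !powRr1; [|lra..]; rewrite lef_pV2 ?posrE//; lra.
apply: ge0_subset_integral => //.
- exact: measurable_itv.
- exact: (measurable_int mu I).
- by move=> t _; rewrite lee_fin mulr_ge0 ?powR_ge0 ?expR_ge0.
- by move=> t; rewrite /I12 /= !in_itv /= andbT => /andP[t1 _]; exact: lt_le_trans t1.
Qed.

End PowerKernels.

(** * Correlations and the energy form *)

Section Correlation.
Context {R : realType}.
Notation mu := (@lebesgue_measure R).
Implicit Types f g phi psi : R -> R.

(** The cross-correlation. A convolution operator paired with [g] depends on [f] and [g] only
    through it, and it is as smooth in [z] as [g] is in [x]. *)
Definition corr f g (z : R) : R := \int[mu]_x (f x * g (x + z)).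

Definition diffcorr f g (z : R) : R :=
  \int[mu]_x ((f (x + z) - f x) * (g (x + z) - g x)).

(** Half of the Gagliardo form: differences are indexed by the shift [z], and [z] and [- z]
    contribute equally, so the positive half-line is enough. *)
Definition energy (al : R) f g : R :=
  \int[mu]_(z in `]0, +oo[) (z `^ (-1 - al) * diffcorr f g z).

Lemma continuous_measurableR f : continuous f -> measurable_fun [set: R] f.
Proof. exact: continuous_measurable_fun. Qed.

Notation intg f := (mu.-integrable [set: R] (EFin \o f)).

Lemma intgB f g : intg f -> intg g -> intg (fun x => f x - g x).
Proof. by move=> fi gi; have := integrableB measurableT fi gi; exact: eq_integrable. Qed.

Lemma intgZ (k : R) f : intg f -> intg (fun x => k * f x).
Proof. by move=> fi; have := integrableZl measurableT k fi; exact: eq_integrable. Qed.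

Lemma RintD f g : intg f -> intg g ->
  \int[mu]_x (f x + g x) = \int[mu]_x f x + \int[mu]_x g x.
Proof. exact: RintegralD. Qed.

Lemma RintB f g : intg f -> intg g ->
  \int[mu]_x (f x - g x) = \int[mu]_x f x - \int[mu]_x g x.
Proof. exact: RintegralB. Qed.

Lemma RintZ (k : R) f : intg f -> \int[mu]_x (k * f x) = k * \int[mu]_x f x.
Proof. exact: RintegralZl. Qed.

Lemma le_Rint f g : intg f -> intg g -> (forall x, f x <= g x) ->
  \int[mu]_x f x <= \int[mu]_x g x.
Proof. by move=> fi gi fg; apply: le_Rintegral. Qed.

Lemma le_intg f g : intg g -> measurable_fun [set: R] f -> (forall x, `|f x| <= g x) -> intg f.
Proof.
move=> gi mf fg; apply: le_integrable gi => //; first exact/measurable_EFinP.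
by move=> x _; rewrite /= lee_fin (le_trans (fg x))// ler_norm.
Qed.

Lemma intg_measurable f : intg f -> measurable_fun [set: R] f.
Proof. by move=> fi; apply/measurable_EFinP; exact: (measurable_int mu fi). Qed.

Lemma measurable_mul f g : measurable_fun [set: R] f -> measurable_fun [set: R] g ->
  measurable_fun [set: R] (fun x => f x * g x).
Proof. exact: measurable_realfun.measurable_funM. Qed.

Lemma RintE f : intg f -> ((\int[mu]_x f x)%:E = \int[mu]_x (f x)%:E)%E.
Proof. by move=> fi; rewrite /Rintegral fineK//; exact: (integrable_fin_num measurableT fi). Qed.

Lemma integrable_mul_bounded f g (M : R) : mu.-integrable [set: R] (EFin \o f) ->
  measurable_fun [set: R] g -> (forall x, `|g x| <= M) ->
  intg (fun x => f x * g x).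
Proof.
move=> fi mg gM.
have : mu.-integrable [set: R] (fun x => M%:E * (EFin \o f) x)%E by exact: integrableZl.
apply: le_integrable => //.
  apply/measurable_EFinP; apply: measurable_realfun.measurable_funM => //.
  by apply/measurable_EFinP; exact: (measurable_int mu fi).
move=> x _ /=; rewrite lee_fin !normrM mulrC ler_wpM2r//.
exact: le_trans (gM x) (ler_norm _).
Qed.

Lemma Rintegral_mul_bounded f g (M : R) : mu.-integrable [set: R] (EFin \o f) ->
  measurable_fun [set: R] g -> (forall x, `|g x| <= M) ->
  `|\int[mu]_x (f x * g x)| <= M * \int[mu]_x `|f x|.
Proof.
move=> fi mg gM; have i1 := integrable_mul_bounded fi mg gM.
apply: le_trans (le_normr_Rintegral measurableT i1) _.
rewrite -RintegralZl//; last exact: integrable_norm.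
apply: le_Rintegral => //.
- exact: integrable_norm.
- have := integrableZl measurableT M (integrable_norm fi); exact: eq_integrable.
- by move=> x _; rewrite normrM mulrC ler_wpM2r.
Qed.

Variables a b : R.
Hypothesis ab : a < b.
Notation Om := (`]a, b[%classic : set R).
Notation tf := (test_function Om).

Lemma lebesgue_measure_oo_lty : (mu Om < +oo)%E.
Proof. by rewrite lebesgue_measure_itv /= lte_fin ab -EFinD ltry. Qed.

Lemma bounded_supp_integrable f (M : R) : measurable_fun [set: R] f ->
  (forall x, `|f x| <= M) -> (forall x, ~ Om x -> f x = 0) ->
  mu.-integrable [set: R] (EFin \o f).
Proof.
move=> mf fM f0.
have : mu.-integrable Om (EFin \o f).
  apply: measurable_bounded_integrable => //.
  - exact: lebesgue_measure_oo_lty.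
  - exact: measurable_funTS.
  - by exists M; split => [|N MN x _]; [rewrite num_real|exact: le_trans (fM x) (ltW MN)].
move/(@integrable_mkcond _ _ _ mu _ _ (measurable_itv _)).
apply: eq_integrable => // x _; rewrite patchE; case: ifPn => // /negP xab.
by rewrite /= f0// => xo; apply: xab; rewrite inE.
Qed.

(** The derivative in the shift falls on the test function alone, so [|f|] times a bound for
    [derive1 phi] dominates and [f] needs no regularity. *)
Lemma is_derive_corr f phi (z : R) : mu.-integrable [set: R] (EFin \o f) -> tf phi ->
  is_derive z 1 (corr f phi) (corr f (derive1 phi) z).
Proof.
move=> fi tp.
have [M M0 hM] := tf_bounded (ltW ab) tp.
have [M' M'0 hM'] := tf_bounded (ltW ab) (tf_derive1 tp).
have mshift (h : R -> R) w : continuous h -> measurable_fun [set: R] (fun x => h (x + w)).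
  by move=> ch; apply: measurable_shift_fun; exact: continuous_measurableR.
pose F w x := f x * phi (x + w).
have dF (w : R) x : is_derive w 1 (F ^~ x) (f x * derive1 phi (x + w)).
  have h : is_derive w 1 (fun w : R => phi (1 * w + x)) (1 * derive1 phi (1 * w + x)).
    by apply: is_derive_affine; exact: (tf_is_derive _ tp).
  rewrite /F (_ : (fun w => _) = f x *: (fun w => phi (1 * w + x))); last first.
    by apply/funext => v; rewrite fctE /GRing.scale /= mul1r addrC.
  by apply: is_derive_eq; rewrite /GRing.scale /= !mul1r addrC.
have I : (`]z - 1, z + 1[%classic : set R) z by rewrite /= in_itv /=; apply/andP; split; lra.
have H1 w : (`]z - 1, z + 1[%classic : set R) w -> mu.-integrable [set: R] (EFin \o F w).
  by move=> _; apply: (@integrable_mul_bounded _ _ M) => //; apply: mshift; exact: tf_continuous tp.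
have H2 w x : (`]z - 1, z + 1[%classic : set R) w -> [set: R] x -> derivable (F ^~ x) w 1.
  by move=> _ _; case: (dF w x).
have H3 : mu.-integrable [set: R] (EFin \o (fun x => M' * `|f x|)).
  by have := integrableZl measurableT M' (integrable_norm fi); exact: eq_integrable.
have H4 w x : (`]z - 1, z + 1[%classic : set R) w -> [set: R] x -> `|partial1of2 F w x| <= M' * `|f x|.
  move=> _ _; rewrite partial1of2E; case: (dF w x) => _ ->.
  by rewrite normrM mulrC ler_wpM2r.
have H0 x : 0 <= M' * `|f x| by rewrite mulr_ge0.
apply: DeriveDef; first exact: (derivable_under_integral measurableT I H1 H2 H0 H3 H4).
rewrite -derive1E (differentiation_under_integral measurableT I H1 H2 H0 H3 H4).
by apply: eq_Rintegral => x _; rewrite partial1of2E; case: (dF z x).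
Qed.

Lemma corr_bounded f phi : mu.-integrable [set: R] (EFin \o f) -> tf phi ->
  exists2 C : R, 0 <= C & forall z, `|corr f phi z| <= C.
Proof.
move=> fi tp; have [M M0 hM] := tf_bounded (ltW ab) tp.
exists (M * \int[mu]_x `|f x|); first by rewrite mulr_ge0// Rintegral_ge0.
move=> z; apply: Rintegral_mul_bounded => //.
by apply: measurable_shift_fun; apply: continuous_measurableR; exact: tf_continuous tp.
Qed.

Lemma corr_out f phi (z : R) : (forall x, ~ Om x -> f x = 0) ->
  (forall x, ~ Om x -> phi x = 0) -> b - a <= `|z| -> corr f phi z = 0.
Proof.
move=> f0 p0 hz; rewrite /corr (_ : (fun x => _) = cst 0).
  by rewrite Rintegral_cst ?mul0r.
apply/funext => x; have [|nx] := pselect (Om x); last by rewrite f0 ?mul0r.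
move=> /=; rewrite in_itv /= => /andP[ax xb]; rewrite p0 ?mulr0//= in_itv /=.
move=> /andP[h1 h2]; move: hz; rewrite leNgt => /negP; apply.
rewrite ltr_norml; apply/andP; split; lra.
Qed.

Lemma diffcorrE psi phi (z : R) : tf psi -> tf phi ->
  diffcorr psi phi z = 2 * corr psi phi 0 - corr psi phi z - corr psi phi (- z).
Proof.
move=> ts tp.
have cs := tf_continuous ts; have cp := tf_continuous tp.
have [M M0 hM] := tf_bounded (ltW ab) tp.
have ms w : measurable_fun [set: R] (fun x => psi (x + w)).
  by apply: measurable_shift_fun; exact: continuous_measurableR.
have mp w : measurable_fun [set: R] (fun x => phi (x + w)).
  by apply: measurable_shift_fun; exact: continuous_measurableR.
have I v w : intg (fun x => psi (x + v) * phi (x + w)).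
  apply: (@integrable_mul_bounded (fun x => psi (x + v)) _ M) => //.
  exact: (@integrable_shift _ v (EFin \o psi) (tf_integrable ts)).
have S v w : \int[mu]_x (psi (x + v) * phi (x + w)) = corr psi phi (w - v).
  rewrite -(@Rintegral_shift _ (- v)) /corr; last exact: measurable_realfun.measurable_funM.
  by apply: eq_Rintegral => x _; congr (psi _ * phi _); ring.
transitivity (\int[mu]_x ((psi (x + z) * phi (x + z) - psi (x + z) * phi (x + 0)) -
    (psi (x + 0) * phi (x + z) - psi (x + 0) * phi (x + 0)))).
  by apply: eq_Rintegral => x _; rewrite addr0; ring.
rewrite (RintB (intgB (I z z) (I z 0)) (intgB (I 0 z) (I 0 0))).
rewrite (RintB (I z z) (I z 0)) (RintB (I 0 z) (I 0 0)).
by rewrite !S !subrr subr0 sub0r; ring.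
Qed.

(** By [diffcorrE] the derivative is [corr psi (derive1 phi)] at [- z] minus its value at [z]. It is
    odd, hence 0 at the origin, and its bounded derivative makes it [O(|z|)]. The two bounds on [d1]
    serve the boundary terms of the later integration by parts, one at 0 and one at infinity. *)
Lemma diffcorr_derive2 psi phi : tf psi -> tf phi -> exists d1 : R -> R,
  [/\ forall z : R, is_derive z 1 (diffcorr psi phi) (d1 z),
      forall z : R, is_derive z 1 d1
        (- corr psi (derive1 (derive1 phi)) (- z) - corr psi (derive1 (derive1 phi)) z),
      d1 0 = 0 & exists C : R, forall z, `|d1 z| <= C /\ `|d1 z| <= C * `|z|].
Proof.
move=> ts tp; have int_s := tf_integrable ts; have tp1 := tf_derive1 tp; have tp2 := tf_derive1 tp1.
have dN (g : R -> R) (g' : R -> R) (z : R) : (forall w : R, is_derive w 1 g (g' w)) ->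
    is_derive z 1 (fun w : R => g (- w)) (- g' (- z)).
  move=> dg; have := @is_derive_affine _ g (-1) 0 z (g' (- z)).
  rewrite mulN1r addr0 mulN1r => /(_ (dg _)).
  by congr (is_derive _ _ _ _); apply/funext => w; rewrite mulN1r addr0.
have dc h : tf h -> forall w : R, is_derive w 1 (corr psi h) (corr psi (derive1 h) w).
  by move=> th w; exact: is_derive_corr.
exists (fun z => corr psi (derive1 phi) (- z) - corr psi (derive1 phi) z); split.
- move=> z; have -> : diffcorr psi phi = (cst (2 * corr psi phi 0) - corr psi phi) - (fun z => corr psi phi (- z)).
    by apply/funext => w; rewrite diffcorrE.
  have h1 := dc _ tp z; have h2 := dN _ _ z (dc _ tp).
  by apply: is_derive_eq; rewrite sub0r opprK addrC.
- move=> z; have h1 := dc _ tp1 z; have h2 := dN _ _ z (dc _ tp1).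
  exact: (is_deriveB h2 h1).
- by rewrite oppr0 subrr.
- have [C C0 hC] := corr_bounded int_s tp1; have [C' C'0 hC'] := corr_bounded int_s tp2.
  exists ((C + C) + (C' + C')) => z; split.
    by apply: le_trans (ler_normB _ _) _; apply: le_trans (lerD (hC _) (hC _)) _; rewrite lerDl addr_ge0.
  pose e1 w := corr psi (derive1 phi) (- w) - corr psi (derive1 phi) w.
  apply: (@le_trans _ _ ((C' + C') * `|z|)); last by rewrite ler_wpM2r// lerDr addr_ge0.
  have de1 (w : R) : is_derive w 1 e1
      (- corr psi (derive1 (derive1 phi)) (- w) - corr psi (derive1 (derive1 phi)) w).
    have h1 := dc _ tp1 w; have h2 := dN _ _ w (dc _ tp1); exact: (is_deriveB h2 h1).
  have e10 : e1 0 = 0 by rewrite /e1 oppr0 subrr.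
  have : `|e1 z - e1 0| <= (C' + C') * `|z - 0|; last by rewrite e10 !subr0.
  apply: (@derive_bound_lipschitz _ e1 _ (C' + C') de1) => w.
  by apply: le_trans (ler_normB _ _) _; rewrite normrN; exact: lerD.
Qed.

(* The Taylor bound at 0 makes the singular weight [z ^ (-1 - al)] integrable
   against the difference correlation. *)
Lemma diffcorr_bounds psi phi : tf psi -> tf phi ->
  exists C : R, [/\ forall z, `|diffcorr psi phi z| <= C * z ^+ 2, forall z, `|diffcorr psi phi z| <= C &
   continuous (diffcorr psi phi)].
Proof.
move=> ts tp; have int_s := tf_integrable ts; have tp2 := tf_derive1 (tf_derive1 tp).
have [d1 [h1 _ _ [C d1C]]] := diffcorr_derive2 ts tp.
have d1b z : `|d1 z| <= C * `|z| by case: (d1C z).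
have C0 : 0 <= C by apply: le_trans (proj1 (d1C 0)); exact: normr_ge0.
have [C' C'0 hC'] := corr_bounded int_s tp.
have cD : continuous (diffcorr psi phi) by move=> z; exact: is_derive_continuous (h1 z).
have D0 : diffcorr psi phi 0 = 0 by rewrite diffcorrE// oppr0; ring.
have b1 z : `|diffcorr psi phi z| <= C * z ^+ 2.
  have zz : C * z ^+ 2 = C * `|z| * `|z|.
    by rewrite -mulrA -expr2 -normrX ger0_norm ?sqr_ge0.
  case: (ltgtP z 0) => [z0|z0|->]; last by rewrite D0 normr0 expr0n mulr0.
  - have [c + E] := MVT z0 (fun w _ => h1 w) (continuous_subspaceT cD).
    rewrite in_itv /= => /andP[zc c0].
    have -> : diffcorr psi phi z = d1 c * z by move: E; rewrite D0; lra.
    rewrite normrM zz ler_wpM2r//; apply: le_trans (d1b c) _.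
    rewrite ler_wpM2l ?C0// !ltr0_norm//; lra.
  - have [c + E] := MVT z0 (fun w _ => h1 w) (continuous_subspaceT cD).
    rewrite in_itv /= => /andP[zc c0].
    have -> : diffcorr psi phi z = d1 c * z by move: E; rewrite D0; lra.
    rewrite normrM zz ler_wpM2r//; apply: le_trans (d1b c) _.
    rewrite ler_wpM2l ?C0// !gtr0_norm//; lra.
exists (C + 4 * C'); split => [z|z|//].
  by apply: le_trans (b1 z) _; rewrite ler_wpM2r ?sqr_ge0// lerDl mulr_ge0.
rewrite diffcorrE//; have := hC' 0; have := hC' z; have := hC' (- z).
rewrite !ler_norml; move=> /andP[? ?] /andP[? ?] /andP[? ?]; apply/andP; split; lra.
Qed.

End Correlation.

Section CorrelationE.
Context {R : realType}.
Notation mu := (@lebesgue_measure R).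
Implicit Types f g : R -> R.

Lemma corrE f g z : corr f g z = \int[mu]_x (f x * g (x + z)).
Proof. by []. Qed.

Lemma diffcorrP f g z :
  diffcorr f g z = \int[mu]_x ((f (x + z) - f x) * (g (x + z) - g x)).
Proof. by []. Qed.

Lemma energyE al f g :
  energy al f g = \int[mu]_(z in `]0, +oo[) (z `^ (-1 - al) * diffcorr f g z).
Proof. by []. Qed.

End CorrelationE.

(* Unification must not unfold these integrals. *)
#[global] Opaque corr diffcorr energy.

Section Squeeze.
Context {R : realType}.

Lemma cvg0_squeeze (K e : nat -> R) : (forall n, `|K n| <= e n) ->
  e @ \oo --> 0 -> K @ \oo --> 0.
Proof.
move=> Ke e0; apply/norm_cvg0P; apply: (squeeze_cvgr _ (cvg_cst 0) e0).
by apply: nearW => n; rewrite normr_ge0 Ke.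
Qed.

Lemma cvg0_le_powR (K : nat -> R) (q B : R) : q < 0 ->
  (forall n, `|K n| <= B * n.+2%:R `^ q) -> K @ \oo --> 0.
Proof.
move=> q0 hK; apply: (cvg0_squeeze hK).
rewrite -(mulr0 B); apply: cvgMr.
apply: (cvg_comp (fun n : nat => n.+2%:R : R) (fun z : R => z `^ q) _ (powR_cvgy0 q0)).
apply/cvgryPge => A; exists (Num.truncn A) => // n /= hn.
by apply: le_trans (ltW (truncnS_gt _)) _; rewrite ler_nat ltnW// ltnS ltnW.
Qed.

End Squeeze.

(** * The energy form and integration by parts in the shift *)

Section Energy.
Context {R : realType}.
Notation mu := (@lebesgue_measure R).
Variables a b al : R.
Hypothesis ab : a < b.
Hypothesis al1 : 1 < al.
Hypothesis al2 : al < 2.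
Notation Om := (`]a, b[%classic : set R).
Notation tf := (test_function Om).
Notation pos := (`]0, +oo[%classic : set R).
Local Ltac lras := move: (ab) (al1) (al2) => ? ? ?; lra.
Implicit Types f g phi psi : R -> R.

Let mpos : measurable (pos : set (measurableTypeR R)).
Proof. exact: measurable_itv. Qed.

Lemma energy_integrable psi phi : tf psi -> tf phi ->
  mu.-integrable pos (fun z => (z `^ (-1 - al) * diffcorr psi phi z)%:E).
Proof.
move=> ts tp; have [C [h1 h2 cD]] := diffcorr_bounds ab ts tp.
have al0 : 0 < al by lras.
apply: (@integrable_powR_dominated _ _ C) => //.
by apply: measurable_funTS; exact: continuous_measurableR.
Qed.

Lemma diffcorrC psi phi : diffcorr psi phi = diffcorr phi psi.
Proof. by apply/funext => z; rewrite !diffcorrP; apply: eq_Rintegral => x _; rewrite mulrC. Qed.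

Lemma energyC psi phi : energy al psi phi = energy al phi psi.
Proof. by rewrite !energyE diffcorrC. Qed.

Lemma diffcorr_int psi phi z : tf psi -> tf phi ->
  mu.-integrable [set: R] (EFin \o (fun x => (psi (x + z) - psi x) * (phi (x + z) - phi x))).
Proof.
move=> ts tp; have [M M0 hM] := tf_bounded (ltW ab) tp.
have mp w : measurable_fun [set: R] (fun x => phi (x + w)).
  by apply: measurable_shift_fun; apply: continuous_measurableR; exact: tf_continuous tp.
apply: (@integrable_mul_bounded _ (fun x => psi (x + z) - psi x) _ (M + M)).
- apply: intgB; last exact: tf_integrable ts.
  exact: (integrable_shift z (tf_integrable ts)).
- apply: measurable_realfun.measurable_funB => //.
  by apply: continuous_measurableR; exact: tf_continuous tp.
- by move=> x; apply: le_trans (ler_normB _ _) _; exact: lerD.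
Qed.

Lemma diffcorrDl psi1 psi2 phi z : tf psi1 -> tf psi2 -> tf phi ->
  diffcorr (fun x => psi1 x + psi2 x) phi z = diffcorr psi1 phi z + diffcorr psi2 phi z.
Proof.
move=> t1 t2 tp; rewrite !diffcorrP -RintD; [|exact: diffcorr_int..].
by apply: eq_Rintegral => x _; ring.
Qed.

Lemma diffcorrZl (k : R) psi phi z : tf psi -> tf phi ->
  diffcorr (fun x => k * psi x) phi z = k * diffcorr psi phi z.
Proof.
move=> t1 tp; rewrite !diffcorrP -RintZ; last exact: diffcorr_int.
by apply: eq_Rintegral => x _; ring.
Qed.

Lemma energyDl psi1 psi2 phi : tf psi1 -> tf psi2 -> tf phi ->
  energy al (fun x => psi1 x + psi2 x) phi = energy al psi1 phi + energy al psi2 phi.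
Proof.
move=> t1 t2 tp; rewrite !energyE.
have i1 := energy_integrable t1 tp; have i2 := energy_integrable t2 tp.
rewrite -(RintegralD mpos i1 i2).
by apply: eq_Rintegral => z _; rewrite diffcorrDl// mulrDr.
Qed.

Lemma energyZl (k : R) psi phi : tf psi -> tf phi ->
  energy al (fun x => k * psi x) phi = k * energy al psi phi.
Proof.
move=> t1 tp; rewrite !energyE.
have i1 := energy_integrable t1 tp.
rewrite -(RintegralZl k mpos i1).
by apply: eq_Rintegral => z _; rewrite diffcorrZl// mulrCA.
Qed.

Lemma energy_ge0 phi : 0 <= energy al phi phi.
Proof.
rewrite energyE; apply: Rintegral_ge0 => z _; rewrite mulr_ge0 ?powR_ge0//.
by rewrite diffcorrP; apply: Rintegral_ge0 => x _; rewrite -expr2 sqr_ge0.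
Qed.

(** Dominated convergence with [|H|] itself as majorant. It allows the fundamental theorem of
    calculus to be applied on segments that avoid the singularity at 0. *)
Lemma cvg_Rintegral_segments (H : R -> R) (l : R) : mu.-integrable pos (EFin \o H) ->
  (fun n : nat => \int[mu]_(z in `[n.+2%:R^-1, n.+2%:R]) H z) @ \oo --> l ->
  \int[mu]_(z in pos) H z = l.
Proof.
move=> iH cl.
pose Fn (n : nat) : set R := `[n.+2%:R^-1, n.+2%:R]%classic.
have mFn n : measurable (Fn n : set (measurableTypeR R)) by exact: measurable_itv.
have FnP n : Fn n `<=` pos.
  by move=> z; rewrite /Fn /= !in_itv /= andbT => /andP[h _]; apply: lt_le_trans h; rewrite invr_gt0.
have mH : measurable_fun pos (EFin \o H) := measurable_int mu iH.
pose fn n := ((EFin \o H) \_ (Fn n)).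
have := @dominated_convergence _ _ _ mu pos mpos fn (EFin \o H) (fun z => `|(EFin \o H) z|)%E.
case.
- move=> n; apply/(measurable_restrict _ (mFn n) mpos).
  by apply: measurable_funS mH => //; exact: subIsetl.
- exact: mH.
- apply: aeW => z /=; rewrite in_itv /= andbT => z0.
  apply: cvg_near_cst; near=> n; rewrite /fn patchE ifT// inE /Fn /= in_itv /=; apply/andP; split.
    have : z^-1 <= n.+2%:R.
      near: n; exists (Num.truncn z^-1).+1 => // n /= hn.
      apply: (@le_trans _ _ (n%:R)); last by rewrite ler_nat ltnW// ltnW.
      by apply: le_trans (ltW (truncnS_gt _)) _; rewrite ler_nat.
    by move=> h; rewrite -[leRHS]invrK lef_pV2 ?posrE ?invr_gt0.
  near: n; exists (Num.truncn z).+1 => // n /= hn.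
  apply: (@le_trans _ _ (n%:R)); last by rewrite ler_nat ltnW// ltnW.
  by apply: le_trans (ltW (truncnS_gt _)) _; rewrite ler_nat.
- by apply: integrable_abse.
- apply: aeW => z n _; rewrite /fn patchE; case: ifP => // _.
  by rewrite abse0; exact: abse_ge0.
move=> _ _ c1; rewrite /Rintegral.
have c2 : (\int[mu]_(z in pos) fn n z @[n --> \oo] --> l%:E)%E.
  have -> : (fun n => \int[mu]_(z in pos) fn n z)%E =
      (fun n => (\int[mu]_(z in `[n.+2%:R^-1, n.+2%:R]) H z)%:E).
    apply/funext => n; rewrite -integral_mkcondr setIidr//= /Rintegral fineK//.
    have := integrable_fin_num (mFn n) (integrableS mpos (mFn n) (FnP n) iH).
    by [].
  by apply/fine_cvgP; split; [exact: nearW|exact: cl].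
by rewrite (cvg_unique _ c1 c2).
Unshelve. all: by end_near. Qed.

Lemma intD_on (D : set R) f g : measurable (D : set (measurableTypeR R)) ->
  mu.-integrable D (EFin \o f) -> mu.-integrable D (EFin \o g) ->
  mu.-integrable D (EFin \o (fun x => f x + g x)).
Proof. by move=> mD fi gi; have := integrableD mD fi gi; exact: eq_integrable. Qed.

Lemma intZ_on (D : set R) (k : R) f : measurable (D : set (measurableTypeR R)) ->
  mu.-integrable D (EFin \o f) -> mu.-integrable D (EFin \o (fun x => k * f x)).
Proof. by move=> mD fi; have := integrableZl mD k fi; exact: eq_integrable. Qed.

(** The weight [z ^ (1 - al)] is integrable at 0 but not at infinity, which is why [f] must vanish
    beyond some [L]. *)
Lemma powR_mul_integrable f (C L : R) : 0 < L -> measurable_fun [set: R] f ->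
  (forall z, `|f z| <= C) -> (forall z, L <= z -> f z = 0) ->
  mu.-integrable pos (EFin \o (fun z => z `^ (1 - al) * f z)).
Proof.
move=> L0 mf fC fL.
pose k := (fun z : R => (z `^ (1 - al))%:E) \_ (`]0, L]%classic : set R).
have i1 : mu.-integrable [set: R] k.
  apply/(@integrable_mkcond _ _ _ mu _ _ (measurable_itv _)); apply: integrable_powR_near0 => //; lras.
have i2 : mu.-integrable pos (fun z => C%:E * k z)%E.
  have : mu.-integrable [set: R] (fun z => C%:E * k z)%E by exact: integrableZl.
  by apply: integrableS => //.
apply: le_integrable i2 => //.
  apply/measurable_EFinP; apply: measurable_realfun.measurable_funM.
    by apply: measurable_funTS; exact: measurable_powR.
  exact: measurable_funTS.
move=> z /=; rewrite in_itv /= andbT => z0.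
rewrite /k patchE; case: ifPn => [_|].
  rewrite -EFinM /= lee_fin !normrM mulrC ler_wpM2r//; apply: le_trans (fC _) _; exact: ler_norm.
rewrite notin_setE /= in_itv /= z0 /= => /negP; rewrite -ltNge => bz.
by rewrite fL ?mulr0 ?normr0 ?lee_fin// ltW.
Qed.

Lemma corr_continuous f phi : mu.-integrable [set: R] (EFin \o f) -> tf phi ->
  continuous (corr f phi).
Proof. by move=> fi tp z; apply: is_derive_continuous; exact: (is_derive_corr ab _ fi tp). Qed.

Lemma corr_powR_integrable f phi : mu.-integrable [set: R] (EFin \o f) ->
  (forall x, ~ Om x -> f x = 0) -> tf phi ->
  mu.-integrable pos (EFin \o (fun z => z `^ (1 - al) * corr f phi z)) /\
  mu.-integrable pos (EFin \o (fun z => z `^ (1 - al) * corr f phi (- z))).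
Proof.
move=> fi f0 tp; have [C C0 hC] := corr_bounded ab fi tp.
have mc := continuous_measurableR (corr_continuous fi tp).
have L0 : 0 < b - a by lras.
have p0 := fun x => @tf_out _ _ _ _ x tp.
split; apply: (@powR_mul_integrable _ C (b - a)) => //.
- by move=> z hz; apply: (corr_out f0 p0); exact: le_trans hz (ler_norm z).
- exact: measurable_opp_fun.
- by move=> z hz; apply: (corr_out f0 p0); rewrite normrN; exact: le_trans hz (ler_norm z).
Qed.

(** Two integrations by parts at once: the difference of the two integrands has an explicit
    primitive that tends to 0 at both ends of the half-line. *)
Lemma energy_by_parts psi phi : tf psi -> tf phi ->
  \int[mu]_(z in pos) (z `^ (1 - al) * (corr psi (derive1 (derive1 phi)) z +
     corr psi (derive1 (derive1 phi)) (- z))) = - (al * (al - 1) * energy al psi phi).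
Proof.
move=> ts tp.
have [d1 [h1 h2 d10 [C hC]]] := diffcorr_derive2 ab ts tp.
have [C' [hD2 hD cD]] := diffcorr_bounds ab ts tp.
pose phi2 := derive1 (derive1 phi).
have tp2 : tf phi2 by apply: tf_derive1; exact: tf_derive1.
pose d2 z := - corr psi phi2 (- z) - corr psi phi2 z.
pose H z := z `^ (1 - al) * d2 z - al * (al - 1) * (z `^ (-1 - al) * diffcorr psi phi z).
(* A primitive of [H]: the second term is chosen so that its derivative cancels the term
   [(1 - al) * z ^ (- al) * d1 z] produced by the first. *)
pose G z := z `^ (1 - al) * d1 z + (al - 1) * (z `^ (- al) * diffcorr psi phi z).
have ics : mu.-integrable pos (EFin \o (fun z => z `^ (1 - al) * (corr psi phi2 z + corr psi phi2 (- z)))).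
  have [i1 i2] := corr_powR_integrable (tf_integrable ts) (fun x => @tf_out _ _ _ _ x ts) tp2.
  have -> : (fun z => z `^ (1 - al) * (corr psi phi2 z + corr psi phi2 (- z))) =
     (fun z => z `^ (1 - al) * corr psi phi2 z + z `^ (1 - al) * corr psi phi2 (- z)).
    by apply/funext => z; exact: mulrDr.
  exact: (intD_on mpos i1 i2).
have ie := energy_integrable ts tp.
have iH : mu.-integrable pos (EFin \o H).
  have -> : H = (fun z => -1 * (z `^ (1 - al) * (corr psi phi2 z + corr psi phi2 (- z))) +
      (- (al * (al - 1))) * (z `^ (-1 - al) * diffcorr psi phi z)).
    apply/funext => z; rewrite /H /d2.
    by move: (corr _ _ _) (corr _ _ _) (diffcorr _ _ _) => x1 x2 x3; ring.
  exact: (intD_on mpos (intZ_on (-1) mpos ics) (intZ_on (- (al * (al - 1))) mpos ie)).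
have dG (z : R) : 0 < z -> is_derive z 1 G (H z).
  move=> z0; have p1 := is_derive1_powR (1 - al) z0; have p2 := is_derive1_powR (- al) z0.
  have k1 := h1 z; have k2 := h2 z.
  have e : H z = (z `^ (1 - al) * (- corr psi phi2 (- z) - corr psi phi2 z) + d1 z * ((1 - al) * z `^ (1 - al - 1)))
     + (al - 1) * (z `^ (- al) * d1 z + diffcorr psi phi z * (- al * z `^ (- al - 1))).
    rewrite /H /d2 (_ : 1 - al - 1 = - al); last by ring.
    rewrite (_ : - al - 1 = -1 - al); last by ring.
    move: (corr _ _ _) (corr _ _ _) (diffcorr _ _ _) (d1 z) (_ `^ _) (_ `^ _) (_ `^ _) => x1 x2 x3 x4 x5 x6 x7; ring.
  rewrite e; apply: (@is_deriveD _ _ _ (fun z => z `^ (1 - al) * d1 z) (fun z => (al - 1) * (z `^ (- al) * diffcorr psi phi z))).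
    exact: is_deriveM.
  apply: (@is_deriveZ _ _ _ (fun z => z `^ (- al) * diffcorr psi phi z)); exact: is_deriveM.
have cH (z : R) : 0 < z -> {for z, continuous H}.
  move=> z0; apply: continuousB.
    apply: continuousM; first exact: powR_continuous_gt0.
    have ci := fun w => is_derive_continuous (is_derive_corr ab w (tf_integrable ts) tp2).
    apply: continuousB; last exact: ci.
    by apply: continuousN; apply: continuous_comp; [exact: opp_continuous|exact: ci].
  apply: continuousM; first exact: cst_continuous.
  by apply: continuousM; [exact: powR_continuous_gt0|exact: cD].
have IH0 : \int[mu]_(z in pos) H z = 0.
  apply: cvg_Rintegral_segments => //.
  have -> : (fun n : nat => \int[mu]_(z in `[n.+2%:R^-1, n.+2%:R]) H z) =
      (fun n : nat => G n.+2%:R - G n.+2%:R^-1).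
    apply/funext => n; have n1 : n.+2%:R^-1 < n.+2%:R :> R.
      by apply: (@lt_trans _ _ 1); rewrite ?invf_lt1// ltr1n.
    have n0 (z : R) : n.+2%:R^-1 <= z <= n.+2%:R -> 0 < z.
      by move=> /andP[h _]; apply: lt_le_trans h; rewrite invr_gt0.
    by rewrite /Rintegral (FTC2_segment n1 (fun z hz => dG z (n0 z hz)) (fun z hz => cH z (n0 z hz))).
  have C'0 : 0 <= C' by apply: le_trans (hD 0); exact: normr_ge0.
  have C0 : 0 <= C by apply: le_trans (proj1 (hC 0)); exact: normr_ge0.
  rewrite -[X in _ --> X](subrr (0 : R)); apply: cvgB.
  (* At infinity [d1] and [diffcorr] are bounded, so [G] is [O(z ^ (1 - al))]. *)
  - apply: (@cvg0_le_powR _ _ (1 - al) (C + (al - 1) * C')); first lras.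
    move=> n; rewrite /G; set z : R := n.+2%:R; have z1 : 1 <= z by rewrite ler1n.
    have z0 : 0 < z by lras.
    apply: le_trans (ler_normD _ _) _; rewrite !normrM !(ger0_norm (powR_ge0 _ _)) (@ger0_norm _ (al - 1)); last lras.
    rewrite [leRHS]mulrDl; apply: lerD.
      by rewrite mulrC ler_wpM2r ?powR_ge0//; case: (hC z).
    rewrite -mulrA ler_wpM2l//; first lras.
    rewrite mulrC; apply: ler_pM; rewrite ?powR_ge0//.
    by apply: ler_powR => //; lras.
  (* At 0, [d1] is [O(z)] and [diffcorr] is [O(z ^ 2)], so [G] is [O(z ^ (2 - al))]. Written in
     [w = 1 / z] this is a negative power of [n + 2], as the same lemma expects. *)
  - apply: (@cvg0_le_powR _ _ (al - 2) (C + (al - 1) * C')); first lras.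
    move=> n; rewrite /G; set w : R := n.+2%:R; have w0 : 0 < w by [].
    set z := w^-1; have z0 : 0 < z by rewrite invr_gt0.
    have -> : w `^ (al - 2) = z `^ (2 - al).
      by rewrite /z -(powR_inv1 (ltW w0)) -powRrM; congr (_ `^ _); ring.
    apply: le_trans (ler_normD _ _) _; rewrite !normrM !(ger0_norm (powR_ge0 _ _)) (@ger0_norm _ (al - 1)); last lras.
    have zp (p : R) : z `^ p * z = z `^ (p + 1) by rewrite powRD ?powRr1 ?ltW// (gt_eqF z0) implybT.
    have e1 : z `^ (2 - al) = z `^ (1 - al) * z by rewrite zp; congr (_ `^ _); ring.
    have e2 : z `^ (2 - al) = z `^ (- al) * z ^+ 2 by rewrite expr2 mulrA !zp; congr (_ `^ _); ring.
    rewrite [leRHS]mulrDl; apply: lerD.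
      rewrite e1 mulrCA ler_wpM2l ?powR_ge0//.
      by apply: le_trans (proj2 (hC z)) _; rewrite gtr0_norm.
    rewrite -mulrA ler_wpM2l//; first lras.
    by rewrite e2 mulrCA ler_wpM2l ?powR_ge0.
have : \int[mu]_(z in pos) H z = - (\int[mu]_(z in pos) (z `^ (1 - al) * (corr psi phi2 z + corr psi phi2 (- z)))) - al * (al - 1) * energy al psi phi.
  rewrite energyE -(RintegralZl (al * (al - 1)) mpos ie).
  rewrite -[X in _ = X - _]mulN1r -(RintegralZl (-1) mpos ics).
  rewrite -(RintegralB mpos (intZ_on (-1) mpos ics) (intZ_on (al * (al - 1)) mpos ie)).
  by apply: eq_Rintegral => z _; rewrite /H /d2; move: (corr _ _ _) (corr _ _ _) (diffcorr _ _ _) => x1 x2 x3; ring.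
rewrite IH0; move: (\int[mu]_(z in _) _) (energy _ _ _) => x y; lra.
Qed.

End Energy.

(** * The fractional Laplacian of a test function *)

Section RealFubini.
Context {R : realType}.
Notation mu := (@lebesgue_measure R).
Notation R2 := (measurableTypeR R * measurableTypeR R)%type.

Lemma Rintegral_Fubini (G : R -> R -> R) (A B : R -> R) :
  measurable_fun [set: R2] (fun p : R2 => G p.1 p.2) ->
  mu.-integrable [set: R] (EFin \o A) -> mu.-integrable [set: R] (EFin \o B) ->
  (forall x z, `|G x z| <= A x * B z) ->
  \int[mu]_x \int[mu]_z G x z = \int[mu]_z \int[mu]_x G x z.
Proof.
move=> mG iA iB GAB.
have mG1 x : measurable_fun [set: R] (G x).
  have h : measurable_fun [set: measurableTypeR R] (fun z : measurableTypeR R => (x, z) : R2).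
    by apply: measurable_fun_pair => //; exact: measurable_cst.
  exact: (measurableT_comp mG h).
have mG2 z : measurable_fun [set: R] (G ^~ z).
  have h : measurable_fun [set: measurableTypeR R] (fun x : measurableTypeR R => (x, z) : R2).
    by apply: measurable_fun_pair => //; exact: measurable_cst.
  exact: (measurableT_comp mG h).
have i1 x : mu.-integrable [set: R] (EFin \o G x).
  by apply: (le_intg (intgZ (A x) iB)) => //; exact: GAB.
have i2 z : mu.-integrable [set: R] (EFin \o (G ^~ z)).
  apply: (le_intg (intgZ (B z) iA)) => // x; rewrite mulrC; exact: GAB.
have iG : (mu \x mu)%E.-integrable [set: R2] (fun p : R2 => (G p.1 p.2)%:E).
  apply/integrable12ltyP; first exact/measurable_EFinP.
  apply: (@le_lt_trans _ _ (\int[mu]_x ((\int[mu]_z `|B z|) * `|A x|)%:E)%E).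
    apply: ge0_le_integral => //.
    - by move=> x _; exact: integral_ge0.
    - apply: (@measurable_fun_fubini_tonelli_F _ _ _ _ R mu (fun p : R2 => `|(G p.1 p.2)%:E|)%E) => //.
      by apply: measurableT_comp => //; exact/measurable_EFinP.
    - apply: (measurable_int mu); exact: (intgZ (\int[mu]_z `|B z|) (integrable_norm iA)).
    - move=> x _ /=; rewrite EFinM RintE; last exact: integrable_norm.
      rewrite muleC -ge0_integralZl//=; last by apply: (measurable_int mu); exact: (integrable_norm iB).
      apply: ge0_le_integral => //.
      + by apply: (measurable_int mu); exact: (integrable_norm (i1 x)).
      + apply: (measurable_int mu); exact: (intgZ `|A x| (integrable_norm iB)).
      + move=> z _; rewrite -EFinM lee_fin -normrM; apply: le_trans (GAB _ _) _; exact: ler_norm.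
  rewrite -RintE ?ltry//; exact: (intgZ (\int[mu]_z `|B z|) (integrable_norm iA)).
have F := Fubini iG; rewrite /= in F.
rewrite /Rintegral.
under [in LHS]eq_integral => x _ do rewrite RintE//.
under [in RHS]eq_integral => x _ do rewrite RintE//.
by rewrite F.
Qed.

End RealFubini.

Section FracLapEnergy.
Context {R : realType}.
Notation mu := (@lebesgue_measure R).
Notation R2 := (measurableTypeR R * measurableTypeR R)%type.
Variables a b al : R.
Hypothesis ab : a < b.
Hypothesis al1 : 1 < al.
Hypothesis al2 : al < 2.
Notation Om := (`]a, b[%classic : set R).
Notation tf := (test_function Om).
Notation pos := (`]0, +oo[%classic : set R).
Local Ltac lras := move: (ab) (al1) (al2) => ? ? ?; lra.
Implicit Types f g phi psi : R -> R.

Let mpos : measurable (pos : set (measurableTypeR R)).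
Proof. exact: measurable_itv. Qed.

(** The Riemann-Liouville kernel without its Gamma factor. Cutting it off at 0 turns both one-sided
    integrals into integrals over the whole line. *)
Definition riesz_kernel : R -> R := (fun z : R => z `^ (1 - al)) \_ pos.

Lemma riesz_kernel_gt0 z : 0 < z -> riesz_kernel z = z `^ (1 - al).
Proof. by move=> z0; rewrite /riesz_kernel patchE ifT// inE /= in_itv /= z0. Qed.

Lemma riesz_kernel_le0 z : z <= 0 -> riesz_kernel z = 0.
Proof. by move=> z0; rewrite /riesz_kernel patchE ifF//; apply/negbTE; rewrite notin_setE /= in_itv /= andbT; apply/negP; rewrite -leNgt. Qed.

Lemma measurable_riesz_kernel : measurable_fun [set: R] riesz_kernel.
Proof.
apply/(measurable_restrictT _ mpos); apply: measurable_funTS; exact: measurable_powR.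
Qed.

Lemma Rintegral_pos_riesz_kernel f :
  \int[mu]_(z in pos) (z `^ (1 - al) * f z) = \int[mu]_z (riesz_kernel z * f z).
Proof.
rewrite Rintegral_mkcond; apply: eq_Rintegral => z _; rewrite patchE /riesz_kernel patchE.
by case: ifP => // _; rewrite mul0r.
Qed.

Lemma riesz_kernel_mul_integrable f (C L : R) : 0 < L -> measurable_fun [set: R] f ->
  (forall z, `|f z| <= C) -> (forall z, L <= z -> f z = 0) ->
  mu.-integrable [set: R] (EFin \o (fun z => riesz_kernel z * f z)).
Proof.
move=> L0 mf fC fL.
have := powR_mul_integrable ab al1 al2 L0 mf fC fL.
move/(@integrable_mkcond _ _ _ mu _ _ mpos); apply: eq_integrable => // z _.
by rewrite patchE /= /riesz_kernel patchE; case: ifP => // _; rewrite mul0r.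
Qed.

Lemma RL_leftE f x : measurable_fun [set: R] f ->
  RL_integral_left al f x = (Gamma (2 - al))^-1 * \int[mu]_z (riesz_kernel z * f (x - z)).
Proof.
move=> mf; congr (_ * _).
pose H z := riesz_kernel z * f (x - z).
have mH : measurable_fun [set: R] H.
  apply: measurable_mul; first exact: measurable_riesz_kernel.
  have := measurable_opp_fun (measurable_shift_fun x mf).
  by under [X in _ -> measurable_fun _ X]eq_fun do rewrite addrC.
rewrite -(Rintegral_shift x mH) -(Rintegral_opp (measurable_shift_fun x mH)).
rewrite Rintegral_mkcond; apply: eq_Rintegral => y _; rewrite patchE /H.
rewrite (_ : - y + x = x - y); last by rewrite addrC.
rewrite subKr; case: ifPn => [|].
  by rewrite inE /= in_itv /= => yx; rewrite riesz_kernel_gt0// subr_gt0.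
by rewrite notin_setE /= in_itv /= => /negP; rewrite -leNgt => xy; rewrite riesz_kernel_le0 ?mul0r// subr_le0.
Qed.

Lemma RL_rightE f x : measurable_fun [set: R] f ->
  RL_integral_right al f x = (Gamma (2 - al))^-1 * \int[mu]_z (riesz_kernel z * f (x + z)).
Proof.
move=> mf; congr (_ * _).
pose H z := riesz_kernel z * f (x + z).
have mH : measurable_fun [set: R] H.
  apply: measurable_mul; first exact: measurable_riesz_kernel.
  have := measurable_shift_fun x mf.
  by under [X in _ -> measurable_fun _ X]eq_fun do rewrite addrC.
rewrite -(Rintegral_shift (- x) mH).
rewrite Rintegral_mkcond; apply: eq_Rintegral => y _; rewrite patchE /H.
rewrite (_ : x + (y - x) = y); last by ring.
case: ifPn => [|].
  by rewrite inE /= in_itv /= andbT => yx; rewrite riesz_kernel_gt0// subr_gt0.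
by rewrite notin_setE /= in_itv /= andbT => /negP; rewrite -leNgt => xy; rewrite riesz_kernel_le0 ?mul0r// subr_le0.
Qed.

Lemma measurable_Rintegral2 (G : R -> R -> R) :
  measurable_fun [set: R2] (fun p : R2 => G p.1 p.2) ->
  measurable_fun [set: R] (fun x => \int[mu]_z G x z).
Proof.
move=> mG.
have mp : measurable_fun [set: R2] (fun p : R2 => maxe (G p.1 p.2)%:E 0).
  by apply: measurable_maxe => //; exact/measurable_EFinP.
have mn : measurable_fun [set: R2] (fun p : R2 => maxe (- (G p.1 p.2)%:E)%E 0).
  by apply: measurable_maxe => //; apply: measurableT_comp => //; exact/measurable_EFinP.
have h1 := @measurable_fun_fubini_tonelli_F _ _ _ _ R mu (fun p : R2 => maxe (G p.1 p.2)%:E 0) mp.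
have h2 := @measurable_fun_fubini_tonelli_F _ _ _ _ R mu (fun p : R2 => maxe (- (G p.1 p.2)%:E)%E 0) mn.
have m1 := h1 (fun p => ltac:(by rewrite le_max lexx orbT)).
have m2 := h2 (fun p => ltac:(by rewrite le_max lexx orbT)).
apply: (measurableT_comp (@fine_measurable R setT measurableT)).
have -> : (fun x => \int[mu]_z (G x z)%:E)%E = (fun x => \int[mu]_z (maxe (G x z)%:E 0) - \int[mu]_z (maxe (- (G x z)%:E) 0))%E.
  by apply/funext => x; rewrite integralE; congr (_ - _)%E; apply: eq_integral => z _; rewrite ?funeposE ?funenegE.
exact: (emeasurable_funB m1 m2).
Qed.

(** Fubini, then the translation [x -> x - s * z]. The sign [s] treats both Riemann-Liouville
    integrals together: [s = -1] is the left one, [s = 1] the right one. *)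
Lemma riesz_pairing f phi (M s : R) : measurable_fun [set: R] f -> (forall x, `|f x| <= M) ->
  (forall x, ~ Om x -> f x = 0) -> tf phi -> s = 1 \/ s = -1 ->
  \int[mu]_(x in Om) (\int[mu]_z (riesz_kernel z * f (x + s * z)) * phi x) =
  \int[mu]_z (riesz_kernel z * corr f phi (- (s * z))).
Proof.
move=> mf fM f0 tp hs.
have [C C0 hC] := tf_bounded (ltW ab) tp.
have M0 : 0 <= M by apply: le_trans (fM 0); exact: normr_ge0.
have L0 : 0 < b - a by rewrite subr_gt0.
have mfs : measurable_fun [set: R2] (fun p : R2 => f (p.1 + s * p.2)).
  apply: (measurableT_comp mf); apply: measurable_realfun.measurable_funD => //.
  by apply: measurable_realfun.measurable_funM => //; exact: measurable_cst.
have mfs1 x : measurable_fun [set: R] (fun z => f (x + s * z)).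
  apply: (measurableT_comp mf); apply: measurable_realfun.measurable_funD; first exact: measurable_cst.
  by apply: measurable_realfun.measurable_funM => //; exact: measurable_cst.
(* A shift longer than [b - a] moves every point of [Om] out of [Om], so the kernel can be truncated
   there; only the truncated kernel is integrable, and Fubini needs that. *)
pose kL := (fun z : R => riesz_kernel z) \_ (`]0, b - a]%classic : set R).
have ikL : mu.-integrable [set: R] (EFin \o kL).
  have i0 := @integrable_powR_near0 R (1 - al) (b - a) ltac:(lras) L0.
  have := (@integrable_mkcond _ _ _ mu _ _ (measurable_itv _)).1 i0.
  apply: eq_integrable => // z _; rewrite /kL /= !patchE; case: ifPn => //.
  by rewrite inE /= in_itv /= => /andP[z0 _]; rewrite riesz_kernel_gt0.
(* Here [x] need not lie in [Om], so the range of relevant shifts depends on [x]. *)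
have iz x : mu.-integrable [set: R] (EFin \o (fun z => riesz_kernel z * f (x + s * z))).
  apply: (@riesz_kernel_mul_integrable _ M (`|x| + `|a| + `|b| + 1)) => //.
  move=> z hz; apply: f0 => /=; rewrite in_itv /= => /andP[h1 h2]; move: hz h1 h2.
  have := ler_norm x; have := ler_norm (- x); have := ler_norm (-a); have := ler_norm b; have := normr_ge0 a; have := normr_ge0 b; rewrite !normrN.
  by case: hs => -> ? ? ? ? ? ? ? ? ?; (suff : (0 : R) < 0 by rewrite ltxx); lra.
transitivity (\int[mu]_x \int[mu]_z (riesz_kernel z * f (x + s * z) * phi x)).
  rewrite Rintegral_mkcond; apply: eq_Rintegral => x _; rewrite patchE; case: ifPn => [_|].
    by rewrite [in LHS]mulrC -(RintZ (phi x) (iz x)); apply: eq_Rintegral => z _; rewrite mulrC.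
  rewrite notin_setE => nx; rewrite (tf_out tp nx).
  by under eq_Rintegral do rewrite mulr0; rewrite Rintegral_cst// mul0r.
rewrite (@Rintegral_Fubini _ _ (fun x => M * `|phi x|) kL).
- apply: eq_Rintegral => z _.
  have mfz : measurable_fun [set: R] (fun x => f (x + s * z)) by exact: measurable_shift_fun.
  have ip : mu.-integrable [set: R] (EFin \o (fun x => phi x * f (x + s * z))).
    exact: (integrable_mul_bounded (tf_integrable tp) mfz (fun x => fM _)).
  transitivity (\int[mu]_x (riesz_kernel z * (phi x * f (x + s * z)))).
    by apply: eq_Rintegral => x _; rewrite -mulrA [X in _ * X]mulrC.
  rewrite RintZ//; congr (_ * _); rewrite corrE.
  rewrite -(Rintegral_shift (- (s * z))); last exact: (intg_measurable ip).
  by apply: eq_Rintegral => x _; rewrite subrK mulrC.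
- apply: measurable_realfun.measurable_funM; last first.
    by apply: (measurableT_comp (continuous_measurableR (tf_continuous tp))).
  apply: measurable_realfun.measurable_funM => //.
  exact: (measurableT_comp measurable_riesz_kernel).
- exact: (intgZ M (integrable_norm (tf_integrable tp))).
- exact: ikL.
- move=> x z; rewrite /kL patchE; case: ifPn => [_|].
    rewrite !normrM (@ger0_norm _ (riesz_kernel z)).
      have k0 : 0 <= riesz_kernel z by rewrite /riesz_kernel patchE; case: ifP => // _; exact: powR_ge0.
      rewrite [leRHS]mulrC mulrA ler_wpM2r// ler_wpM2l//.
    by rewrite /riesz_kernel patchE; case: ifP => // _; exact: powR_ge0.
  rewrite notin_setE /= in_itv /= mulr0 => /negP; rewrite negb_and -!leNgt -ltNge normr_le0.
  case/orP => hz; first by rewrite riesz_kernel_le0// !mul0r.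
  have [xO|nx] := pselect (Om x); last by rewrite (tf_out tp nx) mulr0.
  rewrite f0 ?mulr0 ?mul0r//=; move: xO; rewrite /= !in_itv /= => /andP[h1 h2] /andP[h3 h4].
  by case: hs h3 h4 => -> ? ?; (suff : (0 : R) < 0 by rewrite ltxx); lra.
Qed.

Lemma riesz_pairing_integrable f phi (M s : R) : measurable_fun [set: R] f -> (forall x, `|f x| <= M) ->
  (forall x, ~ Om x -> f x = 0) -> tf phi -> s = 1 \/ s = -1 ->
  mu.-integrable [set: R] (EFin \o (fun x => \int[mu]_z (riesz_kernel z * f (x + s * z)) * phi x)).
Proof.
move=> mf fM f0 tp hs.
have [C C0 hC] := tf_bounded (ltW ab) tp.
have M0 : 0 <= M by apply: le_trans (fM 0); exact: normr_ge0.
have L0 : 0 < b - a by rewrite subr_gt0.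
have mfs : measurable_fun [set: R2] (fun p : R2 => f (p.1 + s * p.2)).
  apply: (measurableT_comp mf); apply: measurable_realfun.measurable_funD => //.
  by apply: measurable_realfun.measurable_funM => //; exact: measurable_cst.
have mk : measurable_fun [set: R2] (fun p : R2 => riesz_kernel p.2 * f (p.1 + s * p.2)).
  apply: measurable_realfun.measurable_funM => //.
  exact: (measurableT_comp measurable_riesz_kernel).
have mI := @measurable_Rintegral2 (fun x z => riesz_kernel z * f (x + s * z)) mk.
have k0 z : 0 <= riesz_kernel z by rewrite /riesz_kernel patchE; case: ifP => // _; exact: powR_ge0.
pose kL := (fun z : R => riesz_kernel z) \_ (`]0, b - a]%classic : set R).
have ikL : mu.-integrable [set: R] (EFin \o kL).
  have i0 := @integrable_powR_near0 R (1 - al) (b - a) ltac:(lras) L0.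
  have := (@integrable_mkcond _ _ _ mu _ _ (measurable_itv _)).1 i0.
  apply: eq_integrable => // z _; rewrite /kL /= !patchE; case: ifPn => //.
  by rewrite inE /= in_itv /= => /andP[z0 _]; rewrite riesz_kernel_gt0.
pose B := M * \int[mu]_z kL z.
apply: (@le_intg _ _ (fun x => B * `|phi x|)).
- exact: (intgZ B (integrable_norm (tf_integrable tp))).
- by apply: measurable_mul => //; apply: continuous_measurableR; exact: tf_continuous tp.
move=> x; have [xO|nx] := pselect (Om x); last by rewrite (tf_out tp nx) mulr0 normr0 mulr0.
rewrite normrM ler_wpM2r// /B -RintZ//.
have bnd z : `|riesz_kernel z * f (x + s * z)| <= M * kL z.
  rewrite /kL patchE; case: ifPn => [_|].
    by rewrite normrM ger0_norm// mulrC ler_wpM2r.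
  rewrite notin_setE /= in_itv /= mulr0 => /negP; rewrite negb_and -!leNgt -ltNge normr_le0.
  case/orP => hz; first by rewrite riesz_kernel_le0// mul0r.
  rewrite f0 ?mulr0//=; move: xO; rewrite /= !in_itv /= => /andP[h1 h2] /andP[h3 h4].
  by case: hs h3 h4 => -> ? ?; (suff : (0 : R) < 0 by rewrite ltxx); lra.
have ik : mu.-integrable [set: R] (EFin \o (fun z => riesz_kernel z * f (x + s * z))).
  apply: (le_intg (intgZ M ikL)) => //.
  by apply: measurable_mul; [exact: measurable_riesz_kernel|
    apply: (measurableT_comp mf); apply: measurable_realfun.measurable_funD; [exact: measurable_cst|
    by apply: measurable_realfun.measurable_funM => //; exact: measurable_cst]].
apply: le_trans (le_normr_Rintegral measurableT ik) _.
apply: le_Rint; [exact: integrable_norm|exact: (intgZ M ikL)|exact: bnd].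
Qed.

(** Both derivatives stay on [phi], so [f] is merely bounded with support in [Om]. This generality
    is what lets the formula be used for limits of test functions. *)
Lemma fracLap_distrE f phi (M : R) : measurable_fun [set: R] f -> (forall x, `|f x| <= M) ->
  (forall x, ~ Om x -> f x = 0) -> tf phi ->
  fracLap_distr al Om f phi = (2 * cos (al * pi / 2))^-1 * (Gamma (2 - al))^-1 *
   \int[mu]_(z in pos) (z `^ (1 - al) * (corr f (derive1 (derive1 phi)) z +
     corr f (derive1 (derive1 phi)) (- z))).
Proof.
move=> mf fM f0 tp; have tp2 := tf_derive1 (tf_derive1 tp).
have fi := bounded_supp_integrable ab mf fM f0.
rewrite /fracLap_distr -[RHS]mulrA; congr (_ * _).
have gen s : s = 1 \/ s = -1 ->
  \int[mu]_(x in Om) ((Gamma (2 - al))^-1 * \int[mu]_z (riesz_kernel z * f (x + s * z)) * derive1n 2 phi x) =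
  (Gamma (2 - al))^-1 * \int[mu]_z (riesz_kernel z * corr f (derive1 (derive1 phi)) (- (s * z))).
  move=> hs; rewrite -(riesz_pairing mf fM f0 tp2 hs) -RintegralZl.
  - by apply: eq_Rintegral => x _; rewrite mulrA.
  - exact: measurable_itv.
  - have := riesz_pairing_integrable mf fM f0 tp2 hs; apply: integrableS => //; exact: measurable_itv.
rewrite /RL_deriv_left /RL_deriv_right.
have g1 := gen 1 (or_introl erefl); have g2 := gen (-1) (or_intror erefl).
have [j1 j2] := corr_powR_integrable ab al1 al2 fi f0 tp2.
set f2 := derive1 (derive1 phi); set G := (Gamma (2 - al))^-1.
have l1 : \int[mu]_(x in Om) (RL_integral_left al f x * derive1n 2 phi x) =
    G * \int[mu]_(z in pos) (z `^ (1 - al) * corr f f2 z).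
  apply: (etrans _ (congr1 (fun w => G * w) (esym (Rintegral_pos_riesz_kernel (corr f f2))))).
  transitivity (G * \int[mu]_z (riesz_kernel z * corr f f2 (- (-1 * z)))).
    rewrite -g2; apply: eq_Rintegral => x _; rewrite (RL_leftE x mf); congr (_ * _ * _).
    by apply: eq_Rintegral => z _; rewrite (mulN1r z).
  have e : (fun z => riesz_kernel z * corr f f2 (- (-1 * z))) = (fun z => riesz_kernel z * corr f f2 z).
    by apply/funext => z; rewrite (mulN1r z) (opprK z).
  exact: (congr1 (fun F => G * Rintegral mu setT F) e).
have l2 : \int[mu]_(x in Om) (RL_integral_right al f x * derive1n 2 phi x) =
    G * \int[mu]_(z in pos) (z `^ (1 - al) * corr f f2 (- z)).
  apply: (etrans _ (congr1 (fun w => G * w) (esym (Rintegral_pos_riesz_kernel (fun z => corr f f2 (- z)))))).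
  transitivity (G * \int[mu]_z (riesz_kernel z * corr f f2 (- (1 * z)))).
    rewrite -g1; apply: eq_Rintegral => x _; rewrite (RL_rightE x mf); congr (_ * _ * _).
    by apply: eq_Rintegral => z _; rewrite (mul1r z).
  have e : (fun z => riesz_kernel z * corr f f2 (- (1 * z))) = (fun z => riesz_kernel z * corr f f2 (- z)).
    by apply/funext => z; rewrite (mul1r z).
  exact: (congr1 (fun F => G * Rintegral mu setT F) e).
apply: (etrans (congr2 +%R l1 l2)); apply: (etrans (esym (mulrDr _ _ _))).
apply: (etrans (congr1 (fun w => G * w) (esym (RintegralD mpos j1 j2)))).
have e : (fun z => z `^ (1 - al) * corr f f2 z + z `^ (1 - al) * corr f f2 (- z)) =
    (fun z => z `^ (1 - al) * (corr f f2 z + corr f f2 (- z))).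
  by apply/funext => z; exact: (esym (mulrDr _ _ _)).
exact: (congr1 (fun F => G * Rintegral mu pos F) e).
Qed.

End FracLapEnergy.

(** * The Gagliardo seminorm and its relation to the energy *)

Section Gagliardo.
Context {R : realType}.
Notation mu := (@lebesgue_measure R).
Notation R2 := (measurableTypeR R * measurableTypeR R)%type.
Implicit Types f g phi psi : R -> R.

(* 0 on the diagonal, as 0 / 0 = 0 *)
Definition gagliardo_kernel (al : R) f (x y : R) : R := (f x - f y) ^+ 2 / `|x - y| `^ (1 + al).

Definition gagliardo (al : R) f : \bar R := (\int[mu]_x \int[mu]_y (gagliardo_kernel al f x y)%:E)%E.

Lemma gagliardo_kernel_ge0 al f x y : 0 <= gagliardo_kernel al f x y.
Proof. by rewrite mulr_ge0 ?sqr_ge0// invr_ge0 powR_ge0. Qed.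

Lemma measurable_gagliardo_kernel al f : measurable_fun [set: R] f ->
  measurable_fun [set: R2] (fun p : R2 => gagliardo_kernel al f p.1 p.2).
Proof.
move=> mf.
have m1 : measurable_fun [set: R2] (fun p : R2 => f p.1) by exact: (measurableT_comp mf).
have m2 : measurable_fun [set: R2] (fun p : R2 => f p.2) by exact: (measurableT_comp mf).
apply: measurable_realfun.measurable_funM.
  by apply: measurable_funX; exact: measurable_realfun.measurable_funB.
have -> : (fun p : R2 => (`|p.1 - p.2| `^ (1 + al))^-1) = (fun p : R2 => `|p.1 - p.2| `^ (- (1 + al))).
  by apply/funext => p; rewrite powRN.
apply: (measurableT_comp (@measurable_powR R (- (1 + al)))).
by apply: measurableT_comp => //; exact: measurable_realfun.measurable_funB.
Qed.

Lemma measurable_gagliardo_kernel1 al f x : measurable_fun [set: R] f ->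
  measurable_fun [set: R] (fun y => (gagliardo_kernel al f x y)%:E).
Proof.
move=> /(measurable_gagliardo_kernel al) mg; apply/measurable_EFinP.
have h : measurable_fun [set: measurableTypeR R] (fun z : measurableTypeR R => (x, z) : R2).
  by apply: measurable_fun_pair => //; exact: measurable_cst.
exact: (measurableT_comp mg h).
Qed.

Lemma measurable_gagliardo_inner al f : measurable_fun [set: R] f ->
  measurable_fun [set: R] (fun x => \int[mu]_y (gagliardo_kernel al f x y)%:E)%E.
Proof.
move=> mf.
apply: (@measurable_fun_fubini_tonelli_F _ _ _ _ R mu (fun p : R2 => (gagliardo_kernel al f p.1 p.2)%:E)).
  by apply/measurable_EFinP; exact: measurable_gagliardo_kernel.
by move=> p; rewrite lee_fin gagliardo_kernel_ge0.
Qed.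

End Gagliardo.

Section GagliardoEnergy.
Context {R : realType}.
Notation mu := (@lebesgue_measure R).
Notation R2 := (measurableTypeR R * measurableTypeR R)%type.
Variables a b al : R.
Hypothesis ab : a < b.
Hypothesis al1 : 1 < al.
Hypothesis al2 : al < 2.
Notation Om := (`]a, b[%classic : set R).
Notation tf := (test_function Om).
Notation pos := (`]0, +oo[%classic : set R).
Local Ltac lras := move: (ab) (al1) (al2) => ? ? ?; lra.
Implicit Types f g phi psi : R -> R.

Let mpos : measurable (pos : set (measurableTypeR R)).
Proof. exact: measurable_itv. Qed.

Lemma ge0_even_integral (g : R -> R) : measurable_fun [set: R] g -> (forall z, 0 <= g z) ->
  (forall z, g (- z) = g z) ->
  (\int[mu]_z (g z)%:E = \int[mu]_(z in pos) (g z)%:E + \int[mu]_(z in pos) (g z)%:E)%E.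
Proof.
move=> mg g0 gN.
have mE (D : set R) : measurable_fun D (fun z => (g z)%:E).
  by apply/measurable_EFinP; exact: measurable_funTS.
rewrite -(setUv (pos : set R)) ge0_integral_setU//=; last 4 first.
- exact: measurableC.
- exact: mE.
- by move=> z _; rewrite lee_fin.
- exact/disj_setPCl.
congr (_ + _)%E; rewrite setCitvr.
have := @ge0_integration_by_substitution0 R (fun z => (g z)%:E) (mE _) (fun z => g0 z).
rewrite -integral_itv_obnd_cbnd; last exact: mE.
by move=> ->; apply: eq_integral => z _; rewrite gN.
Qed.

(** Substituting [y = z + x] and exchanging the integrals leaves [|z| ^ (-1 - al)] times the
    difference correlation, which is even in [z]; the two half-lines give the factor 2. *)
Lemma gagliardo_energy phi : tf phi -> gagliardo al phi = (2 * energy al phi phi)%:E.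
Proof.
move=> tp; have cp := tf_continuous tp; have mp := continuous_measurableR cp.
have [C [hD2 hD cD]] := diffcorr_bounds ab tp tp.
have mD := continuous_measurableR cD.
pose F (x z : R) := (phi x - phi (z + x)) ^+ 2 * `|z| `^ (- (1 + al)).
have mF : measurable_fun [set: R2] (fun p : R2 => (F p.1 p.2)%:E).
  apply/measurable_EFinP; apply: measurable_realfun.measurable_funM.
    apply: measurable_funX; apply: measurable_realfun.measurable_funB.
      exact: (measurableT_comp mp).
    by apply: (measurableT_comp mp); exact: measurable_realfun.measurable_funD.
  apply: (measurableT_comp (@measurable_powR R (- (1 + al)))).
  by apply: measurableT_comp.
have F0 (p : R2) : (0 <= (F p.1 p.2)%:E)%E by rewrite lee_fin mulr_ge0 ?sqr_ge0 ?powR_ge0.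
pose g (z : R) := `|z| `^ (- (1 + al)) * diffcorr phi phi z.
have D0 z : 0 <= diffcorr phi phi z.
  by rewrite diffcorrP; apply: Rintegral_ge0 => x _; rewrite -expr2 sqr_ge0.
have mg : measurable_fun [set: R] g.
  apply: measurable_mul => //.
  apply: (measurableT_comp (@measurable_powR R (- (1 + al)))); exact: measurable_realfun.normr_measurable.
transitivity (\int[mu]_x \int[mu]_z (F x z)%:E)%E.
  apply: eq_integral => x _.
  rewrite -(ge0_integral_shift x (measurable_gagliardo_kernel1 al x mp) (fun y => gagliardo_kernel_ge0 al phi x y)).
  apply: eq_integral => z _; rewrite /F /gagliardo_kernel powRN; congr (_ / _ `^ _)%:E.
  by rewrite opprD addrCA subrr addr0 normrN.
rewrite (@fubini_tonelli _ _ _ _ R mu mu (fun p : R2 => (F p.1 p.2)%:E) mF F0) /=.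
transitivity (\int[mu]_z (g z)%:E)%E.
  apply: eq_integral => z _.
  have i1 := diffcorr_int ab z tp tp.
  have i2 := intgZ (`|z| `^ (- (1 + al))) i1.
  rewrite /g diffcorrP -RintZ// RintE//.
  by apply: eq_integral => x _; rewrite /F mulrC (addrC z) -sqrrN opprB expr2.
have -> := @ge0_even_integral g mg (fun z => mulr_ge0 (powR_ge0 _ _) (D0 z)) _.
  have ie := energy_integrable ab al1 al2 tp tp.
  rewrite (_ : (\int[mu]_(z in pos) (g z)%:E)%E = (energy al phi phi)%:E).
    by rewrite -EFinD mulr_natl mulr2n.
  rewrite energyE /Rintegral fineK; last exact: (integrable_fin_num mpos ie).
  apply: eq_integral => z; rewrite inE /= in_itv /= andbT => z0.
  by rewrite /g gtr0_norm// opprD.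
by move=> z; rewrite /g normrN !(diffcorrE ab _ tp tp) opprK addrAC.
Qed.

(** The factor between the operator and the energy. The minus sign and [al * (al - 1)] come from
    [energy_by_parts]; since [cos (al * pi / 2) < 0] for [1 < al < 2], the whole is positive. *)
Definition fracLap_const : R := - ((2 * cos (al * pi / 2))^-1 * (Gamma (2 - al))^-1) * (al * (al - 1)).

Lemma fracLap_const_gt0 : 0 < fracLap_const.
Proof.
have G0 : 0 < Gamma (2 - al) by apply: Gamma_gt0; lras.
have c0 : cos (al * pi / 2) < 0.
  (* After the shift by [pi] the angle lies between [- pi / 2] and 0. *)
  rewrite -(subrK pi (al * pi / 2)) cosDpi oppr_lt0; apply: cos_gt0_pihalf.
  have p0 : 0 < pi :> R := pi_gt0 R.
  by apply/andP; split; move: (al1) (al2) => ? ?; nra.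
rewrite /fracLap_const mulr_gt0//; last by rewrite mulr_gt0; lras.
by rewrite -mulNr mulr_gt0 ?invr_gt0// oppr_gt0 invr_lt0 pmulr_rlt0.
Qed.

Lemma fracLap_distr_energy psi phi : tf psi -> tf phi ->
  fracLap_distr al Om psi phi = fracLap_const * energy al psi phi.
Proof.
move=> ts tp; have [M M0 hM] := tf_bounded (ltW ab) ts.
rewrite (fracLap_distrE ab al1 al2 (continuous_measurableR (tf_continuous ts)) hM (fun x => @tf_out _ _ _ _ x ts) tp).
rewrite (energy_by_parts ab al1 al2 ts tp) /fracLap_const.
by move: (_ * _^-1) (energy _ _ _) => x y; ring.
Qed.

End GagliardoEnergy.

(** * Hoelder estimate *)

Section Morrey.
Context {R : realType}.
Notation mu := (@lebesgue_measure R).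
Variables a b al : R.
Hypothesis ab : a < b.
Hypothesis al1 : 1 < al.
Hypothesis al2 : al < 2.
Notation Om := (`]a, b[%classic : set R).
Notation tf := (test_function Om).
Local Ltac lras := move: (ab) (al1) (al2) => ? ? ?; lra.
Implicit Types (f g phi psi : R -> R) (p q r s t L : R).

Definition avg f (p q : R) : R := (q - p)^-1 * \int[mu]_(x in `[p, q]) f x.

Lemma continuous_segment_integrable f p q : continuous f ->
  mu.-integrable (`[p, q]%classic : set R) (EFin \o f).
Proof.
by move=> cf; apply: continuous_compact_integrable; [exact: segment_compact|exact: continuous_subspaceT].
Qed.

Lemma Rintegral_segment_cst p q (k : R) : p <= q -> \int[mu]_(x in `[p, q]) k = k * (q - p).
Proof.
move=> pq; rewrite Rintegral_cst; last exact: measurable_itv.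
congr (_ * _); rewrite /= lebesgue_measure_itv /= lte_fin.
by move: pq; rewrite le_eqVlt => /predU1P[->|->]; rewrite ?ltxx /= ?subrr.
Qed.

Lemma continuous_sqB f t : continuous f -> continuous (fun x => (f x - t) ^+ 2).
Proof.
move=> cf x; apply: (@continuous_comp _ _ _ (fun x => f x - t) (fun y : R => y ^+ 2)).
  by apply: continuousB; [exact: cf|exact: cst_continuous].
exact: exprn_continuous.
Qed.

(** Jensen's inequality for the square, obtained by integrating the tangent line of [(y - t) ^ 2] at
    the mean [y = m]. *)
Lemma avg_sqdist_le f p q t : continuous f -> p < q ->
  (q - p) * (avg f p q - t) ^+ 2 <= \int[mu]_(x in `[p, q]) (f x - t) ^+ 2.
Proof.
move=> cf pq; set m := avg f p q.
have mI : measurable (`[p, q]%classic : set (measurableTypeR R)) by exact: measurable_itv.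
have fi := @continuous_segment_integrable f p q cf.
have i2 := @continuous_segment_integrable _ p q (continuous_sqB (t := t) cf).
have ck (k : R) : mu.-integrable (`[p, q]%classic : set R) (EFin \o (fun=> k)).
  by apply: continuous_segment_integrable; exact: cst_continuous.
have il : mu.-integrable (`[p, q]%classic : set R) (EFin \o (fun x => 2 * (m - t) * f x + (t ^+ 2 - m ^+ 2))).
  exact: (intD_on mI (intZ_on (2 * (m - t)) mI fi) (ck _)).
have E : \int[mu]_(x in `[p, q]) (2 * (m - t) * f x + (t ^+ 2 - m ^+ 2)) = (q - p) * (m - t) ^+ 2.
  rewrite (RintegralD mI (intZ_on (2 * (m - t)) mI fi) (ck _)) (RintegralZl (2 * (m - t)) mI fi).
  rewrite (Rintegral_segment_cst _ (ltW pq)).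
  have -> : \int[mu]_(x in `[p, q]) f x = (q - p) * m.
    by rewrite /m /avg mulrA mulfV ?mul1r// subr_eq0 gt_eqF.
  have R1 (w : R) : 2 * (w - t) * ((q - p) * w) + (t ^+ 2 - w ^+ 2) * (q - p) = (q - p) * (w - t) ^+ 2 by ring.
  exact: R1.
rewrite -E; apply: le_Rintegral => // x _.
have R2 (w y : R) : 2 * (w - t) * y + (t ^+ 2 - w ^+ 2) <= (y - t) ^+ 2 by have := sqr_ge0 (y - w); nra.
exact: R2.
Qed.

(** Jensen in each of the two variables, then [|x - y| <= L] to insert the Gagliardo kernel at the
    price of [L ^ (1 + al)]. *)
Lemma avg_diff_le phi p q r s L : tf phi -> p < q -> r < s -> 0 <= L ->
  (forall x y : R, p <= x <= q -> r <= y <= s -> `|x - y| <= L) ->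
  (q - p) * (s - r) * (avg phi p q - avg phi r s) ^+ 2 <= L `^ (1 + al) * (2 * energy al phi phi).
Proof.
move=> tp pq rs L0 hL; have cp := tf_continuous tp; have mp := continuous_measurableR cp.
set m := avg phi p q.
have mI (u v : R) : measurable (`[u, v]%classic : set (measurableTypeR R)) by exact: measurable_itv.
have isq u v t := @continuous_segment_integrable _ u v (continuous_sqB (t := t) cp).
have msq (D : set R) t : measurable_fun D (fun x => ((phi x - t) ^+ 2)%:E).
  apply/measurable_EFinP; apply: measurable_funTS; apply: continuous_measurableR; exact: continuous_sqB.
rewrite -lee_fin.
apply: (@le_trans _ _ (\int[mu]_(y in `[r, s]) ((q - p) * (phi y - m) ^+ 2)%:E)%E).
  have -> : (\int[mu]_(y in `[r, s]) ((q - p) * (phi y - m) ^+ 2)%:E =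
      ((q - p) * \int[mu]_(y in `[r, s]) (phi y - m) ^+ 2)%:E)%E.
    rewrite -(RintegralZl (q - p) (mI r s) (isq r s m)) /Rintegral fineK//.
    exact: (integrable_fin_num (mI r s) (intZ_on (q - p) (mI r s) (isq r s m))).
  rewrite lee_fin -mulrA; apply: ler_wpM2l; first by rewrite subr_ge0 ltW.
  by have := avg_sqdist_le m cp rs; rewrite -sqrrN opprB.
pose Lk := L `^ (1 + al).
apply: (@le_trans _ _ (\int[mu]_(y in `[r, s]) \int[mu]_x (Lk%:E * (gagliardo_kernel al phi y x)%:E))%E).
  apply: ge0_le_integral => //.
  - by move=> y _; rewrite lee_fin mulr_ge0 ?sqr_ge0// subr_ge0 ltW.
  - apply/measurable_EFinP; apply: measurable_realfun.measurable_funM; first exact: measurable_cst.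
    by apply/measurable_EFinP; exact: msq.
  - apply: (@eq_measurable_fun _ _ _ _ _ (fun y => Lk%:E * \int[mu]_x (gagliardo_kernel al phi y x)%:E)%E).
      move=> y _; rewrite ge0_integralZl//; [exact: measurable_gagliardo_kernel1|by move=> x _; rewrite lee_fin gagliardo_kernel_ge0|by rewrite lee_fin powR_ge0].
    apply: measurable_funTS; apply: emeasurable_funM; [exact: measurable_cst|exact: measurable_gagliardo_inner].
  - move=> y; rewrite /= in_itv /= => hy.
    apply: (@le_trans _ _ (\int[mu]_(x in `[p, q]) ((phi x - phi y) ^+ 2)%:E)%E).
      have -> : (\int[mu]_(x in `[p, q]) ((phi x - phi y) ^+ 2)%:E = (\int[mu]_(x in `[p, q]) (phi x - phi y) ^+ 2)%:E)%E.
        by rewrite /Rintegral fineK//; exact: (integrable_fin_num (mI p q) (isq p q (phi y))).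
      by rewrite lee_fin; have := avg_sqdist_le (phi y) cp pq; rewrite -/m -(sqrrN (m - _)) opprB.
    apply: (@le_trans _ _ (\int[mu]_(x in `[p, q]) (Lk%:E * (gagliardo_kernel al phi y x)%:E))%E).
      apply: ge0_le_integral => //.
      - by move=> x _; rewrite lee_fin sqr_ge0.
      - exact: msq.
      - by apply: measurable_funTS; apply: emeasurable_funM; [exact: measurable_cst|exact: measurable_gagliardo_kernel1].
      - move=> x; rewrite /= in_itv /= => hx; rewrite -EFinM lee_fin /gagliardo_kernel -(sqrrN (phi x - _)) opprB.
        have [->|xy] := eqVneq x y; first by rewrite subrr expr0n /= mul0r mulr0.
        have d0 : 0 < `|y - x| by rewrite normr_gt0 subr_eq0 eq_sym.
        rewrite mulrCA ler_peMr ?sqr_ge0// ler_pdivlMr ?powR_gt0// mul1r.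
        have al0 : 0 <= 1 + al by lras.
        by apply: (ge0_ler_powR al0); rewrite ?nnegrE// distrC; exact: hL.
    apply: ge0_subset_integral => //.
    - by apply: measurable_funTS; apply: emeasurable_funM; [exact: measurable_cst|exact: measurable_gagliardo_kernel1].
    - by move=> x _; rewrite -EFinM lee_fin mulr_ge0 ?powR_ge0 ?gagliardo_kernel_ge0.
apply: (@le_trans _ _ (\int[mu]_y (Lk%:E * \int[mu]_x (gagliardo_kernel al phi y x)%:E))%E).
  have e y : (\int[mu]_x (Lk%:E * (gagliardo_kernel al phi y x)%:E) = Lk%:E * \int[mu]_x (gagliardo_kernel al phi y x)%:E)%E.
    rewrite ge0_integralZl//; [exact: measurable_gagliardo_kernel1|by move=> x _; rewrite lee_fin gagliardo_kernel_ge0|by rewrite lee_fin powR_ge0].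
  under eq_integral do rewrite e.
  apply: ge0_subset_integral => //.
  - by apply: emeasurable_funM; [exact: measurable_cst|exact: measurable_gagliardo_inner].
  - move=> y _; apply: mule_ge0; first by rewrite lee_fin powR_ge0.
    by apply: integral_ge0 => x _; rewrite lee_fin gagliardo_kernel_ge0.
rewrite ge0_integralZl//; last 3 first.
- exact: measurable_gagliardo_inner.
- by move=> y _; apply: integral_ge0 => x _; rewrite lee_fin gagliardo_kernel_ge0.
- by rewrite lee_fin powR_ge0.
by rewrite -[X in (_ * X)%E]/(gagliardo al phi) (gagliardo_energy ab al1 al2 tp) -EFinM.
Qed.

Lemma chain_bound (m : nat -> R) (S rho : R) : 0 <= S -> 0 <= rho -> rho < 1 ->
  (forall k, `|m k - m k.+1| <= S * rho ^+ k) -> forall n, `|m 0 - m n| <= S / (1 - rho).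
Proof.
move=> S0 r0 r1 hm n; have r1' : 0 < 1 - rho by rewrite subr_gt0.
suff H : `|m 0 - m n| <= S * (1 - rho ^+ n) / (1 - rho).
  apply: le_trans H _; rewrite ler_pM2r ?invr_gt0// ler_piMr// gerBl exprn_ge0//.
elim: n => [|n IH]; first by rewrite subrr normr0 expr0 subrr mulr0 mul0r.
apply: le_trans (ler_distD (m n) _ _) _.
apply: le_trans (lerD IH (hm n)) _.
rewrite le_eqVlt; apply/orP; left; apply/eqP; rewrite exprS; field; lra.
Qed.

Lemma powRX (x t : R) k : 0 <= x -> (x ^+ k) `^ t = (x `^ t) ^+ k.
Proof. by move=> x0; rewrite -[LHS](congr1 (fun z => z `^ t) (powR_mulrn k x0)) powRAC powR_mulrn ?powR_ge0. Qed.

(** The factor by which the bound on the jump between consecutive averages shrinks when the interval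
    is halved. It is below 1 because [al > 1], which is where continuity of functions of finite
    energy comes from. *)
Definition morrey_rho : R := Num.sqrt (2^-1 `^ (al - 1)).

Lemma morrey_rho_ge0 : 0 <= morrey_rho.
Proof. exact: sqrtr_ge0. Qed.

Lemma morrey_rho_lt1 : morrey_rho < 1.
Proof.
rewrite /morrey_rho -[X in _ < X]sqrtr1 ltr_sqrt//.
have h : (0 : R) < al - 1 by lras.
have := @gt0_ltr_powR R (al - 1) h 2^-1 1.
by rewrite powR1 => -> //; rewrite ?nnegrE//; lra.
Qed.

(** Telescoping over nested intervals of length [d = l / 2 ^ k] around [w]. Two consecutive ones
    have lengths [d] and [d / 2], so [avg_diff_le] bounds the squared jump of averages by
    [4 * energy * d ^ (al - 1)]; the jumps are thus dominated by a geometric series of ratio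
    [morrey_rho]. *)
Lemma morrey_nested phi (w l : R) (pk qk : nat -> R) : tf phi -> 0 < l ->
  (forall k, qk k = pk k + l / 2 ^+ k) -> (forall k, pk k <= w <= qk k) ->
  (forall k, pk k <= pk k.+1) -> (forall k, qk k.+1 <= qk k) ->
  `|avg phi (pk 0) (qk 0) - phi w| <= Num.sqrt (4 * energy al phi phi * l `^ (al - 1)) / (1 - morrey_rho).
Proof.
move=> tp l0 hq hw hp1 hq1; have E0 := energy_ge0 al phi.
set S := Num.sqrt _; set r := morrey_rho.
have r1' : 0 < 1 - r by rewrite subr_gt0 morrey_rho_lt1.
have d0 k : 0 < l / 2 ^+ k by rewrite divr_gt0// exprn_gt0.
have pq k : pk k < qk k by rewrite hq ltrDl.
pose m k := avg phi (pk k) (qk k).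
have step k : `|m k - m k.+1| <= S * r ^+ k.
  have h := @avg_diff_le phi (pk k) (qk k) (pk k.+1) (qk k.+1) (l / 2 ^+ k) tp (pq k) (pq k.+1) (ltW (d0 k)).
  have {h} : (qk k - pk k) * (qk k.+1 - pk k.+1) * (m k - m k.+1) ^+ 2 <= (l / 2 ^+ k) `^ (1 + al) * (2 * energy al phi phi).
    apply: h => x y /andP[h1 h2] /andP[h3 h4].
    have := hp1 k; have := hq1 k; have := hq k; rewrite ler_norml => *; apply/andP; split; lra.
  have Dk j : qk j - pk j = l / 2 ^+ j by rewrite hq addrAC subrr add0r.
  have dS : l / 2 ^+ k.+1 = l / 2 ^+ k / 2 by rewrite exprSr invfM mulrA.
  rewrite (Dk k) (Dk k.+1) dS.
  set d := l / 2 ^+ k; have dk0 : 0 < d := d0 k.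
  have -> : d `^ (1 + al) = d `^ (al - 1) * d ^+ 2.
    rewrite -(powR_mulrn 2 (ltW dk0)) -powRD ?(gt_eqF dk0) ?implybT//; congr (_ `^ _); ring.
  move=> h.
  have {}h : (m k - m k.+1) ^+ 2 <= 4 * energy al phi phi * d `^ (al - 1).
    have d2 : 0 < d ^+ 2 by rewrite exprn_gt0.
    rewrite -(ler_pM2l d2); move: h; move: (energy _ _ _) (d `^ _) (m k - m k.+1) => e u v; lra.
  rewrite -(@ler_pXn2r _ 2) ?nnegrE ?mulr_ge0 ?sqrtr_ge0 ?exprn_ge0 ?morrey_rho_ge0//.
  rewrite real_normK ?num_real// exprMn sqr_sqrtr ?mulr_ge0 ?powR_ge0//; apply: le_trans h _.
  have -> : d `^ (al - 1) = l `^ (al - 1) * r ^+ k ^+ 2.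
    rewrite exprAC sqr_sqrtr ?powR_ge0// -powRX ?invr_ge0// -powRM ?exprn_ge0 ?invr_ge0 ?(ltW l0)//.
    by rewrite /d exprVn.
  by rewrite mulrA.
have chain := chain_bound (sqrtr_ge0 _) morrey_rho_ge0 morrey_rho_lt1 step.
(* The Lipschitz constant of [phi] only identifies the limit of the averages; it disappears from the
   final bound. *)
have [M M0 hM] := tf_lipschitz (ltW ab) tp.
have lim k : `|m k - phi w| <= M * (l / 2 ^+ k).
  have Md : 0 <= M * (l / 2 ^+ k) by rewrite mulr_ge0// ltW.
  rewrite -(@ler_pXn2r _ 2) ?nnegrE// real_normK ?num_real//.
  have h := avg_sqdist_le (phi w) (tf_continuous tp) (pq k).
  have D : qk k - pk k = l / 2 ^+ k by rewrite hq addrAC subrr add0r.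
  have h2 : \int[mu]_(x in `[pk k, qk k]) (phi x - phi w) ^+ 2 <= (M * (l / 2 ^+ k)) ^+ 2 * (qk k - pk k).
    rewrite -(Rintegral_segment_cst _ (ltW (pq k))); apply: le_Rintegral => //.
    - exact: (@continuous_segment_integrable _ (pk k) (qk k) (continuous_sqB (t := phi w) (tf_continuous tp))).
    - by apply: continuous_segment_integrable; exact: cst_continuous.
    - move=> x; rewrite /= in_itv /= => /andP[x1 x2].
      rewrite -(real_normK (num_real _)) ler_pXn2r ?nnegrE//; apply: le_trans (hM _ _) _.
      rewrite ler_wpM2l//; have /andP[w1 w2] := hw k; have := hq k; rewrite ler_norml => *; apply/andP; split; lra.
  rewrite -(ler_pM2l (d0 k)) -{1}D; apply: le_trans h _; apply: le_trans h2 _; by rewrite D mulrC.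
apply/ler_addgt0Pr => e e0.
(* Enough, since [M * l / e <= k <= 2 ^ k]. *)
pose k := (Num.truncn (M * l / e)).+1.
have hk : M * (l / 2 ^+ k) <= e.
  rewrite mulrA ler_pdivrMr ?exprn_gt0// -ler_pdivrMl// mulrC.
  apply: le_trans (ltW (truncnS_gt _)) _; rewrite -/k -natrX ler_nat.
  by apply: ltnW; exact: ltn_expl.
apply: le_trans (ler_distD (m k) _ _) _; apply: lerD; first exact: chain.
exact: le_trans (lim k) hk.
Qed.

(** The square of twice the bound of [morrey_nested], without the energy and the length: 4 from the
    two end points, 4 from the jump estimate. *)
Definition morrey_const : R := 16 / (1 - morrey_rho) ^+ 2.

Lemma morrey_const_ge0 : 0 <= morrey_const.
Proof. by rewrite divr_ge0// sqr_ge0. Qed.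

(** Morrey's inequality. The average over the interval between [x] and [y] is compared with both end
    values, through intervals shrinking to either end. *)
Lemma morrey phi (x y : R) : tf phi ->
  (phi x - phi y) ^+ 2 <= morrey_const * `|x - y| `^ (al - 1) * energy al phi phi.
Proof.
move=> tp; have E0 := energy_ge0 al phi.
wlog xy : x y / x < y.
  move=> h; have [xy|xy|->] := ltgtP x y; first exact: h.
    by rewrite -sqrrN opprB distrC; exact: h.
  rewrite subrr expr0n /=; apply: mulr_ge0 => //.
  by apply: mulr_ge0; [exact: morrey_const_ge0|exact: powR_ge0].
set l := y - x; have l0 : 0 < l by rewrite subr_gt0.
have -> : `|x - y| = l by rewrite distrC gtr0_norm.
have dl k : l / 2 ^+ k.+1 <= l / 2 ^+ k.
  by rewrite ler_pM2l// lef_pV2 ?posrE ?exprn_gt0// exprS ler_peMl ?exprn_ge0//; lra.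
have dp k : 0 < l / 2 ^+ k by rewrite divr_gt0// exprn_gt0.
have h1 : `|avg phi x y - phi x| <= Num.sqrt (4 * energy al phi phi * l `^ (al - 1)) / (1 - morrey_rho).
  have := @morrey_nested phi x l (fun=> x) (fun k => x + l / 2 ^+ k) tp l0.
  have -> : x + l / 2 ^+ 0 = y by rewrite expr0 divr1 /l addrC subrK.
  apply => // k.
    by rewrite lexx lerDl ltW.
  by rewrite lerD2l.
have h2 : `|avg phi x y - phi y| <= Num.sqrt (4 * energy al phi phi * l `^ (al - 1)) / (1 - morrey_rho).
  have := @morrey_nested phi y l (fun k => y - l / 2 ^+ k) (fun=> y) tp l0.
  have -> : y - l / 2 ^+ 0 = x by rewrite expr0 divr1 /l subKr.
  apply => // k.
  - by rewrite subrK.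
  - by rewrite lexx gerBl ltW.
  - by rewrite lerD2l lerN2.
have r1' : 0 < 1 - morrey_rho by rewrite subr_gt0 morrey_rho_lt1.
have B : `|phi x - phi y| <= 2 * (Num.sqrt (4 * energy al phi phi * l `^ (al - 1)) / (1 - morrey_rho)).
  apply: le_trans (ler_distD (avg phi x y) _ _) _; rewrite mulr_natl mulr2n; apply: lerD => //.
  by rewrite distrC.
have {}B : `|phi x - phi y| ^+ 2 <= (2 * (Num.sqrt (4 * energy al phi phi * l `^ (al - 1)) / (1 - morrey_rho))) ^+ 2.
  rewrite ler_pXn2r ?nnegrE//; apply: mulr_ge0 => //.
  by apply: divr_ge0; [exact: sqrtr_ge0|exact: ltW].
move: B; rewrite real_normK ?num_real// => B; apply: le_trans B _.
rewrite !exprMn sqr_sqrtr ?mulr_ge0 ?powR_ge0// /morrey_const exprVn.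
rewrite le_eqVlt; apply/orP; left; apply/eqP; move: (energy _ _ _) (l `^ _) (_ ^- 2) => u v w; ring.
Qed.

Definition sup_const : R := morrey_const * (b - a) `^ (al - 1).

Lemma sup_const_ge0 : 0 <= sup_const.
Proof. by rewrite mulr_ge0 ?morrey_const_ge0 ?powR_ge0. Qed.

Lemma sup_energy phi (x : R) : tf phi -> (phi x) ^+ 2 <= sup_const * energy al phi phi.
Proof.
move=> tp; have E0 := energy_ge0 al phi.
have [xO|xO] := pselect (Om x); last first.
  by rewrite (tf_out tp xO) expr0n /= mulr_ge0// sup_const_ge0.
have pa : phi a = 0 by apply: (tf_out tp) => /=; rewrite in_itv /= ltxx.
have := morrey x a tp; rewrite pa subr0 => h; apply: le_trans h _.
rewrite ler_wpM2r// ler_wpM2l ?morrey_const_ge0//.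
have h : (0 : R) <= al - 1 by lras.
move: xO => /=; rewrite in_itv /= => /andP[ax xb].
apply: (ge0_ler_powR h); rewrite ?nnegrE//; first by rewrite subr_ge0 ltW.
by rewrite gtr0_norm ?subr_gt0// lerD2r ltW.
Qed.

End Morrey.

(** * Completion in the energy norm *)

Section EnergyForm.
Context {R : realType}.
Notation mu := (@lebesgue_measure R).
Variables a b al : R.
Hypothesis ab : a < b.
Hypothesis al1 : 1 < al.
Hypothesis al2 : al < 2.
Notation Om := (`]a, b[%classic : set R).
Notation tf := (test_function Om).
Implicit Types (f g phi psi : R -> R).

Notation E f := (energy al f f).

Lemma energyBl psi1 psi2 phi : tf psi1 -> tf psi2 -> tf phi ->
  energy al (fun x => psi1 x - psi2 x) phi = energy al psi1 phi - energy al psi2 phi.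
Proof.
move=> t1 t2 tp.
have -> : (fun x => psi1 x - psi2 x) = (fun x => psi1 x + (-1) * psi2 x) by apply/funext => x; rewrite mulN1r.
rewrite (energyDl ab al1 al2) ?(energyZl ab al1 al2) ?mulN1r//; exact: tf_scale.
Qed.

Lemma energyZZ k phi : tf phi -> E (fun x => k * phi x) = k ^+ 2 * E phi.
Proof.
move=> tp; have ts := tf_scale k tp.
rewrite (energyZl ab al1 al2 k tp ts) (energyC al phi (fun x => k * phi x)).
by rewrite (energyZl ab al1 al2 k tp tp) mulrA -expr2.
Qed.

Lemma energy_sq_diff phi psi : tf phi -> tf psi ->
  E (fun x => phi x - psi x) = E phi - 2 * energy al phi psi + E psi.
Proof.
move=> tp ts; have tb := tf_sub tp ts.
rewrite (energyBl tp ts tb) (energyC al phi (fun x => _ - _)) (energyC al psi (fun x => _ - _)).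
rewrite (energyBl tp ts tp) (energyBl tp ts ts) (energyC al psi phi).
by move: (E phi) (energy al phi psi) (E psi) => u v w; ring.
Qed.

Lemma energy_sq_add phi psi : tf phi -> tf psi ->
  E (fun x => phi x + psi x) = E phi + 2 * energy al phi psi + E psi.
Proof.
move=> tp ts; have tb := tf_add tp ts.
rewrite (energyDl ab al1 al2 tp ts tb) (energyC al phi (fun x => _ + _)) (energyC al psi (fun x => _ + _)).
rewrite (energyDl ab al1 al2 tp ts tp) (energyDl ab al1 al2 tp ts ts) (energyC al psi phi).
by move: (E phi) (energy al phi psi) (E psi) => u v w; ring.
Qed.

(* The uniform bound is a consequence of the energy bound, by [sup_energy]. *)
Definition energy_lim (phi_ : nat -> R -> R) (v : R -> R) :=
  [/\ forall n, tf (phi_ n), continuous v, forall x, ~ Om x -> v x = 0 &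
   exists2 e : nat -> R, e @ \oo --> 0 & forall n,
    [/\ 0 <= e n, forall x, `|phi_ n x - v x| <= e n &
     forall m, (n <= m)%N -> E (fun x => phi_ n x - phi_ m x) <= e n]].

Lemma uniform_limit_continuous (phi_ : nat -> R -> R) (v : R -> R) (e : nat -> R) :
  (forall n, continuous (phi_ n)) -> e @ \oo --> 0 ->
  (forall n x, `|phi_ n x - v x| <= e n) -> continuous v.
Proof.
move=> cp e0 hv x; apply/cvgrPdist_le => d d0.
have d3 : 0 < d / 3 by rewrite divr_gt0.
have /cvgrPdist_le/(_ _ d3)[N _ hN] := e0.
have eN : e N <= d / 3.
  by apply: le_trans (hN N (leqnn N)); rewrite /= sub0r normrN ler_norm.
have /cvgrPdist_le/(_ _ d3) := cp N x.
apply: filterS => y hy.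
have := hv N x; have := hv N y; move: hy; rewrite /=.
rewrite !ler_norml => /andP[? ?] /andP[? ?] /andP[? ?]; apply/andP; split; lra.
Qed.

(** The energy controls the supremum on test functions, so a sequence that is Cauchy in energy is
    uniformly Cauchy and has a continuous limit. *)
Lemma energy_cauchy_lim (phi_ : nat -> R -> R) (e : nat -> R) : (forall n, tf (phi_ n)) ->
  e @ \oo --> 0 ->
  (forall n m, (n <= m)%N -> E (fun x => phi_ n x - phi_ m x) <= e n) ->
  exists v, energy_lim phi_ v.
Proof.
move=> tp e0 he.
have e_ge0 n : 0 <= e n by apply: le_trans (he n n (leqnn n)); exact: energy_ge0.
pose K := sup_const a b al; have K0 : 0 <= K := sup_const_ge0 a b al.
pose d (n : nat) : R := Num.sqrt (K * e n).
have d0 : d @ \oo --> 0.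
  rewrite -(@sqrtr0 R); apply: (cvg_comp (fun n => K * e n) Num.sqrt _ (@sqrt_continuous R 0)).
  by rewrite -(mulr0 K); apply: cvgMr.
have hd n m x : (n <= m)%N -> `|phi_ n x - phi_ m x| <= d n.
  move=> nm; rewrite -(@ler_pXn2r _ 2) ?nnegrE ?sqrtr_ge0// real_normK ?num_real//.
  have hs := sup_energy ab al1 al2 x (tf_sub (tp n) (tp m)).
  have -> : d n ^+ 2 = K * e n by rewrite sqr_sqrtr// mulr_ge0.
  by apply: (le_trans hs); apply: ler_wpM2l => //; exact: he.
have cv x : cvgn (fun n => phi_ n x).
  apply/cauchy_cvgP/cauchy_exP => eps eps0.
  have /cvgrPdist_lt/(_ _ eps0)[N _ hN] := d0.
  exists (phi_ N x); exists N => // m /= Nm; apply: le_lt_trans (hd N m x Nm) _.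
  by apply: le_lt_trans (hN N (leqnn N)); rewrite /= sub0r normrN ler_norm.
pose v x := limn (fun n => phi_ n x).
have hv n x : `|phi_ n x - v x| <= d n.
  have c1 : (fun m => `|phi_ n x - phi_ m x|) @ \oo --> `|phi_ n x - v x|.
    by apply: cvg_norm; apply: cvgB; [exact: cvg_cst|exact: cv].
  rewrite -(cvg_lim _ c1)//; apply: limr_le; first by apply/cvg_ex; eexists; exact: c1.
  by exists n => // m /= nm; exact: hd.
exists v; split => //.
- exact: (uniform_limit_continuous (fun n => tf_continuous (tp n)) d0 hv).
- move=> x xO; rewrite /v (_ : (fun n => phi_ n x) = cst 0) ?lim_cst//.
  by apply/funext => n; rewrite (tf_out (tp n) xO).
(* [energy_lim] asks for a single rate, which must serve the uniform and the energy bound. *)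
- exists (fun n => d n + e n); first by rewrite -[0]addr0; exact: cvgD.
  move=> n; split => [|x|m nm].
  + by rewrite addr_ge0// sqrtr_ge0.
  + by apply: le_trans (hv n x) _; rewrite lerDl.
  + by apply: le_trans (he n m nm) _; rewrite lerDr sqrtr_ge0.
Qed.

Lemma Hs_sqnormE u : Hs_sqnorm (al / 2) u = (\int[mu]_x ((u x) ^+ 2)%:E + gagliardo al u)%E.
Proof.
have h : 1 + (al / 2) *+ 2 = 1 + al by rewrite mulr2n; field.
by rewrite /Hs_sqnorm h.
Qed.

Lemma gagliardo_ge0 u : (0 <= gagliardo al u)%E.
Proof. by apply: integral_ge0 => x _; apply: integral_ge0 => y _; rewrite lee_fin gagliardo_kernel_ge0. Qed.

(** The pointwise bound [(r - s) ^ 2 <= 2 * r ^ 2 + 2 * s ^ 2], integrated with values in the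
    extended reals so that finiteness need not be known beforehand. *)
Lemma gagliardo_sub_le (f g h : R -> R) : measurable_fun [set: R] f -> measurable_fun [set: R] g ->
  measurable_fun [set: R] h -> (forall x, f x = g x - h x) ->
  (gagliardo al f <= 2%:E * gagliardo al g + 2%:E * gagliardo al h)%E.
Proof.
move=> mf mg mh fE.
have k0 (k : R -> R) x y : (0 <= (gagliardo_kernel al k x y)%:E)%E by rewrite lee_fin gagliardo_kernel_ge0.
have I0 (k : R -> R) x : (0 <= \int[mu]_y (gagliardo_kernel al k x y)%:E)%E by apply: integral_ge0 => y _; exact: k0.
have m2 (k : R -> \bar R) : measurable_fun [set: R] k -> measurable_fun [set: R] (fun x => 2%:E * k x)%E.
  by move=> mk; apply: emeasurable_funM => //; exact: measurable_cst.
have z2 (k : R -> \bar R) : measurable_fun [set: R] k -> (forall x, 0 <= k x)%E ->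
    (\int[mu]_x (2%:E * k x) = 2%:E * \int[mu]_x k x)%E.
  by move=> mk k_0; rewrite ge0_integralZl.
have eg : (2%:E * gagliardo al g = \int[mu]_x (2%:E * \int[mu]_y (gagliardo_kernel al g x y)%:E))%E.
  exact: esym (z2 _ (measurable_gagliardo_inner al mg) (I0 g)).
have eh : (2%:E * gagliardo al h = \int[mu]_x (2%:E * \int[mu]_y (gagliardo_kernel al h x y)%:E))%E.
  exact: esym (z2 _ (measurable_gagliardo_inner al mh) (I0 h)).
rewrite eg eh [leLHS]/gagliardo {eg eh}.
rewrite -ge0_integralD//; last 4 first.
- by move=> x _; rewrite mule_ge0.
- by apply: m2; exact: measurable_gagliardo_inner.
- by move=> x _; rewrite mule_ge0.
- by apply: m2; exact: measurable_gagliardo_inner.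
apply: ge0_le_integral => //.
- exact: measurable_gagliardo_inner.
- by apply: emeasurable_funD; apply: m2; exact: measurable_gagliardo_inner.
move=> x _; rewrite -(z2 _ (measurable_gagliardo_kernel1 al x mg) (k0 g x)) -(z2 _ (measurable_gagliardo_kernel1 al x mh) (k0 h x)).
rewrite -ge0_integralD//; last 4 first.
- by move=> y _; rewrite mule_ge0.
- by apply: m2; exact: measurable_gagliardo_kernel1.
- by move=> y _; rewrite mule_ge0.
- by apply: m2; exact: measurable_gagliardo_kernel1.
apply: ge0_le_integral => //.
- exact: measurable_gagliardo_kernel1.
- by apply: emeasurable_funD; apply: m2; exact: measurable_gagliardo_kernel1.
move=> y _; rewrite -!EFinM -EFinD lee_fin /gagliardo_kernel !mulrA -mulrDl ler_wpM2r ?invr_ge0 ?powR_ge0//.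
rewrite !fE; have := sqr_ge0 ((g x - g y) + (h x - h y)); move: (g x) (g y) (h x) (h y) => *; nra.
Qed.

Lemma integral_sq_supp_le (f : R -> R) (M : R) : measurable_fun [set: R] f -> 0 <= M ->
  (forall x, `|f x| <= M) -> (forall x, ~ Om x -> f x = 0) ->
  (\int[mu]_x ((f x) ^+ 2)%:E <= (M ^+ 2 * (b - a))%:E)%E.
Proof.
move=> mf M0 fM f0.
have -> : (\int[mu]_x ((f x) ^+ 2)%:E = \int[mu]_(x in Om) ((f x) ^+ 2)%:E)%E.
  rewrite [RHS]integral_mkcond; apply: eq_integral => x _; rewrite patchE; case: ifPn => //.
  by rewrite notin_setE => /f0 ->; rewrite expr0n.
apply: (@le_trans _ _ (\int[mu]_(x in Om) (M ^+ 2)%:E)%E).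
  apply: ge0_le_integral => //.
  - by move=> x _; rewrite lee_fin sqr_ge0.
  - by apply/measurable_EFinP; apply: measurable_funTS; exact: measurable_funX.
  - by move=> x _; rewrite lee_fin -(real_normK (num_real _)) ler_pXn2r ?nnegrE.
rewrite integral_cst /=; last exact: measurable_itv.
by rewrite lebesgue_measure_itv /= lte_fin ab -EFinD -EFinM.
Qed.

Lemma energy_lim_measurable (phi_ : nat -> R -> R) (v : R -> R) : energy_lim phi_ v -> measurable_fun [set: R] v.
Proof. by case=> _ cv _ _; exact: continuous_measurableR. Qed.

(** Approximants at squared distance below [1 / (n + 1)] are Cauchy in energy, so they also converge
    uniformly; [u] agrees with the uniform limit because their [L^2] distance is 0. Continuity and
    the boundary values are available for [v] only. *)
Lemma H0_energy_lim u : H0 (al / 2) Om u ->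
  exists (phi_ : nat -> R -> R) (v : R -> R), energy_lim phi_ v /\ {ae mu, forall x, u x = v x}.
Proof.
move=> [mu_u hu].
have /(@boolp.choice _ _ _)[phi_ hphi] : forall n : nat, exists phi, tf phi /\
    (Hs_sqnorm (al / 2) (fun x => u x - phi x)%R < (n.+1%:R^-1)%:E)%E.
  by move=> n; exact: hu.
have tp n : tf (phi_ n) by case: (hphi n).
have mp n := continuous_measurableR (tf_continuous (tp n)).
have mup n : measurable_fun [set: R] (fun x => u x - phi_ n x) by exact: measurable_realfun.measurable_funB.
have sq_ge0 (f : R -> R) : (0 <= \int[mu]_x ((f x) ^+ 2)%:E)%E by apply: integral_ge0 => x _; rewrite lee_fin sqr_ge0.
have hg n : (gagliardo al (fun x => u x - phi_ n x)%R <= (n.+1%:R^-1)%:E)%E.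
  have [_ /ltW] := hphi n; rewrite Hs_sqnormE; apply: le_trans; exact: leeDr.
have hs n : (\int[mu]_x ((u x - phi_ n x) ^+ 2)%R%:E <= (n.+1%:R^-1)%:E)%E.
  have [_ /ltW] := hphi n; rewrite Hs_sqnormE; apply: le_trans; apply: leeDl; exact: gagliardo_ge0.
have inv0 : (fun n : nat => n.+1%:R^-1 : R) @ \oo --> 0 by exact: cvg_harmonic.
(* The Gagliardo seminorm is twice the energy, so [2 * E] is at most [2 / (n + 1) + 2 / (m + 1)],
   hence at most [4 / (n + 1)]. *)
have he n m : (n <= m)%N -> E (fun x => phi_ n x - phi_ m x) <= 2 * n.+1%:R^-1.
  move=> nm; have td := tf_sub (tp n) (tp m).
  have : ((2 * E (fun x => phi_ n x - phi_ m x))%:E <= (2 * n.+1%:R^-1 + 2 * m.+1%:R^-1)%:E)%E.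
    rewrite -(gagliardo_energy ab al1 al2 td).
    have h := @gagliardo_sub_le (fun x => phi_ n x - phi_ m x) (fun x => u x - phi_ m x) (fun x => u x - phi_ n x)
       (continuous_measurableR (tf_continuous td)) (mup m) (mup n) _.
    apply: le_trans (h _) _; first by move=> x; ring.
    rewrite [X in (_ <= X%:E)%E]addrC.
    have hk k : (2%:E * gagliardo al (fun x => u x - phi_ k x)%R <= (2 * k.+1%:R^-1)%:E)%E.
      by rewrite (EFinM 2 _) lee_pmul2l.
    by rewrite (EFinD (2 * m.+1%:R^-1)); apply: leeD; exact: hk.
  rewrite lee_fin => h.
  have mn : m.+1%:R^-1 <= n.+1%:R^-1 :> R by rewrite lef_pV2 ?posrE// ler_nat.
  move: h mn; move: (E _) (n.+1%:R^-1) (m.+1%:R^-1) => x p r; lra.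
have e0 : (fun n : nat => 2 * n.+1%:R^-1 : R) @ \oo --> 0.
  by rewrite -(mulr0 (2 : R)); apply: cvgMr.
have [v lv] := energy_cauchy_lim tp e0 he; exists phi_, v; split => //.
have [_ cv v0 [d d0 hd]] := lv; have mv := continuous_measurableR cv.
have muv : measurable_fun [set: R] (fun x => u x - v x) by exact: measurable_realfun.measurable_funB.
have msq (f : R -> R) : measurable_fun [set: R] f -> measurable_fun [set: R] (fun x => ((f x) ^+ 2)%:E).
  by move=> mf; apply/measurable_EFinP; exact: measurable_funX.
(* Through [phi_ N]: its distance to [u] is small by choice, its distance to [v] by uniform
   convergence on a bounded support. *)
have I0 : (\int[mu]_x ((u x - v x) ^+ 2)%:E = 0)%E.
  apply/eqP; rewrite eq_le sq_ge0 andbT; apply/lee_addgt0Pr => eps eps0; rewrite add0e.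
  have cv0 : (fun n => 2 * n.+1%:R^-1 + 2 * (d n ^+ 2 * (b - a))) @ \oo --> 0.
    rewrite -[X in _ --> X](addr0 (0 : R)); apply: cvgD => //.
    rewrite -[X in _ --> X](mulr0 (2 : R)); apply: cvgMr.
    rewrite -[X in _ --> X](mul0r (b - a)); apply: cvgMl.
    rewrite -[X in _ --> X](mulr0 (0 : R)); under eq_fun do rewrite expr2.
    exact: cvgM.
  have /cvgrPdist_le/(_ _ eps0)[N _ hN] := cv0.
  have := hN N (leqnn N); rewrite /= sub0r normrN => /(le_trans (ler_norm _)) hN'.
  rewrite -lee_fin in hN'; apply: le_trans hN'.
  apply: (@le_trans _ _ (\int[mu]_x (2%:E * ((u x - phi_ N x) ^+ 2)%:E + 2%:E * ((phi_ N x - v x) ^+ 2)%:E))%E).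
    have mA := msq _ (mup N).
    have mB : measurable_fun [set: R] (fun x => ((phi_ N x - v x) ^+ 2)%:E).
      by apply: msq; exact: measurable_realfun.measurable_funB.
    apply: ge0_le_integral => //.
    - by move=> x _; rewrite lee_fin sqr_ge0.
    - exact: msq.
    - by apply: emeasurable_funD; apply: emeasurable_funM => //; exact: measurable_cst.
    - move=> x _; rewrite -!EFinM -EFinD lee_fin.
      have := sqr_ge0 ((u x - phi_ N x) - (phi_ N x - v x)); move: (u x) (v x) (phi_ N x) => *; nra.
  have mA := msq _ (mup N).
  have mpv : measurable_fun [set: R] (fun x => phi_ N x - v x) by exact: measurable_realfun.measurable_funB.
  have mB := msq _ mpv.
  rewrite ge0_integralD//; last 4 first.
  - by move=> x _; rewrite mule_ge0// lee_fin sqr_ge0.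
  - by apply: emeasurable_funM => //; exact: measurable_cst.
  - by move=> x _; rewrite mule_ge0// lee_fin sqr_ge0.
  - by apply: emeasurable_funM => //; exact: measurable_cst.
  rewrite !ge0_integralZl//; [|by move=> x _; rewrite lee_fin sqr_ge0..].
  rewrite (EFinD (2 * N.+1%:R^-1)); apply: leeD; rewrite (EFinM 2 _) lee_pmul2l//.
  have [dN0 hdN _] := hd N.
  apply: integral_sq_supp_le => // x xO; by rewrite (tf_out (tp N) xO) v0// subrr.
have h0 : (\int[mu]_x `|((u x - v x) ^+ 2)%R%:E| = 0)%E.
  by rewrite -[RHS]I0; apply: eq_integral => x _; rewrite gee0_abs// lee_fin sqr_ge0.
have := (ae_eq_integral_abs mu measurableT (msq _ muv)).1 h0.
apply: filterS => x /(_ I) /= /eqP; rewrite eqe sqrf_eq0 subr_eq0 => /eqP.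
exact.
Qed.

Lemma limn_einf_le_bound (w : (\bar R)^nat) (c : \bar R) : (forall n, w n <= c)%E -> (limn_einf w <= c)%E.
Proof.
move=> h; rewrite limn_einf_lim; apply: lime_le; first exact: is_cvg_einfs.
by apply: nearW => n; apply: le_trans (h n); rewrite /einfs; apply: ereal_inf_lbound; exists n => //=.
Qed.

(** Lower semicontinuity of the seminorm: Fatou in each variable bounds that of [v - phi_ n] by the
    lower limit of those of [phi_ n - phi_ (n + m)]. The index [n + m] makes the Cauchy bound valid
    for every [m]. *)
Lemma energy_lim_H0 (phi_ : nat -> R -> R) (v : R -> R) : energy_lim phi_ v -> H0 (al / 2) Om v.
Proof.
move=> lv; have mv := energy_lim_measurable lv.
have [tp cv v0 [e e0 he]] := lv; split=> // eps eps0.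
have cp n := tf_continuous (tp n).
have gle n : (gagliardo al (fun x => v x - phi_ n x)%R <= (2 * e n)%:E)%E.
  have td m := tf_sub (tp n) (tp (n + m)%N).
  have mtd m := continuous_measurableR (tf_continuous (td m)).
  have pw x : phi_ n x - phi_ (n + m)%N x @[m --> \oo] --> phi_ n x - v x.
    apply: cvgB; first exact: cvg_cst.
    have c1 : (fun m => phi_ m x) @ \oo --> v x.
      apply/subr_cvg0; apply: (cvg0_squeeze _ e0) => m; by have [_ + _] := he m; exact.
    exact: (cvg_comp _ _ (@cvg_addnl n) c1).
  have gv x y : (gagliardo_kernel al (fun x => v x - phi_ n x) x y)%:E =
      limn_einf (fun m => (gagliardo_kernel al (fun x => phi_ n x - phi_ (n + m)%N x) x y)%:E).
    have cg : (gagliardo_kernel al (fun x => phi_ n x - phi_ (n + m)%N x) x y)%:E @[m --> \oo] -->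
        (gagliardo_kernel al (fun x => v x - phi_ n x) x y)%:E; last by have [-> _] := cvg_limn_einf_sup cg.
    apply: cvg_EFin; first exact: nearW.
    rewrite /gagliardo_kernel; apply: cvgMl.
    have c2 : (phi_ n x - phi_ (n + m)%N x) - (phi_ n y - phi_ (n + m)%N y) @[m --> \oo] -->
        (phi_ n x - v x) - (phi_ n y - v y) by exact: cvgB.
    have -> : ((v x - phi_ n x) - (v y - phi_ n y)) ^+ 2 = ((phi_ n x - v x) - (phi_ n y - v y)) ^+ 2 by ring.
    by under eq_fun do rewrite expr2; rewrite expr2; exact: cvgM.
  have in1 x : (\int[mu]_y (gagliardo_kernel al (fun x => v x - phi_ n x) x y)%:E <=
      limn_einf (fun m => \int[mu]_y (gagliardo_kernel al (fun x => phi_ n x - phi_ (n + m)%N x) x y)%:E))%E.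
    under eq_integral do rewrite gv.
    apply: (@fatou _ _ _ mu setT measurableT (fun m y => (gagliardo_kernel al (fun x => phi_ n x - phi_ (n + m)%N x) x y)%:E)).
    - by move=> m; exact: measurable_gagliardo_kernel1.
    - by move=> m y _; rewrite lee_fin gagliardo_kernel_ge0.
  apply: (@le_trans _ _ (\int[mu]_x limn_einf (fun m => \int[mu]_y (gagliardo_kernel al (fun x => phi_ n x - phi_ (n + m)%N x) x y)%:E))%E).
    apply: ge0_le_integral => //.
    - by move=> x _; apply: integral_ge0 => y _; rewrite lee_fin gagliardo_kernel_ge0.
    - by apply: measurable_gagliardo_inner; exact: measurable_realfun.measurable_funB mv (continuous_measurableR (cp n)).
    - apply: measurableT_comp => //; apply: measurable_fun_limn_esup => m.
      by apply: measurableT_comp => //; exact: measurable_gagliardo_inner.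
  apply: le_trans (@fatou _ _ _ mu setT measurableT (fun m x => \int[mu]_y (gagliardo_kernel al (fun x => phi_ n x - phi_ (n + m)%N x) x y)%:E)%E _ _) _.
  - by move=> m; exact: measurable_gagliardo_inner.
  - by move=> m x _; apply: integral_ge0 => y _; rewrite lee_fin gagliardo_kernel_ge0.
  apply: limn_einf_le_bound => m.
  rewrite -[X in (X <= _)%E]/(gagliardo al (fun x => phi_ n x - phi_ (n + m)%N x)) (gagliardo_energy ab al1 al2 (td m)) lee_fin ler_pM2l//.
  by have [_ _] := he n; apply; exact: leq_addr.
have c0 : (fun n => e n ^+ 2 * (b - a) + 2 * e n) @ \oo --> 0.
  rewrite -[X in _ --> X](addr0 (0 : R)); apply: cvgD; last by rewrite -[X in _ --> X](mulr0 (2 : R)); apply: cvgMr.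
  rewrite -[X in _ --> X](mul0r (b - a)); apply: cvgMl.
  by rewrite -[X in _ --> X](mulr0 (0 : R)); under eq_fun do rewrite expr2; exact: cvgM.
have /cvgrPdist_lt/(_ _ eps0)[N _ hN] := c0.
exists (phi_ N); split; first exact: tp.
rewrite Hs_sqnormE.
have := hN N (leqnn N); rewrite /= sub0r normrN => /(le_lt_trans (ler_norm _)) hN'.
rewrite -lte_fin in hN'; apply: le_lt_trans hN'; rewrite EFinD; apply: leeD => //.
have [eN hv _] := he N.
apply: integral_sq_supp_le => //.
- exact: measurable_realfun.measurable_funB mv (continuous_measurableR (cp N)).
- by move=> x; rewrite distrC.
- by move=> x xO; rewrite (tf_out (tp N) xO) v0// subrr.
Qed.

End EnergyForm.

(** * Continuity of the distributional fractional Laplacian *)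

Section Rayleigh.
Context {R : realType}.
Notation mu := (@lebesgue_measure R).
Variables a b al : R.
Hypothesis ab : a < b.
Hypothesis al1 : 1 < al.
Hypothesis al2 : al < 2.
Notation Om := (`]a, b[%classic : set R).
Notation pos := (`]0, +oo[%classic : set R).
Notation tf := (test_function Om).
Implicit Types (f g phi psi : R -> R).

Notation E f := (energy al f f).

Lemma ae_eq_Rintegral (D : set R) (f g : R -> R) : measurable D ->
  measurable_fun D f -> measurable_fun D g -> {ae mu, forall x, f x = g x} ->
  \int[mu]_(x in D) f x = \int[mu]_(x in D) g x.
Proof.
move=> mD mf mg fg; rewrite /Rintegral; congr fine; apply: ae_eq_integral => //.
- exact/measurable_EFinP.
- exact/measurable_EFinP.
- by apply: (@filterS _ _ (ae_filter_ringOfSetsType mu)) fg => x -> _.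
Qed.

(** Allows a member of [H0] to be replaced by its continuous representative inside the operator. *)
Lemma fracLap_distr_ae (u v phi : R -> R) : measurable_fun [set: R] u ->
  measurable_fun [set: R] v -> {ae mu, forall x, u x = v x} ->
  fracLap_distr al Om u phi = fracLap_distr al Om v phi.
Proof.
move=> mu_ mv uv.
have mp (s x : R) : measurable_fun [set: R] (fun y => (s * (x - y)) `^ (1 - al)).
  apply: (measurableT_comp (measurable_powR (1 - al))); apply: measurable_realfun.measurable_funM => //.
  by apply: measurable_realfun.measurable_funB.
have L x : RL_integral_left al u x = RL_integral_left al v x.
  rewrite /RL_integral_left; congr (_ * _).
  have mk : measurable_fun [set: R] (fun y => (x - y) `^ (1 - al)).
    by have := mp 1 x; under eq_fun do rewrite mul1r.
  apply: ae_eq_Rintegral.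
  - exact: measurable_itv.
  - by apply: measurable_funTS; exact: measurable_mul.
  - by apply: measurable_funTS; exact: measurable_mul.
  - by apply: (@filterS _ _ (ae_filter_ringOfSetsType mu)) uv => y ->.
have Rr x : RL_integral_right al u x = RL_integral_right al v x.
  rewrite /RL_integral_right; congr (_ * _).
  have mk : measurable_fun [set: R] (fun y => (y - x) `^ (1 - al)).
    by have := mp (-1) x; under eq_fun do rewrite mulN1r opprB.
  apply: ae_eq_Rintegral.
  - exact: measurable_itv.
  - by apply: measurable_funTS; exact: measurable_mul.
  - by apply: measurable_funTS; exact: measurable_mul.
  - by apply: (@filterS _ _ (ae_filter_ringOfSetsType mu)) uv => y ->.
exact: (congr2 (fun F G : R -> R => (2 * cos (al * pi / 2))^-1 *
  (\int[mu]_(x in Om) (F x * derive1n 2 phi x) + \int[mu]_(x in Om) (G x * derive1n 2 phi x)))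
  (funext L) (funext Rr)).
Qed.

(** The counterpart of [corr_bounded] with the two norms exchanged: it is the supremum of [f] that
    tends to 0 along a uniformly convergent sequence. *)
Lemma corr_sup_le f psi (M z : R) : measurable_fun [set: R] f -> (forall x, `|f x| <= M) -> tf psi ->
  `|corr f psi z| <= M * \int[mu]_x `|psi x|.
Proof.
move=> mf fM tp; have mp := continuous_measurableR (tf_continuous tp).
rewrite corrE.
have -> : \int[mu]_x (f x * psi (x + z)) = \int[mu]_x (psi (x + z) * f x).
  by apply: eq_Rintegral => x _; rewrite mulrC.
apply: (le_trans (@Rintegral_mul_bounded _ (fun x => psi (x + z)) f M _ mf fM)).
  exact: (integrable_shift z (tf_integrable tp)).
have mnp : measurable_fun [set: R] (fun x => `|psi x|) by apply: measurableT_comp.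
by rewrite (Rintegral_shift z mnp).
Qed.

Lemma corrB f g psi (z : R) : mu.-integrable [set: R] (EFin \o f) ->
  mu.-integrable [set: R] (EFin \o g) -> tf psi ->
  corr (fun x => f x - g x) psi z = corr f psi z - corr g psi z.
Proof.
move=> fi gi tp; have mp := continuous_measurableR (tf_continuous tp).
have [M M0 hM] := tf_bounded (ltW ab) tp.
have hMz x : `|psi (x + z)| <= M by exact: hM.
have mz : measurable_fun [set: R] (fun x => psi (x + z)) by exact: (measurable_shift_fun z mp).
rewrite !corrE -(RintB (integrable_mul_bounded fi mz hMz) (integrable_mul_bounded gi mz hMz)).
by apply: eq_Rintegral => x _; rewrite mulrBl.
Qed.

Lemma corr_sum_integrable f psi : mu.-integrable [set: R] (EFin \o f) ->
  (forall x, ~ Om x -> f x = 0) -> tf psi ->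
  mu.-integrable pos (EFin \o (fun z => z `^ (1 - al) * (corr f psi z + corr f psi (- z)))).
Proof.
move=> fi f0 tp; have [i1 i2] := corr_powR_integrable ab al1 al2 fi f0 tp.
have mpos : measurable (pos : set (measurableTypeR R)) by exact: measurable_itv.
by apply: eq_integrable (intD_on mpos i1 i2) => // z _ /=; rewrite mulrDr.
Qed.

(** For a fixed test function the pairing is continuous in the supremum norm, so it passes to
    uniform limits although the operator itself does not. *)
Lemma fracLap_distr_le phi : tf phi -> exists2 C : R, 0 <= C & forall f (M : R),
  measurable_fun [set: R] f -> (forall x, `|f x| <= M) -> (forall x, ~ Om x -> f x = 0) ->
  `|fracLap_distr al Om f phi| <= C * M.
Proof.
move=> tp; have t2 : tf (derive1 (derive1 phi)) by apply: tf_derive1; exact: tf_derive1.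
set psi := derive1 (derive1 phi) in t2 *.
pose A := \int[mu]_x `|psi x|.
have A0 : 0 <= A by apply: Rintegral_ge0.
(* The correlations vanish for shifts of length at least [b - a]; beyond that the kernel would not
   be integrable. *)
pose ind (z : R) : R := \1_(`]0, b - a[%classic : set R) z.
have ba : 0 < b - a by rewrite subr_gt0.
have iF : mu.-integrable pos (EFin \o (fun z => z `^ (1 - al) * ind z)).
  apply: (powR_mul_integrable ab al1 al2 ba (C := 1)).
  - by apply: measurable_indic; exact: measurable_itv.
  - by move=> z; rewrite /ind indicE; case: (_ \in _); rewrite ?normr0 ?normr1.
  - move=> z Lz; rewrite /ind indicE memNset//= in_itv/= => /andP[_]; by rewrite ltNge Lz.
pose I := \int[mu]_(z in pos) (z `^ (1 - al) * ind z).
have I0 : 0 <= I by apply: Rintegral_ge0 => z _; rewrite mulr_ge0 ?powR_ge0// indicE.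
exists (`|(2 * cos (al * pi / 2))^-1 * (Gamma (2 - al))^-1| * (2 * A * I)).
  by rewrite mulr_ge0// !mulr_ge0.
move=> f M mf fM f0.
rewrite (fracLap_distrE ab al1 al2 mf fM f0 tp) -/psi normrM -[leRHS]mulrA; apply: ler_wpM2l => //.
have fi : mu.-integrable [set: R] (EFin \o f) := bounded_supp_integrable ab mf fM f0.
have M0 : 0 <= M by apply: le_trans (fM 0).
have mpos : measurable (pos : set (measurableTypeR R)) by exact: measurable_itv.
have i4 := corr_sum_integrable fi f0 t2.
apply: (le_trans (le_normr_Rintegral mpos i4)).
have i5 := intZ_on (2 * A * M) mpos iF.
apply: (@le_trans _ _ (\int[mu]_(z in pos) (2 * A * M * (z `^ (1 - al) * ind z)))).
  apply: le_Rintegral => //.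
    exact: (integrable_norm i4).
  move=> z /=; rewrite in_itv/= andbT => z0.
  rewrite normrM (ger0_norm (powR_ge0 _ _)) mulrCA ler_wpM2l ?powR_ge0//.
  rewrite /ind indicE; case: (boolP (z \in _)) => [|/negP zi].
    move=> _; rewrite mulr1; apply: le_trans (ler_normD _ _) _.
    have := corr_sup_le z mf fM t2; have := corr_sup_le (- z) mf fM t2.
    rewrite -/A => h1 h2; apply: (le_trans (lerD h2 h1)).
    by have -> : M * A + M * A = 2 * A * M by ring.
  have bz : b - a <= z.
    by rewrite leNgt; apply/negP => zb; apply: zi; rewrite inE/= in_itv/= z0.
  have p0 x : ~ Om x -> psi x = 0 by exact: tf_out.
  have nz : `|z| = z by rewrite ger0_norm// (ltW z0).
  have c1 : corr f psi z = 0 by apply: (corr_out f0 p0); rewrite nz.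
  have c2 : corr f psi (- z) = 0 by apply: (corr_out f0 p0); rewrite normrN nz.
  by rewrite c1 c2 addr0 normr0 mulr0.
rewrite RintegralZl// -/I.
by have -> : 2 * A * M * I = 2 * A * I * M by ring.
Qed.

Lemma fracLap_distrB f g phi (M N : R) : measurable_fun [set: R] f -> (forall x, `|f x| <= M) ->
  (forall x, ~ Om x -> f x = 0) -> measurable_fun [set: R] g -> (forall x, `|g x| <= N) ->
  (forall x, ~ Om x -> g x = 0) -> tf phi ->
  fracLap_distr al Om (fun x => f x - g x) phi = fracLap_distr al Om f phi - fracLap_distr al Om g phi.
Proof.
move=> mf fM f0 mg gN g0 tp.
have t2 : tf (derive1 (derive1 phi)) by apply: tf_derive1; exact: tf_derive1.
have fi : mu.-integrable [set: R] (EFin \o f) := bounded_supp_integrable ab mf fM f0.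
have gi : mu.-integrable [set: R] (EFin \o g) := bounded_supp_integrable ab mg gN g0.
have md : measurable_fun [set: R] (fun x => f x - g x) by exact: measurable_realfun.measurable_funB.
have dM x : `|f x - g x| <= M + N by apply: le_trans (ler_normB _ _) _; exact: lerD.
have d0 x : ~ Om x -> f x - g x = 0 by move=> xO; rewrite f0// g0// subrr.
rewrite (fracLap_distrE ab al1 al2 mf fM f0 tp) (fracLap_distrE ab al1 al2 mg gN g0 tp).
rewrite (fracLap_distrE ab al1 al2 md dM d0 tp) -mulrBr; congr (_ * _).
set psi := derive1 (derive1 phi) in t2 *.
have mpos : measurable (pos : set (measurableTypeR R)) by exact: measurable_itv.
rewrite -(RintegralB mpos (corr_sum_integrable fi f0 t2) (corr_sum_integrable gi g0 t2)).
have e (z : R) : z `^ (1 - al) * (corr (fun x => f x - g x) psi z + corr (fun x => f x - g x) psi (- z)) =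
   z `^ (1 - al) * (corr f psi z + corr f psi (- z)) - z `^ (1 - al) * (corr g psi z + corr g psi (- z)).
  rewrite (corrB z fi gi t2) (corrB (- z) fi gi t2).
  by move: (corr f psi z) (corr g psi z) (corr f psi (- z)) (corr g psi (- z)) => p1 p2 p3 p4; ring.
by apply: eq_Rintegral => z _; exact: e.
Qed.

Lemma energy_lim_fracLap (phi_ : nat -> R -> R) (v phi : R -> R) : energy_lim a b al phi_ v -> tf phi ->
  (fun n => fracLap_const al * energy al (phi_ n) phi) @ \oo --> fracLap_distr al Om v phi.
Proof.
move=> lv tp; have mv := energy_lim_measurable lv.
have [tpn cv v0 [e e0 he]] := lv.
have [M M0 hM] := continuous_bounded_supp (ltW ab) cv v0.
have [C C0 hC] := fracLap_distr_le tp.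
apply/subr_cvg0; apply: (cvg0_squeeze (e := fun n => C * e n)); last first.
  by rewrite -(mulr0 C); apply: cvgMr.
move=> n; have [Mn Mn0 hMn] := tf_bounded (ltW ab) (tpn n).
have mn := continuous_measurableR (tf_continuous (tpn n)).
have [_ hen _] := he n.
rewrite -(fracLap_distr_energy ab al1 al2 (tpn n) tp).
rewrite -(fracLap_distrB mn hMn (fun x => @tf_out _ a b _ x (tpn n)) mv hM v0 tp).
apply: hC => //.
- exact: measurable_realfun.measurable_funB.
- by move=> x xO; rewrite (tf_out (tpn n) xO) v0// subrr.
Qed.

End Rayleigh.

(** * Square-integrable functions on a measurable set *)

Section SquareIntegrable.
Context {R : realType}.
Notation mu := (@lebesgue_measure R).
Variable D : set R.
Hypothesis mD : measurable (D : set (measurableTypeR R)).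
Implicit Types f g : R -> R.

(** No integrability is assumed: if the integral is infinite, [fine] makes both sides 0. *)
Lemma L2normE f : L2norm D f = Num.sqrt (\int[mu]_(x in D) (f x ^+ 2)).
Proof.
rewrite /L2norm /Rintegral unlock /Lnorm.
have -> : (\int[mu]_x `|(EFin \o f \_ D) x| `^ 2 = \int[mu]_(x in D) (f x ^+ 2)%:E)%E.
  rewrite [RHS]integral_mkcond; apply: eq_integral => x _ /=.
  rewrite !patchE; case: ifPn => _; first by rewrite powR_mulrn// real_normK// num_real.
  by rewrite normr0 powR0.
have : (0 <= \int[mu]_(x in D) (f x ^+ 2)%:E)%E by apply: integral_ge0 => x _; rewrite lee_fin sqr_ge0.
case: (\int[mu]_(x in D) (f x ^+ 2)%:E)%E => [r| |]//=.
  by rewrite lee_fin => r0; rewrite powR12_sqrt.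
by move=> _; rewrite sqrtr0 invr_eq0 pnatr_eq0.
Qed.

Lemma L2norm_ge0 f : 0 <= L2norm D f. Proof. by rewrite L2normE sqrtr_ge0. Qed.

Lemma L2norm_sqr f : L2norm D f ^+ 2 = \int[mu]_(x in D) (f x ^+ 2).
Proof. by rewrite L2normE sqr_sqrtr//; apply: Rintegral_ge0 => x _; exact: sqr_ge0. Qed.

Lemma inL2P f : inL2 D f <->
  measurable_fun D f /\ mu.-integrable D (EFin \o (fun x => f x ^+ 2)).
Proof.
have E : (fun x => ((f \_ D) x ^+ 2)%:E) = (EFin \o (fun x => f x ^+ 2)) \_ D.
  by apply/funext => x /=; rewrite !patchE; case: ifPn => // _; rewrite expr0n.
split=> [fL|[mf fi]].
  have := fL; rewrite /inL2 => /andP[]; rewrite inE => mf _; split.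
    by apply/(measurable_restrictT _ mD).
  apply/(integrable_mkcond _ mD); rewrite -E.
  exact: (Lfun2_integrable_sqr fL).
have mfD : measurable_fun [set: R] (f \_ D) by apply/(measurable_restrictT _ mD).
rewrite /inL2; apply/andP; split; rewrite inE//=.
rewrite /finite_norm unlock /Lnorm; apply: poweR_lty.
move/integrableP: fi => [_]; apply: le_lt_trans.
rewrite [leRHS]integral_mkcond le_eqVlt; apply/orP; left; apply/eqP; apply: eq_integral => x _ /=.
rewrite !patchE; case: ifPn => _; last by rewrite normr0 powR0.
by rewrite powR_mulrn// normrX.
Qed.

Lemma inL2_mul f g : inL2 D f -> inL2 D g -> mu.-integrable D (EFin \o (fun x => f x * g x)).
Proof.
move=> /inL2P[mf fi] /inL2P[mg gi].
apply: (le_integrable mD _ _ (integrableD mD fi gi)).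
  by apply/measurable_EFinP; exact: measurable_realfun.measurable_funM.
move=> x _; rewrite /= lee_fin [leRHS]ger0_norm ?addr_ge0 ?sqr_ge0// normrM.
rewrite -(real_normK (num_real (f x))) -(real_normK (num_real (g x))).
have := sqr_ge0 (`|f x| - `|g x|); have := normr_ge0 (f x); have := normr_ge0 (g x).
by move: `|f x| `|g x| => r s; nra.
Qed.

Lemma inL2Z (k : R) f : inL2 D f -> inL2 D (fun x => k * f x).
Proof.
move=> /inL2P[mf fi]; apply/inL2P; split.
  by apply: measurable_realfun.measurable_funM => //; exact: measurable_cst.
have := integrableZl mD (k ^+ 2) fi; apply: eq_integrable => // x _ /=.
by rewrite exprMn.
Qed.

Lemma inL2D f g : inL2 D f -> inL2 D g -> inL2 D (fun x => f x + g x).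
Proof.
move=> fL gL; have fg := inL2_mul fL gL; move/inL2P: fL => [mf fi]; move/inL2P: gL => [mg gi].
apply/inL2P; split; first exact: measurable_realfun.measurable_funD.
have := integrableD mD (integrableD mD fi (integrableZl mD 2 fg)) gi.
by apply: eq_integrable => // x _ /=; rewrite -EFinM -!EFinD; congr EFin; ring.
Qed.

Lemma inL2B f g : inL2 D f -> inL2 D g -> inL2 D (fun x => f x - g x).
Proof.
move=> fL gL; have := inL2D fL (inL2Z (-1) gL).
by under eq_fun do rewrite mulN1r.
Qed.

Lemma inL2_sum (n : nat) (f : 'I_n -> R -> R) : (forall i, inL2 D (f i)) ->
  inL2 D (fun x => \sum_i f i x).
Proof.
move=> fL; have : forall s : seq 'I_n, inL2 D (fun x => \sum_(i <- s) f i x).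
  elim=> [|i s IH].
    under eq_fun do rewrite big_nil; apply/inL2P; split; first exact: measurable_cst.
    by rewrite (_ : _ \o _ = cst 0%E)//; [exact: integrable0|apply/funext => x /=; rewrite expr0n].
  by under eq_fun do rewrite big_cons; exact: inL2D.
exact.
Qed.

Lemma bounded_integrable_on f (M : R) : (mu D < +oo)%E -> measurable_fun D f ->
  (forall x, D x -> `|f x| <= M) -> mu.-integrable D (EFin \o f).
Proof.
move=> Dfin mf fM; apply: measurable_bounded_integrable => //.
exists M; split; first exact: num_real.
by move=> y My x Dx /=; apply: le_trans (fM x Dx) _; exact: ltW.
Qed.

Lemma inL2_integrable f : (mu D < +oo)%E -> inL2 D f -> mu.-integrable D (EFin \o f).
Proof.
move=> Dfin /inL2P[mf fi].
have ci : mu.-integrable D (EFin \o cst (1 : R)) by apply: (bounded_integrable_on (M := 1)) => // x _; rewrite normr1.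
apply: (le_integrable mD _ _ (integrableD mD ci fi)).
  exact/measurable_EFinP.
move=> x _; rewrite /= lee_fin [leRHS]ger0_norm ?addr_ge0 ?sqr_ge0//.
rewrite -(real_normK (num_real (f x))); have := sqr_ge0 (`|f x| - 1); have := normr_ge0 (f x).
by move: `|f x| => r; nra.
Qed.

Lemma L2_cauchy_schwarz f g : inL2 D f -> inL2 D g ->
  `|\int[mu]_(x in D) (f x * g x)| <= L2norm D f * L2norm D g.
Proof.
move=> fL gL; have fg := inL2_mul fL gL.
have := L2norm_ge0 f; have := L2norm_ge0 g.
have := L2norm_sqr f; have := L2norm_sqr g.
move/inL2P: (fL) => [mf fi]; move/inL2P: (gL) => [mg gi].
have quad (s : R) : 0 <= \int[mu]_(x in D) (f x ^+ 2) + 2 * s * \int[mu]_(x in D) (f x * g x) +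
    s ^+ 2 * \int[mu]_(x in D) (g x ^+ 2).
  have i2 : mu.-integrable D (EFin \o (fun x => 2 * s * (f x * g x))).
    by have := integrableZl mD (2 * s) fg; exact: eq_integrable.
  have i3 : mu.-integrable D (EFin \o (fun x => s ^+ 2 * g x ^+ 2)).
    by have := integrableZl mD (s ^+ 2) gi; exact: eq_integrable.
  have i12 : mu.-integrable D (EFin \o (fun x => f x ^+ 2 + 2 * s * (f x * g x))).
    by have := integrableD mD fi i2; exact: eq_integrable.
  rewrite -(RintegralZl (2 * s) mD fg) -(RintegralZl (s ^+ 2) mD gi) -(RintegralD mD fi i2) -(RintegralD mD i12 i3).
  apply: Rintegral_ge0 => x _; have -> : f x ^+ 2 + 2 * s * (f x * g x) + s ^+ 2 * g x ^+ 2 = (f x + s * g x) ^+ 2 by ring.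
  exact: sqr_ge0.
move: (\int[mu]_(x in D) (f x ^+ 2)) (\int[mu]_(x in D) (g x ^+ 2)) (\int[mu]_(x in D) (f x * g x)) quad.
move=> u w v quad hw hu q0 p0; move: quad; rewrite -{}hw -{}hu.
move: (L2norm D f) (L2norm D g) q0 p0 => p q q0 p0 quad.
rewrite -(@ler_pXn2r _ 2) ?nnegrE ?mulr_ge0// real_normK ?num_real// exprMn.
have [q00|q00] := eqVneq q 0.
  have [->|v0] := eqVneq v 0; first by rewrite expr0n mulr_ge0 ?sqr_ge0.
  (* With [q = 0] the quadratic degenerates to an affine function, and this point is chosen to give
     it the value -1. *)
  have := quad (- (p ^+ 2 + 1) / (2 * v)); rewrite q00 expr0n mulr0 addr0.
  have -> : 2 * (- (p ^+ 2 + 1) / (2 * v)) * v = - (p ^+ 2 + 1) by field.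
  lra.
have q1 : 0 < q ^+ 2 by rewrite exprn_gt0// lt0r q00.
(* The minimizer of the quadratic. *)
have := quad (- v / q ^+ 2).
have -> : p ^+ 2 + 2 * (- v / q ^+ 2) * v + (- v / q ^+ 2) ^+ 2 * q ^+ 2 = p ^+ 2 - v ^+ 2 / q ^+ 2.
  by field.
by rewrite subr_ge0 ler_pdivrMr.
Qed.

Lemma Rintegral_sqr_expand f g (t : R) : inL2 D f -> inL2 D g ->
  \int[mu]_(x in D) ((f x + t * g x) ^+ 2) = \int[mu]_(x in D) (f x ^+ 2) +
  2 * t * \int[mu]_(x in D) (f x * g x) + t ^+ 2 * \int[mu]_(x in D) (g x ^+ 2).
Proof.
move=> fL gL; have fg := inL2_mul fL gL.
have [_ fi] := (inL2P f).1 fL; have [_ gi] := (inL2P g).1 gL.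
have i2 := intZ_on (2 * t) mD fg; have i3 := intZ_on (t ^+ 2) mD gi.
have i12 := intD_on mD fi i2.
rewrite -(RintegralZl (2 * t) mD fg) -(RintegralZl (t ^+ 2) mD gi).
rewrite -(RintegralD mD fi i2) -(RintegralD mD i12 i3).
by apply: eq_Rintegral => x _; ring.
Qed.

End SquareIntegrable.

(** * The smallest Dirichlet eigenvalue *)

Section UniformConvergence.
Context {R : realType}.
Notation mu := (@lebesgue_measure R).
Variable D : set R.
Hypothesis mD : measurable (D : set (measurableTypeR R)).
Implicit Types w f g : R -> R.

Lemma integrable_mul_bounded_on w g (M : R) : mu.-integrable D (EFin \o w) ->
  measurable_fun D g -> (forall x, `|g x| <= M) ->
  mu.-integrable D (EFin \o (fun x => w x * g x)).
Proof.
move=> wi mg gM; have mw : measurable_fun D w by apply/measurable_EFinP; exact: measurable_int wi.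
apply: (le_integrable mD _ _ (integrableZl mD M wi)).
  by apply/measurable_EFinP; exact: measurable_realfun.measurable_funM.
move=> x _; rewrite /= lee_fin !normrM mulrC ler_wpM2r//.
by apply: le_trans (gM x) _; exact: ler_norm.
Qed.

Lemma Rintegral_mul_bounded_on w g (M : R) : mu.-integrable D (EFin \o w) ->
  measurable_fun D g -> (forall x, `|g x| <= M) ->
  `|\int[mu]_(x in D) (w x * g x)| <= M * \int[mu]_(x in D) `|w x|.
Proof.
move=> wi mg gM; have i1 := integrable_mul_bounded_on wi mg gM.
apply: (le_trans (le_normr_Rintegral mD i1)).
have ni := integrable_norm wi.
rewrite -(RintegralZl M mD ni); apply: le_Rintegral => //.
- exact: integrable_norm i1.
- by have := integrableZl mD M ni; exact: eq_integrable.
- by move=> x _ /=; rewrite normrM mulrC ler_wpM2r.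
Qed.

Lemma Rintegral_cvg_unif w f (f_ : nat -> R -> R) (e : nat -> R) (M : R) :
  mu.-integrable D (EFin \o w) -> measurable_fun D f -> (forall x, `|f x| <= M) ->
  (forall n, measurable_fun D (f_ n)) -> (forall n x, `|f_ n x - f x| <= e n) ->
  e @ \oo --> 0 ->
  (fun n => \int[mu]_(x in D) (w x * f_ n x)) @ \oo --> \int[mu]_(x in D) (w x * f x).
Proof.
move=> wi mf fM mfn he e0; apply/subr_cvg0.
apply: (cvg0_squeeze (e := fun n => e n * \int[mu]_(x in D) `|w x|)); last first.
  by rewrite -(mul0r (\int[mu]_(x in D) `|w x|)); apply: cvgMl.
move=> n; have fnM x : `|f_ n x| <= e n + M.
  have -> : f_ n x = (f_ n x - f x) + f x by rewrite subrK.
  by apply: le_trans (ler_normD _ _) _; exact: lerD.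
rewrite -(RintegralB mD (integrable_mul_bounded_on wi (mfn n) fnM) (integrable_mul_bounded_on wi mf fM)).
have -> : \int[mu]_(x in D) (w x * f_ n x - w x * f x) = \int[mu]_(x in D) (w x * (f_ n x - f x)).
  by apply: eq_Rintegral => x _; rewrite mulrBr.
by apply: Rintegral_mul_bounded_on => //; exact: measurable_realfun.measurable_funB.
Qed.

End UniformConvergence.

(** * Uniform compactness of Hoelder-bounded families *)

Section HolderCompactness.
Context {R : realType}.

(* The limit is taken pointwise along an ultrafilter finer than [\oo]; the
   Hoelder bound makes it uniform through a finite grid. *)
Lemma holder_compact (a b : R) (phi_ : nat -> R -> R) (S C gam : R) : 0 < gam -> 0 <= C ->
  (forall n (x : R), `|phi_ n x| <= S) ->
  (forall n (x y : R), (phi_ n x - phi_ n y) ^+ 2 <= C * `|x - y| `^ gam) ->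
  (forall n x, ~ `]a, b[%classic x -> phi_ n x = 0) ->
  exists v : R -> R, forall (eps : R) N, 0 < eps -> exists2 n, (N <= n)%N &
    forall (x : R), `|phi_ n x - v x| <= eps.
Proof.
move=> gam0 C0 hS hC out.
have [U [UU sU]] := @ultraFilterLemma nat \oo _.
(* The values at [x] stay in the compact [[- S, S]], hence cluster at some [l]; along an ultrafilter
   a cluster point is a limit. *)
have cvx (x : R) : exists l : R, (fun n => phi_ n x) @ U --> l.
  have h1 : ((fun n => phi_ n x) @ U) `[- S, S]%classic.
    by apply: (@filterS nat U _ setT) => [n _|]; [rewrite /= in_itv/= -ler_norml|exact: filterT].
  have [l [_ hl]] := @segment_compact R (- S) S _ _ h1.
  exists l => B Bl; have [//|nB] := in_ultra_setVsetC ((fun n => phi_ n x) @^-1` B) UU.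
  by have [y [/= nBy By]] := hl (~` B) B nB Bl.
have [v hv] := boolp.choice cvx; exists v => eps N eps0.
have e3 : 0 < eps / 3 by rewrite divr_gt0.
(* Chosen so that [C * eta ^ gam <= (eps / 3) ^ 2]; the denominator [C + 1] covers [C = 0]. *)
pose eta := ((eps / 3) ^+ 2 / (C + 1)) `^ gam^-1.
have C1 : 0 < C + 1 by rewrite ltr_wpDl.
have q0 : 0 < (eps / 3) ^+ 2 / (C + 1) by rewrite divr_gt0// exprn_gt0.
have eta0 : 0 < eta by exact: powR_gt0.
have hol n x y : `|x - y| <= eta -> `|phi_ n x - phi_ n y| <= eps / 3.
  move=> xy; rewrite -(@ler_pXn2r _ 2) ?nnegrE ?(ltW e3)// real_normK ?num_real//.
  apply: le_trans (hC n x y) _.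
  apply: (@le_trans _ _ (C * eta `^ gam)).
    by apply: ler_wpM2l => //; apply: ge0_ler_powR => //; rewrite ?nnegrE ?(ltW gam0) ?(ltW eta0).
  rewrite /eta -powRrM mulVf ?gt_eqF// powRr1 ?(ltW q0)// mulrCA ger_pMr ?exprn_gt0//.
  by rewrite ler_pdivrMr// mul1r lerDl.
have holv x y : `|x - y| <= eta -> `|v x - v y| <= eps / 3.
  move=> xy; have c : (fun n => `|phi_ n x - phi_ n y|) @ U --> `|v x - v y|.
    by apply: cvg_norm; apply: cvgB; exact: hv.
  rewrite -(cvg_lim _ c)//; apply: limr_le; first by apply/cvg_ex; eexists; exact: c.
  by apply: (@filterS nat U _ setT) => [n _|]; [exact: hol|exact: filterT].
(* The points [a + i * eta] with [i < K] come within [eta] of every point of []a, b[]. *)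
pose K := (Num.truncn ((b - a) / eta)).+1.
pose p (i : 'I_K) := a + i%:R * eta.
(* Finitely many grid conditions hold together on a set of the ultrafilter, which also meets every
   tail since it refines [\oo]. *)
have : U ([set n | forall i, `|phi_ n (p i) - v (p i)| <= eps / 3] `&` [set n | (N <= n)%N]).
  apply: filterI; last by apply: sU; exists N.
  apply: filter_forall => i; have /cvgrPdist_le/(_ _ e3) := hv (p i).
  by apply: filterS => n; rewrite distrC.
move=> /(@filter_ex _ U _)[n [hn Nn]]; exists n => // x.
have [xO|xO] := pselect (`]a, b[%classic x); last first.
  have v0 : v x = 0.
    apply: (@cvg_unique _ _ ((fun n => phi_ n x) @ U)) => //; first exact: hv.
    by rewrite (_ : (fun n => phi_ n x) = cst 0); [exact: cvg_cst|apply/funext => m; rewrite out].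
  by rewrite out// v0 subrr normr0 ltW.
move: xO; rewrite /= in_itv/= => /andP[ax xb].
have r0 : 0 <= (x - a) / eta by rewrite divr_ge0 ?(ltW eta0)// subr_ge0 ltW.
have /andP[t1 t2] := Num.Theory.truncn_itv r0.
have iK : (Num.truncn ((x - a) / eta) < K)%N.
  rewrite ltnS Num.Theory.le_truncn// ler_pM2r ?invr_gt0//; lra.
pose i := Ordinal iK.
have xi : `|x - p i| <= eta.
  rewrite /p /=; move: t1 t2; rewrite ler_pdivlMr// ltr_pdivrMr// -natr1.
  by move: (Num.truncn _)%:R => m t1 t2; rewrite ler_norml; apply/andP; split; lra.
have := hol n x (p i) xi; have := holv x (p i) xi; have := hn i.
rewrite !ler_norml; clear => /andP[? ?] /andP[? ?] /andP[? ?]; apply/andP; split; lra.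
Qed.

End HolderCompactness.

Section DirichletEigenvalue.
Context {R : realType}.
Notation mu := (@lebesgue_measure R).
Variables a b al : R.
Hypothesis ab : a < b.
Hypothesis al1 : 1 < al.
Hypothesis al2 : al < 2.
Notation Om := (`]a, b[%classic : set R).
Notation tf := (test_function Om).
Notation fl := (fracLap_const al).
Implicit Types (f g phi psi : R -> R).

Notation E f := (energy al f f).
Notation mass f := (\int[mu]_(x in Om) (f x ^+ 2)).

Local Ltac lras := move: (ab) (al1) (al2) => ? ? ?; lra.

Let mOm : measurable (Om : set (measurableTypeR R)). Proof. exact: measurable_itv. Qed.

Let Omfin : (mu Om < +oo)%E. Proof. exact: lebesgue_measure_oo_lty. Qed.

Lemma continuous_supp_inL2 f : continuous f -> (forall x, ~ Om x -> f x = 0) -> inL2 Om f.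
Proof.
move=> cf f0; have mf := continuous_measurableR cf.
have [M M0 hM] := continuous_bounded_supp (ltW ab) cf f0.
apply/(inL2P mOm); split; first exact: measurable_funTS.
apply: (bounded_integrable_on mOm (M := M ^+ 2)) => //.
  by apply: measurable_funTS; exact: measurable_funX.
by move=> x _; rewrite normrX ler_pXn2r ?nnegrE.
Qed.

Lemma tf_inL2 phi : tf phi -> inL2 Om phi.
Proof. by move=> tp; apply: continuous_supp_inL2; [exact: tf_continuous tp|move=> x; exact: tf_out]. Qed.

Lemma mass_ge0 f : 0 <= mass f.
Proof. by apply: Rintegral_ge0 => x _; exact: sqr_ge0. Qed.

Lemma massZ (k : R) f : inL2 Om f -> mass (fun x => k * f x) = k ^+ 2 * mass f.
Proof.
move=> /(inL2P mOm)[_ fi]; rewrite -(RintegralZl (k ^+ 2) mOm fi).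
by apply: eq_Rintegral => x _; rewrite exprMn.
Qed.

Lemma energy_lim_pairing (w v : R -> R) (phi_ : nat -> R -> R) : mu.-integrable Om (EFin \o w) ->
  energy_lim a b al phi_ v ->
  (fun n => \int[mu]_(x in Om) (w x * phi_ n x)) @ \oo --> \int[mu]_(x in Om) (w x * v x).
Proof.
move=> wi [tp cv v0 [e e0 he]].
have [M M0 hM] := continuous_bounded_supp (ltW ab) cv v0.
apply: (Rintegral_cvg_unif mOm wi _ hM _ _ e0).
- by apply: measurable_funTS; exact: continuous_measurableR.
- by move=> n; apply: measurable_funTS; exact: continuous_measurableR (tf_continuous (tp n)).
- by move=> n x; have [_ + _] := he n; exact.
Qed.

Lemma energy_lim_mass (v : R -> R) (phi_ : nat -> R -> R) : energy_lim a b al phi_ v ->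
  (fun n => mass (phi_ n)) @ \oo --> mass v.
Proof.
move=> [tp cv v0 [e e0 he]].
have [M M0 hM] := continuous_bounded_supp (ltW ab) cv v0.
have i1 : mu.-integrable Om (EFin \o cst (1 : R)).
  by apply: (bounded_integrable_on mOm (M := 1)) => // x _; rewrite normr1.
have sq f : measurable_fun [set: R] f -> measurable_fun Om (fun x => f x ^+ 2).
  by move=> mf; apply: measurable_funTS; exact: measurable_funX.
have h := @Rintegral_cvg_unif _ _ mOm (cst 1) (fun x => v x ^+ 2) (fun n x => phi_ n x ^+ 2)
   (fun n => e n * (e n + 2 * M)) (M ^+ 2) i1 (sq _ (continuous_measurableR cv)) _ _ _ _.
have one f : \int[mu]_(x in Om) (cst 1 x * f x ^+ 2) = mass f.
  by apply: eq_Rintegral => x _; rewrite mul1r.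
have : (fun n => \int[mu]_(x in Om) (cst 1 x * phi_ n x ^+ 2)) @ \oo -->
       \int[mu]_(x in Om) (cst 1 x * v x ^+ 2).
  apply: h.
  - by move=> x; rewrite normrX ler_pXn2r ?nnegrE.
  - by move=> n; apply: sq; exact: continuous_measurableR (tf_continuous (tp n)).
  - move=> n x; have [en0 /(_ x) hn _] := he n; have := hM x.
    rewrite subr_sqr normrM => vM; apply: ler_pM => //.
    have -> : phi_ n x + v x = (phi_ n x - v x) + 2 * v x by ring.
    apply: le_trans (ler_normD _ _) _; apply: lerD => //.
    by rewrite normrM ger0_norm// ler_wpM2l.
  - rewrite -[X in _ --> X](mul0r (0 + 2 * M)); apply: cvgM => //; apply: cvgD => //; exact: cvg_cst.
by rewrite one; under eq_fun do rewrite one.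
Qed.

(* By polarization [2 energy phi_m phi_n = E phi_m + E phi_n - E (phi_n - phi_m)]. *)
Lemma rayleigh_H0 (k : R) (u w : R -> R) : (forall phi, tf phi -> k * mass phi <= fl * E phi) ->
  H0 (al / 2) Om u -> fracLap al Om u w -> k * mass u <= \int[mu]_(x in Om) (w x * u x).
Proof.
move=> hk Hu [wL hw]; have [phi_ [v [lv uv]]] := H0_energy_lim ab al1 al2 Hu.
have [mu_ _] := Hu; have mv := energy_lim_measurable lv.
have [tp _ _ [e e0 he]] := lv.
have wi := inL2_integrable mOm Omfin wL.
have [mw _] := (inL2P mOm w).1 wL.
have msq f : measurable_fun [set: R] f -> measurable_fun Om (fun x => f x ^+ 2).
  by move=> mf; apply: measurable_funTS; exact: measurable_funX.
have -> : mass u = mass v.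
  apply: ae_eq_Rintegral; [exact: mOm|exact: msq|exact: msq|].
  by apply: (@filterS _ _ (ae_filter_ringOfSetsType mu)) uv => x ->.
have -> : \int[mu]_(x in Om) (w x * u x) = \int[mu]_(x in Om) (w x * v x).
  apply: ae_eq_Rintegral; first exact: mOm.
  - by apply: measurable_realfun.measurable_funM => //; exact: measurable_funTS.
  - by apply: measurable_realfun.measurable_funM => //; exact: measurable_funTS.
  by apply: (@filterS _ _ (ae_filter_ringOfSetsType mu)) uv => x ->.
have fl0 := fracLap_const_gt0 ab al1 al2.
have cm := energy_lim_mass lv; have cw := energy_lim_pairing wi lv.
(* The two indices go to infinity one after the other: with [phi_ n] fixed as the test function, the
   energy against [phi_ m] converges to the operator at [v], and thus to the pairing with [w]. *)
have step n : k * mass v + k * mass (phi_ n) - fl * e n <= 2 * \int[mu]_(x in Om) (w x * phi_ n x).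
  rewrite -(hw _ (tp n)) (fracLap_distr_ae a b al (phi_ n) mu_ mv uv).
  have c1 := energy_lim_fracLap ab al1 al2 lv (tp n).
  have c2 : (fun m => k * mass (phi_ m) + k * mass (phi_ n) - fl * e n) @ \oo -->
      k * mass v + k * mass (phi_ n) - fl * e n.
    by apply: cvgB; [apply: cvgD; [exact: cvgMr|exact: cvg_cst]|exact: cvg_cst].
  have c3 : (fun m => 2 * (fl * energy al (phi_ m) (phi_ n))) @ \oo --> 2 * fracLap_distr al Om v (phi_ n).
    exact: cvgMr.
  apply: (ler_cvg_to c2 c3).
  exists n => // m /= nm; have [_ _ /(_ m nm)] := he n.
    rewrite (energy_sq_diff ab al1 al2 (tp n) (tp m)) (energyC al (phi_ n) (phi_ m)) => h.
    have h1 := hk _ (tp n); have h2 := hk _ (tp m).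
    have : fl * (E (phi_ n) - 2 * energy al (phi_ m) (phi_ n) + E (phi_ m)) <= fl * e n.
      by rewrite ler_pM2l.
    move: h1 h2; move: (e n) (energy al (phi_ m) (phi_ n)) (E (phi_ n)) (E (phi_ m)) (mass (phi_ n)) (mass (phi_ m)).
    move: (fl) => c; clear => d p q r s t h1 h2; rewrite mulrDr mulrBr; lra.
have : k * mass v + k * mass v - fl * 0 <= 2 * \int[mu]_(x in Om) (w x * v x).
  have c2 : (fun n => k * mass v + k * mass (phi_ n) - fl * e n) @ \oo --> k * mass v + k * mass v - fl * 0.
    by apply: cvgB; [apply: cvgD; [exact: cvg_cst|exact: cvgMr]|exact: cvgMr].
  have c3 : (fun n => 2 * \int[mu]_(x in Om) (w x * phi_ n x)) @ \oo --> 2 * \int[mu]_(x in Om) (w x * v x).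
    exact: cvgMr.
  by apply: (ler_cvg_to c2 c3); exact: nearW.
by rewrite mulr0; lra.
Qed.

(** The form [fl * E - k * mass] is nonnegative on test functions and tends to 0 along [phi_].
    Evaluated at [phi_ n + t * phi] it becomes, in the limit, a nonnegative quadratic in [t] without
    constant term, so its linear coefficient [2 * L] vanishes. *)
Lemma first_variation (k : R) (phi_ : nat -> R -> R) (v phi : R -> R) :
  (forall phi, tf phi -> k * mass phi <= fl * E phi) ->
  energy_lim a b al phi_ v -> (fun n => fl * E (phi_ n) - k * mass (phi_ n)) @ \oo --> 0 -> tf phi ->
  fracLap_distr al Om v phi = k * \int[mu]_(x in Om) (v x * phi x).
Proof.
move=> hk lv d0 tp; have [tpn cv v0 _] := lv.
have pi := inL2_integrable mOm Omfin (tf_inL2 tp).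
have c1 := energy_lim_fracLap ab al1 al2 lv tp.
have com f : \int[mu]_(x in Om) (phi x * f x) = \int[mu]_(x in Om) (f x * phi x).
  by apply: eq_Rintegral => x _; rewrite mulrC.
have c2 : (fun n => \int[mu]_(x in Om) (phi_ n x * phi x)) @ \oo --> \int[mu]_(x in Om) (v x * phi x).
  by rewrite -com; under eq_fun do rewrite -com; exact: energy_lim_pairing.
pose L := fracLap_distr al Om v phi - k * \int[mu]_(x in Om) (v x * phi x).
pose Q := fl * E phi - k * mass phi.
have Q0 : 0 <= Q by rewrite subr_ge0 hk.
have quad (t : R) : 0 <= 0 + 2 * t * L + t ^+ 2 * Q.
  have cl : (fun n => (fl * E (phi_ n) - k * mass (phi_ n)) + 2 * t * (fl * energy al (phi_ n) phi -
       k * \int[mu]_(x in Om) (phi_ n x * phi x)) + t ^+ 2 * Q) @ \oo --> 0 + 2 * t * L + t ^+ 2 * Q.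
    apply: cvgD; last exact: cvg_cst.
    apply: cvgD => //; apply: cvgMr; apply: cvgB => //; exact: cvgMr.
  apply: (ler_cvg_to (cvg_cst 0) cl); apply: nearW => n.
  have ts := tf_scale t tp; have := hk _ (tf_add (tpn n) ts).
  rewrite (energy_sq_add ab al1 al2 (tpn n) ts) (energyZZ ab al1 al2 t tp).
  rewrite (energyC al (phi_ n) (fun x => t * phi x)) (energyZl ab al1 al2 t tp (tpn n)) (energyC al phi (phi_ n)).
  rewrite (Rintegral_sqr_expand mOm t (tf_inL2 (tpn n)) (tf_inL2 tp)) /Q.
  move: (energy al (phi_ n) phi) (E (phi_ n)) (E phi) (mass (phi_ n)) (mass phi)
    (\int[mu]_(x in Om) (phi_ n x * phi x)) => p q r s m z h.
  by rewrite -subr_ge0 in h; move: h; congr (_ <= _); ring.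
suff : L = 0 by move/eqP; rewrite subr_eq0 => /eqP.
have Q1 : 0 < Q + 1 by lra.
apply/eqP; rewrite -sqrf_eq0; apply/eqP/le_anti; rewrite sqr_ge0 andbT.
(* A point near the minimizer, with [Q + 1] because [Q] may be 0; the value there is
   [- L ^ 2 * (Q + 2) / (Q + 1) ^ 2]. *)
have := quad (- L / (Q + 1)).
have -> : 0 + 2 * (- L / (Q + 1)) * L + (- L / (Q + 1)) ^+ 2 * Q = - (L ^+ 2 * (Q + 2) / (Q + 1) ^+ 2).
  by field; rewrite gt_eqF.
rewrite oppr_ge0 => h; rewrite leNgt; apply/negP => L0.
suff : (0 : R) < 0 by rewrite ltxx.
by apply: lt_le_trans h; rewrite divr_gt0 ?exprn_gt0// mulr_gt0//; lra.
Qed.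

(** A sequence minimizing the Rayleigh quotient has bounded energy, so Morrey's inequality extracts
    a uniformly convergent part. The parallelogram law then upgrades this to convergence in energy,
    and the first variation gives the eigenvalue equation. *)
Lemma poincare_eigenfunction : (exists2 phi, tf phi & mass phi != 0) -> exists k v : _,
  [/\ forall phi, tf phi -> k * mass phi <= fl * E phi, H0 (al / 2) Om v, L2norm Om v != 0 &
   fracLap al Om v (fun x => k * v x)].
Proof.
move=> [phi0 tp0 m0]; have fl0 := fracLap_const_gt0 ab al1 al2.
pose S := [set r : R | exists phi, [/\ tf phi, mass phi = 1 & r = fl * E phi]].
have normalize phi : tf phi -> mass phi != 0 -> S (fl * E phi / mass phi).
  move=> tp mp; have mp0 : 0 < mass phi by rewrite lt0r mp mass_ge0.
  exists (fun x => (Num.sqrt (mass phi))^-1 * phi x); split; first exact: tf_scale.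
    by rewrite (massZ (Num.sqrt (mass phi))^-1 (tf_inL2 tp)) exprVn sqr_sqrtr ?mulVf// ltW.
  rewrite (energyZZ ab al1 al2 _ tp) exprVn sqr_sqrtr ?(ltW mp0)//.
  by rewrite -mulrA; congr (_ * _); rewrite mulrC.
have S0 r : S r -> 0 <= r.
  by move=> [phi [_ _ ->]]; rewrite mulr_ge0 ?(ltW fl0)//; exact: energy_ge0.
have hS : has_inf S by split; [exists (fl * E phi0 / mass phi0); exact: normalize|exists 0 => r; exact: S0].
pose k := inf S.
have k0 : 0 <= k by apply: lb_le_inf; [case: hS|move=> r; exact: S0].
have hk phi : tf phi -> k * mass phi <= fl * E phi.
  move=> tp; have [->|mp] := eqVneq (mass phi) 0.
    by rewrite mulr0 mulr_ge0 ?(ltW fl0)//; exact: energy_ge0.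
  have mp0 : 0 < mass phi by rewrite lt0r mp mass_ge0.
  by rewrite -ler_pdivlMr//; apply: ge_inf (normalize _ tp mp); case: hS.
have /(@boolp.choice _ _ _)[phi_ hphi] : forall n : nat, exists phi,
    [/\ tf phi, mass phi = 1 & fl * E phi <= k + n.+1%:R^-1].
  move=> n; have [|r [phi [tp mp ->]] hr] := @inf_adherent _ S n.+1%:R^-1 _ hS; first by rewrite invr_gt0.
  by exists phi; split => //; exact: ltW.
have tp n : tf (phi_ n) by case: (hphi n).
have mp n : mass (phi_ n) = 1 by case: (hphi n).
have ep n : fl * E (phi_ n) <= k + n.+1%:R^-1 by case: (hphi n).
have inv1 n : n.+1%:R^-1 <= 1 :> R by rewrite invf_le1// ler1n.
pose B := (k + 1) / fl.
have B0 : 0 <= B by rewrite divr_ge0 ?(ltW fl0)//; lra.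
have EB n : E (phi_ n) <= B.
  by rewrite ler_pdivlMr// mulrC; apply: le_trans (ep n) _; rewrite lerD2l.
have supB n (x : R) : `|phi_ n x| <= Num.sqrt (sup_const a b al * B).
  rewrite -(@ler_pXn2r _ 2) ?nnegrE ?sqrtr_ge0// real_normK ?num_real//.
  have sc0 := sup_const_ge0 a b al; rewrite sqr_sqrtr; last exact: mulr_ge0.
  by apply: le_trans (sup_energy ab al1 al2 x (tp n)) _; apply: ler_wpM2l.
have holB n (x y : R) : (phi_ n x - phi_ n y) ^+ 2 <= morrey_const al * B * `|x - y| `^ (al - 1).
  apply: le_trans (morrey ab al1 al2 x y (tp n)) _.
  rewrite mulrAC; apply: ler_wpM2r; first exact: powR_ge0.
  by apply: ler_wpM2l => //; exact: morrey_const_ge0.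
have al10 : 0 < al - 1 by lras.
have mB0 : 0 <= morrey_const al * B by exact: mulr_ge0 (morrey_const_ge0 al) B0.
have [v0 hv0] := holder_compact al10 mB0 supB holB (fun n x => @tf_out _ a b _ x (tp n)).
(* The condition [n <= sg n] keeps the extracted sequence minimizing at the same rate. *)
have /(@boolp.choice _ _ _)[sg hsg] : forall n : nat, exists m, (n <= m)%N /\
    forall x : R, `|phi_ m x - v0 x| <= n.+1%:R^-1.
  by move=> n; have [|m nm hm] := hv0 n.+1%:R^-1 n; [rewrite invr_gt0|exists m].
pose psi n := phi_ (sg n).
have tpsi n : tf (psi n) by exact: tp.
have eps_ n : fl * E (psi n) <= k + n.+1%:R^-1.
  by apply: le_trans (ep _) _; rewrite lerD2l lef_pV2 ?posrE// ler_nat ltnS; case: (hsg n).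
(* By the parallelogram law for [E] and for the mass, [fl * E (psi n - psi m)] is at most [2 / (n +
   1) + 2 / (m + 1) + k * mass (psi n - psi m)], and the last mass is at most
   [4 / (n + 1) * (b - a)] by uniform closeness. *)
pose e (n : nat) : R := (4 + 4 * k * (b - a)) / fl * n.+1%:R^-1.
have e0 : e @ \oo --> 0.
  rewrite -(mulr0 ((4 + 4 * k * (b - a)) / fl)); apply: cvgMr; exact: cvg_harmonic.
have he n m : (n <= m)%N -> E (fun x => psi n x - psi m x) <= e n.
  move=> nm; have mn : m.+1%:R^-1 <= n.+1%:R^-1 :> R by rewrite lef_pV2 ?posrE// ler_nat.
  have td := tf_sub (tpsi n) (tpsi m); have ta := tf_add (tpsi n) (tpsi m).
  have dle (x : R) : `|psi n x - psi m x| <= 2 * n.+1%:R^-1.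
    have [_ /(_ x) h1] := hsg n; have [_ /(_ x) h2] := hsg m.
    have -> : psi n x - psi m x = (psi n x - v0 x) - (psi m x - v0 x) by ring.
    apply: (le_trans (ler_normB _ _)); apply: (le_trans (lerD h1 h2)).
    by rewrite mulr_natl mulr2n lerD2l.
  have md : mass (fun x => psi n x - psi m x) <= 4 * n.+1%:R^-1 * (b - a).
    rewrite -lee_fin; apply: (@le_trans _ _ (\int[mu]_(x in Om) (4 * n.+1%:R^-1)%:E)%E); last first.
      by rewrite integral_cst//= lebesgue_measure_itv /= lte_fin ab -EFinD -EFinM.
    have [_ di] := (inL2P mOm _).1 (tf_inL2 td).
    rewrite /Rintegral fineK; last exact: (integrable_fin_num mOm di).
    apply: ge0_le_integral => //.
    - by move=> x _; rewrite lee_fin sqr_ge0.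
    - by apply/measurable_EFinP; apply: measurable_funTS; apply: measurable_funX; exact: continuous_measurableR (tf_continuous td).
    - move=> x _; rewrite lee_fin -(real_normK (num_real _)).
      apply: (@le_trans _ _ ((2 * n.+1%:R^-1) ^+ 2)); first by rewrite ler_pXn2r ?nnegrE.
      have := inv1 n; have : 0 < n.+1%:R^-1 :> R by rewrite invr_gt0.
      by move: (n.+1%:R^-1) => s ? ?; nra.
  have par : mass (fun x => psi n x + psi m x) = 4 - mass (fun x => psi n x - psi m x).
    have -> : mass (fun x => psi n x + psi m x) = mass (fun x => psi n x + 1 * psi m x).
      by apply: eq_Rintegral => x _; rewrite mul1r.
    have -> : mass (fun x => psi n x - psi m x) = mass (fun x => psi n x + (-1) * psi m x).
      by apply: eq_Rintegral => x _; rewrite mulN1r.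
    rewrite (Rintegral_sqr_expand mOm 1 (tf_inL2 (tpsi n)) (tf_inL2 (tpsi m))).
    rewrite (Rintegral_sqr_expand mOm (-1) (tf_inL2 (tpsi n)) (tf_inL2 (tpsi m))).
    rewrite !mp; move: (\int[mu]_(x in Om) (psi n x * psi m x)) => z; ring.
  have := hk _ ta; rewrite par (energy_sq_add ab al1 al2 (tpsi n) (tpsi m)) => h1.
  rewrite /e mulrAC ler_pdivlMr// mulrC (energy_sq_diff ab al1 al2 (tpsi n) (tpsi m)).
  have := eps_ n; have := eps_ m; have := ler_wpM2l k0 md; have := k0; move: h1 mn.
  move: (E (psi n)) (E (psi m)) (energy al (psi n) (psi m)) (mass (fun x => psi n x - psi m x)) (n.+1%:R^-1) (m.+1%:R^-1).
  move=> p q r s t z h1 mn k0' h2 h3 h4.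
  have -> : fl * (p - 2 * r + q) = 2 * (fl * p) + 2 * (fl * q) - fl * (p + 2 * r + q) by ring.
  have -> : (4 + 4 * k * (b - a)) * t = 4 * t + k * (4 * t * (b - a)) by ring.
  lra.
have [v lv] := energy_cauchy_lim ab al1 al2 tpsi e0 he.
have mv : mass v = 1.
  have c1 := energy_lim_mass lv; apply: (cvg_unique _ c1) => //.
  rewrite /= (_ : (fun n => mass (psi n)) = cst 1); first exact: cvg_cst.
  by apply/funext => n; exact: mp.
have [_ cv vout _] := lv.
have vL := continuous_supp_inL2 cv vout.
exists k, v; split => //.
- exact: (energy_lim_H0 ab al1 al2 lv).
- by rewrite L2normE// mv sqrtr1 oner_neq0.
- split; first exact: inL2Z.
  move=> phi tphi; rewrite (first_variation hk lv _ tphi).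
    have vp := inL2_mul mOm vL (tf_inL2 tphi).
    by rewrite -(RintegralZl k mOm vp); apply: eq_Rintegral => x _; rewrite mulrA.
  apply: (cvg0_squeeze (e := fun n => n.+1%:R^-1)); last exact: cvg_harmonic.
  move=> n; have := eps_ n; have := hk _ (tpsi n); rewrite mp mulr1 => h1 h2.
  by rewrite ger0_norm ?subr_ge0// lerBlDl.
Qed.

(** Masses converge along the approximation of the eigenfunction, so they cannot all be 0. The test
    function found here makes the Rayleigh infimum meaningful and is the raw material for the
    mollifier of the nonlinear term. *)
Lemma dirichlet_eigenvalue_tf (l : R) : dirichlet_eigenvalue al Om l ->
  exists2 phi, tf phi & mass phi != 0.
Proof.
move=> [v0 [Hv0 nv0 _]]; have [phi_ [v [lv v0v]]] := H0_energy_lim ab al1 al2 Hv0.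
have [tp _ _ _] := lv; apply: contrapT => noexists; move/eqP: nv0; apply.
have cm := energy_lim_mass lv.
have mv0 : mass v = 0.
  apply: (cvg_unique _ cm) => //; rewrite /= (_ : (fun n => mass (phi_ n)) = cst 0); first exact: cvg_cst.
  by apply/funext => n; apply/eqP/negPn/negP => h; apply: noexists; exists (phi_ n).
rewrite L2normE//.
have -> : mass v0 = mass v; last by rewrite mv0 sqrtr0.
have [mv0' _] := Hv0; have mv := energy_lim_measurable lv.
have msq f : measurable_fun [set: R] f -> measurable_fun Om (fun x => f x ^+ 2).
  by move=> mf; apply: measurable_funTS; exact: measurable_funX.
apply: ae_eq_Rintegral; [exact: mOm|exact: msq|exact: msq|].
by apply: (@filterS _ _ (ae_filter_ringOfSetsType mu)) v0v => x ->.
Qed.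

Lemma smallest_eigenvalue_coercive (l : R) (u w : R -> R) : smallest_dirichlet_eigenvalue al Om l ->
  H0 (al / 2) Om u -> fracLap al Om u w -> l * mass u <= \int[mu]_(x in Om) (w x * u x).
Proof.
move=> [el lmin] Hu uw.
have [k [v [hk Hv nv kv]]] := poincare_eigenfunction (dirichlet_eigenvalue_tf el).
have lk : l <= k by apply: lmin; exists v; split.
apply: le_trans (rayleigh_H0 hk Hu uw); apply: ler_wpM2r => //; exact: mass_ge0.
Qed.

End DirichletEigenvalue.

(** * The nonlinear term *)

Section RintegralLemmas.
Context {R : realType}.
Notation mu := (@lebesgue_measure R).
Implicit Types (f g : R -> R) (D : set R).

Lemma Rintegral_dominated_cvg D (fn : nat -> R -> R) f g : measurable (D : set (measurableTypeR R)) ->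
  (forall n, measurable_fun D (fn n)) -> measurable_fun D f -> mu.-integrable D (EFin \o g) ->
  (forall n x, D x -> `|fn n x| <= g x) ->
  (forall x, D x -> (fun n => fn n x) @ \oo --> f x) ->
  (fun n => \int[mu]_(x in D) fn n x) @ \oo --> \int[mu]_(x in D) f x.
Proof.
move=> mD mfn mf gi fg cf.
have [] := @dominated_convergence _ _ _ mu D mD (fun n => EFin \o fn n) (EFin \o f) (EFin \o g).
- by move=> n; apply/measurable_EFinP; exact: mfn.
- exact/measurable_EFinP.
- by apply: aeW => x Dx; apply: cvg_EFin; [exact: nearW|exact: cf].
- exact: gi.
- by apply: aeW => x n Dx /=; rewrite lee_fin fg.
move=> fi _ c1; rewrite /Rintegral; apply: fine_cvg; rewrite fineK//.
exact: integrable_fin_num fi.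
Qed.

Lemma Rintegral_subset D (C : set R) f : D `<=` C -> (forall x, C x -> ~ D x -> f x = 0) ->
  \int[mu]_(x in C) f x = \int[mu]_(x in D) f x.
Proof.
move=> DC f0; have e : f \_ C = f \_ D.
  apply/funext => x; rewrite !patchE.
  case: ifPn => [/set_mem Cx|/negP Cx]; case: ifPn => [/set_mem Dx|/negP Dx] //.
    by apply: f0 => // Dx'; apply: Dx; rewrite inE.
  by exfalso; apply: Cx; rewrite inE; exact: DC.
by rewrite Rintegral_mkcond [RHS]Rintegral_mkcond e.
Qed.

Lemma Rintegral_oc_split f (s m t : R) : s <= m -> m <= t -> mu.-integrable `]s, t] (EFin \o f) ->
  \int[mu]_(x in `]s, t]) f x = \int[mu]_(x in `]s, m]) f x + \int[mu]_(x in `]m, t]) f x.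
Proof.
move=> sm mt fi; have h : `]s, t]%classic = `]s, m]%classic `|` `]m, t]%classic :> set R.
  apply/seteqP; split=> x /=; rewrite !in_itv/=.
    by move=> /andP[sx xt]; case: (leP x m) => xm; [left|right]; rewrite ?sx ?xm.
  by case=> /andP[h1 h2]; [rewrite h1 (le_trans h2)|rewrite h2 (le_lt_trans sm)].
rewrite h Rintegral_setU -?h//.
apply/disj_setPLR => x /=; rewrite !in_itv/= => /andP[_ xm] /andP[mx _]; move: (lt_le_trans mx xm); rewrite ltxx.
by [].
Qed.

End RintegralLemmas.

(** * A smooth step built from a test function *)

Section SmoothStep.
Context {R : realType}.
Notation mu := (@lebesgue_measure R).
Variables a b : R.
Hypothesis ab : a < b.
Notation Om := (`]a, b[%classic : set R).
Notation tf := (test_function Om).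
Implicit Types (f g phi psi : R -> R).

Definition step_function (H K : R -> R) := [/\ tf K, forall x, 0 <= K x,
  forall x : R, is_derive x 1 H (K x), forall x, x <= a -> H x = 0 & forall x, b <= x -> H x = 1].

(** The square of any nonzero test function, divided by its integral, is a nonnegative bump of mass
    1; its primitive is the step. *)
Lemma step_function_exists : (exists2 phi, tf phi & \int[mu]_(x in Om) (phi x ^+ 2) != 0) ->
  exists H K, step_function H K.
Proof.
move=> [phi tp m0]; pose m := \int[mu]_(x in Om) (phi x ^+ 2).
pose K x := m^-1 * (phi x * phi x).
have mge : 0 <= m by apply: Rintegral_ge0 => x _; exact: sqr_ge0.
have tK : tf K by apply: tf_scale; apply: tf_mul => //; exact: tf_smooth tp.
have Ki := tf_integrable tK.
have K0 x : 0 <= K x by rewrite mulr_ge0 ?invr_ge0// -expr2 sqr_ge0.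
pose H x := \int[mu]_(t in `]-oo, x]) K t.
have iall (D : set R) : measurable (D : set (measurableTypeR R)) -> mu.-integrable D (EFin \o K).
  by move=> mD; apply: integrableS Ki.
exists H, K; split => // x.
- have [||||dH <-] := @continuous_FTC1 _ K -oo%O x (x + 1).
  + by rewrite ltrDl.
  + by apply: iall; exact: measurable_itv.
  + by rewrite /= ltNyr.
  + exact: tf_continuous tK x.
  by rewrite derive1E; exact: derivableP.
- move=> xa; rewrite /H /Rintegral integral0_eq// => t /=; rewrite in_itv/= => tx.
  rewrite (tf_out tK)//= in_itv/= => /andP[at_ _].
  by move: (lt_le_trans at_ (le_trans tx xa)); rewrite ltxx.
- move=> bx; have e1 : \int[mu]_(t in Om) K t = 1.
    have mOm : measurable (Om : set (measurableTypeR R)) by exact: measurable_itv.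
    have [_ i2] := (inL2P mOm phi).1 (tf_inL2 ab tp).
    transitivity (m^-1 * \int[mu]_(t in Om) (phi t ^+ 2)); last by rewrite mulVf.
    rewrite -(RintegralZl m^-1 mOm i2).
    by apply: eq_Rintegral => t _; rewrite /K expr2.
  rewrite /H -[RHS]e1; apply: Rintegral_subset.
    by move=> t /=; rewrite !in_itv/= => /andP[_ tb]; exact: le_trans (ltW tb) bx.
  by move=> t _; exact: tf_out.
Qed.

Variables H K : R -> R.
Hypothesis HK : step_function H K.

Lemma step_smooth n : nsmooth n H.
Proof.
have [tK _ dH _ _] := HK; case: n => //= n; split => [x|].
  by have [] := dH x.
have -> : derive1 H = K by apply/funext => x; rewrite derive1E; have [] := dH x.
exact: (smoothP K).1 (tf_smooth tK) n.
Qed.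

Lemma step_nondecreasing (x y : R) : x <= y -> H x <= H y.
Proof.
have [tK K0 dH _ _] := HK; rewrite le_eqVlt => /predU1P[->//|xy].
have h := @FTC2_segment _ H K x y xy (fun z _ => dH z) (fun z _ => @tf_continuous _ a b K tK z).
by rewrite -subr_ge0 -lee_fin -h; apply: integral_ge0 => z _; rewrite lee_fin.
Qed.

Lemma step_bounds (x : R) : 0 <= H x <= 1.
Proof.
have [_ _ _ H0 H1] := HK; apply/andP; split.
  have [xa|ax] := leP x a; first by rewrite H0.
  by rewrite -(H0 a)//; apply: step_nondecreasing; exact: ltW.
have [bx|xb] := leP b x; first by rewrite H1.
by rewrite -(H1 b)//; apply: step_nondecreasing; exact: ltW.
Qed.

(** The affine change of variable sends [p] to [a] and [p + eta] to [b], so the step rises over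
    [[p, p + eta]]; [bump_at] is its derivative. *)
Definition step_at (p eta x : R) := H ((b - a) / eta * x + (a - (b - a) / eta * p)).

Definition bump_at (p eta x : R) := (b - a) / eta * K ((b - a) / eta * x + (a - (b - a) / eta * p)).

Section At.
Variables p eta : R.
Hypothesis eta0 : 0 < eta.

Let ba : 0 < b - a. Proof. by rewrite subr_gt0. Qed.

Let argE (x : R) : (b - a) / eta * x + (a - (b - a) / eta * p) = a + (b - a) / eta * (x - p).
Proof. by ring. Qed.

Lemma step_at_le x : x <= p -> step_at p eta x = 0.
Proof.
have [_ _ _ H0 _] := HK; move=> xp; apply: H0; rewrite argE gerDl.
by rewrite mulr_ge0_le0 ?subr_le0// divr_ge0// ltW.
Qed.

Lemma step_at_ge x : p + eta <= x -> step_at p eta x = 1.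
Proof.
have [_ _ _ _ H1] := HK; move=> xp; apply: H1; rewrite argE -lerBlDl mulrAC -mulrA ler_peMr ?(ltW ba)//.
by rewrite ler_pdivlMr// mul1r; lra.
Qed.

Lemma bump_at_ge0 x : 0 <= bump_at p eta x.
Proof. by have [_ K0 _ _ _] := HK; rewrite mulr_ge0// divr_ge0// ltW. Qed.

Lemma is_derive_step_at (x : R) : is_derive x 1 (step_at p eta) (bump_at p eta x).
Proof. by have [_ _ dH _ _] := HK; exact: is_derive_affine. Qed.

Lemma bump_at_out x : ~ (p <= x <= p + eta) -> bump_at p eta x = 0.
Proof.
have [tK _ _ _ _] := HK; move=> xp; rewrite /bump_at argE (tf_out tK) ?mulr0//=.
rewrite in_itv/= ltrDl pmulr_rgt0 ?divr_gt0// subr_gt0 => /andP[px xb]; apply: xp.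
rewrite (ltW px)/=; rewrite -ltrBrDl mulrAC -mulrA gtr_pMr// ltr_pdivrMr// mul1r in xb; lra.
Qed.

Lemma bump_at_continuous : continuous (bump_at p eta).
Proof.
have [tK _ _ _ _] := HK; move=> x; apply: cvgM; first exact: cvg_cst.
apply: (@continuous_comp _ _ _ (fun x => (b - a) / eta * x + (a - (b - a) / eta * p)) K); last exact: tf_continuous tK _.
by apply: cvgD; [apply: cvgM; [exact: cvg_cst|exact: cvg_id]|exact: cvg_cst].
Qed.

Lemma bump_average (v : R -> R) (w : R) : continuous v ->
  (forall x, p <= x <= p + eta -> `|v x - v p| <= w) ->
  `|\int[mu]_(x in `[p, p + eta]) (v x * bump_at p eta x) - v p| <= w.
Proof.
move=> cv vw; have pe : p < p + eta by rewrite ltrDl.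
have mseg : measurable (`[p, p + eta]%classic : set (measurableTypeR R)) by exact: measurable_itv.
have cb := bump_at_continuous.
have bi := continuous_segment_integrable p (p + eta) cb.
have i1 : \int[mu]_(x in `[p, p + eta]) bump_at p eta x = 1.
  have h := @FTC2_segment _ (step_at p eta) _ _ _ pe (fun z _ => is_derive_step_at z) (fun z _ => cb z).
  by rewrite /Rintegral h /= step_at_ge// step_at_le// subr0.
have cM f g : continuous f -> continuous g -> continuous (fun x => f x * g x).
  by move=> cf cg x; apply: cvgM; [exact: cf|exact: cg].
have ccst (k : R) : continuous (fun _ : R => k) by move=> x; exact: cvg_cst.
have vbi := continuous_segment_integrable p (p + eta) (cM _ _ cv cb).
have cbi := continuous_segment_integrable p (p + eta) (cM _ _ (ccst (v p)) cb).
have -> : v p = \int[mu]_(x in `[p, p + eta]) (v p * bump_at p eta x).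
  by rewrite (RintegralZl (v p) mseg bi) i1 mulr1.
rewrite -(RintegralB mseg vbi cbi).
have cd : continuous (fun x => v x * bump_at p eta x - v p * bump_at p eta x).
  by move=> x; apply: cvgB; [exact: cM|exact: cM].
have di := continuous_segment_integrable p (p + eta) cd.
apply: (le_trans (le_normr_Rintegral mseg di)).
rewrite -[leRHS]mulr1 -[X in _ <= _ * X]i1 -(RintegralZl w mseg bi).
apply: le_Rintegral => //.
- exact: integrable_norm di.
- exact: intZ_on.
- move=> x /=; rewrite in_itv/= => xp; rewrite -mulrBl normrM (ger0_norm (bump_at_ge0 x)).
  by apply: ler_wpM2r; [exact: bump_at_ge0|exact: vw].
Qed.

End At.

(** Both steps rise to the right of their base point, so as [eta] tends to 0 this cutoff tends to
    the indicator of the half-open []c, d]]. *)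
Lemma cutoff_tf (c d eta : R) : a < c -> c < d -> 0 < eta -> d + eta < b ->
  tf (fun x => step_at c eta x - step_at d eta x).
Proof.
move=> ac cd eta0 db; split.
  apply/smoothP => n; have -> : (fun x => step_at c eta x - step_at d eta x) =
      (fun x => step_at c eta x + (-1) * step_at d eta x) by apply/funext => x; rewrite mulN1r.
  apply: nsmoothD; first by apply: nsmooth_affine; exact: step_smooth.
  by apply: nsmoothM; [exact: nsmooth_cst|apply: nsmooth_affine; exact: step_smooth].
exists `[c, d + eta]%classic; split.
- exact: segment_compact.
- by move=> x /=; rewrite !in_itv/= => /andP[cx xd]; rewrite (lt_le_trans ac cx) (le_lt_trans xd db).
- move=> x; rewrite /= in_itv/= => xcd; have [xc|cx] := leP x c.
    by rewrite !step_at_le ?subrr//; lra.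
  have xd : d + eta <= x by rewrite leNgt; apply/negP => xd; apply: xcd; rewrite (ltW cx) (ltW xd).
  by rewrite !step_at_ge ?subrr//; lra.
Qed.

End SmoothStep.

(** * Fundamental theorem of calculus and chain rule for a weak derivative *)

Section WeakDerivative.
Context {R : realType}.
Notation mu := (@lebesgue_measure R).
Variables a b : R.
Hypothesis ab : a < b.
Notation Om := (`]a, b[%classic : set R).
Notation tf := (test_function Om).

Let mOm : measurable (Om : set (measurableTypeR R)). Proof. exact: measurable_itv. Qed.

Variables v g : R -> R.
Hypothesis cv : continuous v.
Hypothesis gl : locally_integrable Om g.
Hypothesis hv : forall phi, tf phi ->
  \int[mu]_(x in Om) (v x * derive1 phi x) = - \int[mu]_(x in Om) (g x * phi x).

Lemma locally_integrable_segment (c d : R) : a < c -> d < b ->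
  mu.-integrable `[c, d] (EFin \o g).
Proof.
move=> ac db; have [mg _ gK] := gl.
have sub : (`[c, d]%classic : set R) `<=` Om.
  by move=> x /=; rewrite !in_itv/= => /andP[cx xd]; rewrite (lt_le_trans ac cx) (le_lt_trans xd db).
apply/integrableP; split; last exact: (gK _ sub (@segment_compact R c d)).
by apply/measurable_EFinP; apply: measurable_funS mg.
Qed.

Lemma locally_integrable_oc (c d : R) : a < c -> d < b -> mu.-integrable `]c, d] (EFin \o g).
Proof.
move=> ac db; apply: integrableS (locally_integrable_segment ac db).
- exact: measurable_itv.
- exact: measurable_itv.
- by move=> x /=; rewrite !in_itv/= => /andP[/ltW -> ->].
Qed.

(** The definition of the weak derivative is tested against the cutoffs of []c, d]]. Their
    derivatives are approximate identities at [c] and at [d] with opposite signs, so one side tends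
    to [v c - v d]. *)
Lemma weak_derivative_increment (c d : R) : (exists H K, step_function a b H K) ->
  a < c -> c < d -> d < b -> v d - v c = \int[mu]_(x in `]c, d]) g x.
Proof.
move=> [H [K HK]] ac cd db; have [mg _ _] := gl.
(* Starting from 2 keeps every cutoff supported in [[c, d + (b - d) / 2]], a compact part of [Om] on
   which [g] is integrable and dominates. *)
pose eta n : R := (b - d) / n.+2%:R.
have eta0 n : 0 < eta n by rewrite divr_gt0 ?subr_gt0.
have bd : 0 < b - d by rewrite subr_gt0.
have eta2 n : eta n <= (b - d) / 2 by rewrite ler_pM2l// lef_pV2 ?posrE// ler_nat.
have db_ n : d + eta n < b by have := eta2 n; lra.
have cb_ n : c + eta n < b by have := db_ n; lra.
have etac : eta @ \oo --> 0.
  rewrite -[X in _ --> X](mulr0 (b - d)); apply: cvgMr.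
  exact: (cvg_comp _ _ (@cvg_addnl 1) (@cvg_harmonic R)).
pose psi n x := step_at a b H c (eta n) x - step_at a b H d (eta n) x.
have tpsi n : tf (psi n) by exact: (cutoff_tf ab HK ac cd (eta0 n) (db_ n)).
have dpsi n x : derive1 (psi n) x = bump_at a b K c (eta n) x - bump_at a b K d (eta n) x.
  have h1 := is_derive_step_at HK c (eta n) x; have h2 := is_derive_step_at HK d (eta n) x.
  by rewrite derive1E; have h3 := is_deriveB h1 h2; have [_ ->] := h3.
pose A p n := \int[mu]_(x in `[p, p + eta n]) (v x * bump_at a b K p (eta n) x).
have Acv p : (fun n => A p n) @ \oo --> v p.
  apply/cvgrPdist_le => e e0.
  have /cvgrPdist_le/(_ _ e0) hvp := cv (x := p).
  have [r /= r0 hr] := (nbhs_ballP _ _).1 hvp.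
  have /cvgrPdist_lt/(_ _ r0) := etac; apply: filterS => n; rewrite /= sub0r normrN ger0_norm ?(ltW (eta0 n))// => nr.
  rewrite distrC; apply: (bump_average ab HK (eta0 n)) => // x /andP[px xe].
  rewrite distrC; apply: hr => /=; rewrite /ball /= distrC ger0_norm ?subr_ge0//; lra.
have intA p n : a < p -> p + eta n < b ->
    mu.-integrable Om (EFin \o (fun x => v x * bump_at a b K p (eta n) x)) /\
    \int[mu]_(x in Om) (v x * bump_at a b K p (eta n) x) = A p n.
  move=> ap pb; have out x : ~ (`[p, p + eta n]%classic : set R) x -> v x * bump_at a b K p (eta n) x = 0.
    by rewrite /= in_itv/= => h; rewrite (bump_at_out ab HK (eta0 n)) ?mulr0.
  have sub : (`[p, p + eta n]%classic : set R) `<=` Om.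
    by move=> x /=; rewrite !in_itv/= => /andP[cx xd]; rewrite (lt_le_trans ap cx) (le_lt_trans xd pb).
  have cvb : continuous (fun x => v x * bump_at a b K p (eta n) x).
    by move=> x; apply: cvgM; [exact: cv|exact: (bump_at_continuous HK)].
  split; last by apply: Rintegral_subset => // x _; exact: out.
  apply: integrableS (continuous_integrable_supp cvb _) => // x xO; apply: out => h; apply: xO; exact: sub.
have lhs : (fun n => - \int[mu]_(x in Om) (g x * psi n x)) @ \oo --> v c - v d.
  have -> : (fun n => - \int[mu]_(x in Om) (g x * psi n x)) = (fun n => A c n - A d n).
    apply/funext => n; rewrite -(hv (tpsi n)).
    have [ic <-] := intA c n ac (cb_ n); have [id <-] := intA d n (lt_trans ac cd) (db_ n).
    rewrite -(RintegralB mOm ic id); apply: eq_Rintegral => x _.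
    by rewrite dpsi mulrBr.
  by apply: cvgB; exact: Acv.
have rhs : (fun n => \int[mu]_(x in Om) (g x * psi n x)) @ \oo --> \int[mu]_(x in Om) (g x * \1_(`]c, d]%classic : set R) x).
  pose e1 := (b - d) / 2; have de1 : d + e1 < b by rewrite /e1; lra.
  have iseg := locally_integrable_segment ac de1.
  have mseg : measurable (`[c, d + e1]%classic : set (measurableTypeR R)) by exact: measurable_itv.
  have sub : (`[c, d + e1]%classic : set R) `<=` Om.
    by move=> x /=; rewrite !in_itv/= => /andP[cx xd]; rewrite (lt_le_trans ac cx) (le_lt_trans xd de1).
  have mpsi n : measurable_fun [set: R] (psi n) by apply: continuous_measurableR; exact: tf_continuous (tpsi n).
  apply: (@Rintegral_dominated_cvg _ Om _ _ (fun x => `|g x| * \1_(`[c, d + e1]%classic : set R) x)) => //.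
  - by move=> n; apply: measurable_realfun.measurable_funM => //; exact: measurable_funTS.
  - by apply: measurable_realfun.measurable_funM => //; apply: measurable_funTS.
  - have : mu.-integrable Om ((EFin \o (fun x => `|g x|)) \_ (`[c, d + e1]%classic : set R)).
      apply: integrableS (_ : mu.-integrable [set: R] _) => //.
      by apply/(integrable_mkcond _ mseg); exact: integrable_norm iseg.
    apply: eq_integrable => // x _; rewrite /= patchE indicE; case: ifPn => _; by rewrite ?mulr1 ?mulr0.
  - move=> n x _; rewrite normrM; apply: ler_wpM2l => //; rewrite indicE.
    have [xs|xs] := boolP (x \in _).
      have /andP[h1 h2] := step_bounds HK ((b - a) / eta n * x + (a - (b - a) / eta n * c)).
      have /andP[h3 h4] := step_bounds HK ((b - a) / eta n * x + (a - (b - a) / eta n * d)).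
      move: h1 h2 h3 h4; rewrite /psi /step_at mulr1n ler_norml.
      by move: (H _) (H _) => r s *; apply/andP; split; lra.
    rewrite notin_setE /= in_itv/= in xs.
    rewrite /psi; have [xc|cx] := leP x c.
      by rewrite (step_at_le ab HK (eta0 n) xc) (step_at_le ab HK (eta0 n)) ?subrr ?normr0//; lra.
    have xd : d + e1 < x by rewrite ltNge; apply/negP => h; apply: xs; rewrite (ltW cx).
    have := eta2 n; rewrite -/e1 => ee.
    by rewrite !(step_at_ge ab HK (eta0 n)) ?subrr ?normr0//; lra.
  - move=> x _; apply: cvgMr; rewrite indicE; apply: cvg_near_cst.
    have [xc|cx] := leP x c.
      apply: nearW => n; rewrite /psi (step_at_le ab HK (eta0 n) xc) (step_at_le ab HK (eta0 n)); last by lra.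
      by rewrite memNset ?subrr//= in_itv/= => /andP[]; rewrite ltNge xc.
    have [xd|dx] := leP x d.
      have xc0 : 0 < x - c by rewrite subr_gt0.
      have /cvgrPdist_lt/(_ _ xc0) := etac; apply: filterS => n; rewrite /= sub0r normrN ger0_norm ?(ltW (eta0 n))// => h.
      rewrite /psi (step_at_le ab HK (eta0 n) xd) (step_at_ge ab HK (eta0 n)); last by lra.
      by rewrite subr0 mem_set//= in_itv/= cx xd.
    have xc0 : 0 < x - d by rewrite subr_gt0.
    have /cvgrPdist_lt/(_ _ xc0) := etac; apply: filterS => n; rewrite /= sub0r normrN ger0_norm ?(ltW (eta0 n))// => h.
    rewrite /psi !(step_at_ge ab HK (eta0 n)); [|lra..].
    by rewrite memNset ?subrr//= in_itv/= => /andP[_]; rewrite leNgt dx.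
have rhs' : (fun n => - \int[mu]_(x in Om) (g x * psi n x)) @ \oo --> - \int[mu]_(x in Om) (g x * \1_(`]c, d]%classic : set R) x).
  exact: cvgN.
have e1 : v c - v d = - \int[mu]_(x in Om) (g x * \1_(`]c, d]%classic : set R) x).
  exact: (cvg_unique _ lhs rhs').
have e2 : \int[mu]_(x in Om) (g x * \1_(`]c, d]%classic : set R) x) = \int[mu]_(x in `]c, d]) g x.
  rewrite (@Rintegral_subset _ `]c, d]%classic).
  - by apply: eq_Rintegral => x xcd; rewrite indicE xcd mulr1.
  - by move=> x /=; rewrite !in_itv/= => /andP[cx xd]; rewrite (lt_trans ac cx) (le_lt_trans xd db).
  - by move=> x _ xcd; rewrite indicE memNset ?mulr0.
by rewrite -e2 -[RHS]opprK -e1 opprB.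
Qed.

(** Passage from short intervals to long ones, by induction on the number of pieces of length
    [eta]. *)
Lemma chain_le (F G : R -> R -> R) (eta c d : R) : 0 < eta ->
  (forall s m t, c <= s -> s <= m -> m <= t -> t <= d -> F s m <= G s m -> F m t <= G m t -> F s t <= G s t) ->
  (forall s t, c <= s -> s <= t -> t <= d -> t - s <= eta -> F s t <= G s t) -> c <= d -> F c d <= G c d.
Proof.
move=> eta0 add small cd.
have main n : forall t, c <= t -> t <= d -> t - c <= n%:R * eta -> F c t <= G c t.
  elim: n => [|n IH] t ct td; first by rewrite mul0r => h; apply: small => //; lra.
  rewrite -natr1 mulrDl mul1r => h.
  have [h1|h1] := leP (t - c) eta; first exact: small.
  apply: (add c (t - eta) t) => //; [lra|lra| |].
    by apply: IH; lra.
  by apply: small => //; lra.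
apply: (main (Num.truncn ((d - c) / eta)).+1) => //.
by rewrite -ler_pdivrMr// ltW// truncnS_gt.
Qed.

Hypothesis uc : forall e : R, 0 < e -> exists2 r : R, 0 < r & forall x y : R, `|x - y| <= r -> `|v x - v y| <= e.
Variable M : R.
Hypothesis vM : forall x : R, `|v x| <= M.
Hypothesis step : exists H K, step_function a b H K.

Lemma square_weight_integrable (c d : R) : a < c -> d < b ->
  mu.-integrable `]c, d] (EFin \o (fun x => 3 * (g x * v x ^+ 2))).
Proof.
move=> ac db; have gi := locally_integrable_oc ac db.
have mcd : measurable (`]c, d]%classic : set (measurableTypeR R)) by exact: measurable_itv.
apply: intZ_on => //; apply: (integrable_mul_bounded_on (M := M ^+ 2) mcd gi).
  by apply: measurable_funTS; apply: measurable_funX; exact: continuous_measurableR.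
by move=> x; rewrite normrX ler_pXn2r ?nnegrE//; exact: le_trans (vM x).
Qed.

(** The quadratic is the difference quotient of the cube between [s] and [t], compared with the
    derivative [3 * x ^ 2]; each of two factored terms is at most [e1 * (3 * K)]. *)
Lemma square_weight_le (K e1 x s t : R) : 0 <= e1 -> `|x| <= K -> `|s| <= K -> `|t| <= K ->
  `|x - s| <= e1 -> `|x - t| <= e1 -> `|s ^+ 2 + s * t + t ^+ 2 - 3 * x ^+ 2| <= e1 * (6 * K).
Proof.
move=> e10 hx hs ht h1 h2.
have -> : s ^+ 2 + s * t + t ^+ 2 - 3 * x ^+ 2 = (s - x) * (s + x + t) + (t - x) * (t + x + x) by ring.
have le_prod p q : `|p| <= e1 -> `|q| <= K + K + K -> `|p * q| <= e1 * (K + K + K).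
  by move=> hp hq; rewrite normrM; apply: ler_pM.
have le3 p q r : `|p| <= K -> `|q| <= K -> `|r| <= K -> `|p + q + r| <= K + K + K.
  move=> hp hq hr; apply: le_trans (ler_normD _ _) _; apply: lerD => //.
  by apply: le_trans (ler_normD _ _) _; apply: lerD.
have -> : e1 * (6 * K) = e1 * (K + K + K) + e1 * (K + K + K) by ring.
apply: le_trans (ler_normD _ _) _.
by apply: lerD; apply: le_prod; rewrite 1?distrC//; exact: le3.
Qed.

(** The chain rule without mollification. On a short interval the cube grows by a constant weight
    times the integral of [g], and that weight is uniformly close to [3 * v ^ 2]; the errors add up
    to at most [e] times the integral of [|g|]. *)
Lemma cube_increment (c d : R) : a < c -> c < d -> d < b ->
  v d ^+ 3 - v c ^+ 3 = \int[mu]_(x in `]c, d]) (3 * (g x * v x ^+ 2)).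
Proof.
move=> ac cd db; have M0 : 0 <= M := le_trans (normr_ge0 _) (vM 0).
pose F s t := `|v t ^+ 3 - v s ^+ 3 - \int[mu]_(x in `]s, t]) (3 * (g x * v x ^+ 2))|.
pose N s t := \int[mu]_(x in `]s, t]) `|g x|.
have moc s t : measurable (`]s, t]%classic : set (measurableTypeR R)) by exact: measurable_itv.
have ocsub s t : c <= s -> t <= d -> (`]s, t]%classic : set R) `<=` `]c, d].
  by move=> cs td x /=; rewrite !in_itv/= => /andP[sx xt]; rewrite (le_lt_trans cs sx) (le_trans xt td).
have gi := locally_integrable_oc ac db; have ngi := integrable_norm gi.
have sqi := square_weight_integrable ac db.
have N0 : 0 <= N c d by apply: Rintegral_ge0.
have key (e : R) : 0 < e -> F c d <= e * N c d.
  (* So that the error [e1 * (6 * M)] of [square_weight_le] is at most [e], also when [M = 0]. *)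
  move=> e0; pose e1 := e / (6 * M + 1).
  have M1 : 0 < 6 * M + 1 by lra.
  have e10 : 0 < e1 by rewrite divr_gt0.
  have [r r0 hr] := uc e10.
  apply: (@chain_le F (fun s t => e * N s t) r c d r0) => //; last exact: ltW.
  - move=> s m t cs sm mt td h1 h2.
    have isq := integrableS (moc c d) (moc s t) (ocsub s t cs td) sqi.
    have ing := integrableS (moc c d) (moc s t) (ocsub s t cs td) ngi.
    rewrite /F /N (Rintegral_oc_split sm mt isq) (Rintegral_oc_split sm mt ing) mulrDr.
    apply: le_trans (lerD h1 h2); apply: le_trans (ler_normD _ _); rewrite le_eqVlt; apply/orP; left; apply/eqP.
    by congr (`| _ |); ring.
  - move=> s t cs st td tsr; rewrite /F /N.
    have [->|sNt] := eqVneq s t.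
      rewrite !subrr sub0r normrN set_itvoc0.
      by rewrite !Rintegral_set0 normr0 mulr0.
    have st' : s < t by rewrite lt_neqAle sNt.
    have gi' := integrableS (moc c d) (moc s t) (ocsub s t cs td) gi.
    have ngi' := integrableS (moc c d) (moc s t) (ocsub s t cs td) ngi.
    have sqi' := integrableS (moc c d) (moc s t) (ocsub s t cs td) sqi.
    have inc := weak_derivative_increment step (lt_le_trans ac cs) st' (le_lt_trans td db).
    pose w := v s ^+ 2 + v s * v t + v t ^+ 2.
    have -> : v t ^+ 3 - v s ^+ 3 = \int[mu]_(x in `]s, t]) (w * g x).
      by rewrite (RintegralZl w (moc s t) gi') -inc /w; ring.
    have wgi := intZ_on w (moc s t) gi'.
    rewrite -(RintegralB (moc s t) wgi sqi').
    have di : mu.-integrable `]s, t] (EFin \o (fun x => w * g x - 3 * (g x * v x ^+ 2))).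
      by have := integrableB (moc s t) wgi sqi'; exact: eq_integrable.
    apply: (le_trans (le_normr_Rintegral (moc s t) di)).
    rewrite -(RintegralZl e (moc s t) ngi'); apply: le_Rintegral => //.
    + exact: integrable_norm di.
    + exact: intZ_on.
    move=> x /=; rewrite in_itv/= => /andP[sx xt].
    have -> : w * g x - 3 * (g x * v x ^+ 2) = (w - 3 * v x ^+ 2) * g x by ring.
    rewrite normrM; apply: ler_wpM2r => //.
    have sx0 : 0 <= x - s by rewrite subr_ge0 ltW.
    have tx0 : x - t <= 0 by rewrite subr_le0.
    have h1 : `|v x - v s| <= e1.
      by apply: hr; rewrite ger0_norm//; apply: le_trans tsr; rewrite lerD2r.
    have h2 : `|v x - v t| <= e1.
      by apply: hr; rewrite ler0_norm// opprB; apply: le_trans tsr; rewrite lerD2l lerN2 ltW.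
    apply: (le_trans (square_weight_le (ltW e10) (vM x) (vM s) (vM t) h1 h2)).
    rewrite /e1 mulrAC ler_pdivrMr// ler_wpM2l ?(ltW e0)// lerDl; exact: ler01.
have F0 : F c d = 0.
  apply/eqP; rewrite eq_le normr_ge0 andbT leNgt; apply/negP => F0.
  (* With this choice the bound would be less than half of [F c d]. *)
  have := key (F c d / (2 * (N c d + 1))); have N1 : 0 < 2 * (N c d + 1) by lra.
  move=> /(_ (divr_gt0 F0 N1)); rewrite mulrAC ler_pdivlMr//; move: F0 N0; move: (F c d) (N c d) => p q; nra.
by move/eqP: F0; rewrite normr_eq0 subr_eq0 => /eqP.
Qed.

Hypothesis v0 : forall x, ~ Om x -> v x = 0.
Hypothesis wi : mu.-integrable Om (EFin \o (fun x => g x * v x ^+ 2)).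

(** [g] is integrable only on compact parts of [Om], so the increment of the cube is taken between
    interior points and these are sent to the ends, where [v] is 0; [wi] provides the domination. *)
Lemma nonlinear_term_eq0 : \int[mu]_(x in Om) (g x * v x ^+ 2) = 0.
Proof.
(* Starting from 3 ensures [a + del n < b - del n]. *)
pose del n : R := (b - a) / n.+3%:R.
have ba : 0 < b - a by rewrite subr_gt0.
have del0 n : 0 < del n by rewrite divr_gt0.
have del3 n : del n <= (b - a) / 3 by rewrite ler_pM2l// lef_pV2 ?posrE// ler_nat.
have delc : del @ \oo --> 0.
  rewrite -[X in _ --> X](mulr0 (b - a)); apply: cvgMr.
  exact: (cvg_comp _ _ (@cvg_addnl 2) (@cvg_harmonic R)).
have ac n : a < a + del n by rewrite ltrDl.
have cd n : a + del n < b - del n by have := del3 n; lra.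
have db n : b - del n < b by rewrite gtrDl oppr_lt0.
have inc n := cube_increment (ac n) (cd n) (db n).
have c1 : (fun n => v (b - del n) ^+ 3 - v (a + del n) ^+ 3) @ \oo --> v b ^+ 3 - v a ^+ 3.
  have cub (p : R) (s : nat -> R) : s @ \oo --> p -> (fun n => v (s n) ^+ 3) @ \oo --> v p ^+ 3.
    move=> sp; have h : (fun n => v (s n)) @ \oo --> v p by exact: (cvg_comp _ _ sp (cv (x := p))).
    by under eq_fun do rewrite exprS expr2; rewrite exprS expr2; apply: cvgM => //; apply: cvgM.
  apply: cvgB; apply: cub.
    by rewrite -[X in _ --> X]subr0; apply: cvgB => //; exact: cvg_cst.
  by rewrite -[X in _ --> X]addr0; apply: cvgD => //; exact: cvg_cst.
have va : v a = 0 by apply: v0; rewrite /= in_itv/= ltxx.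
have vb : v b = 0 by apply: v0; rewrite /= in_itv/= ltxx andbF.
rewrite va vb expr0n subrr in c1.
pose f x := 3 * (g x * v x ^+ 2).
have fi : mu.-integrable Om (EFin \o f) by exact: intZ_on.
have mf : measurable_fun Om f by apply/measurable_EFinP; exact: measurable_int fi.
have c2 : (fun n => \int[mu]_(x in Om) (f x * \1_(`]a + del n, b - del n]%classic : set R) x)) @ \oo --> \int[mu]_(x in Om) f x.
  apply: (@Rintegral_dominated_cvg _ Om _ _ (fun x => `|f x|)) => //.
  - move=> n; apply: measurable_realfun.measurable_funM => //; apply: measurable_funTS.
  - exact: integrable_norm fi.
  - by move=> n x _; rewrite normrM indicE; case: (_ \in _); rewrite ?normr1 ?mulr1// normr0 mulr0.
  - move=> x /=; rewrite in_itv/= => /andP[ax xb]; rewrite -[X in _ --> X]mulr1; apply: cvgMr.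
    apply: cvg_near_cst; have xa : 0 < Num.min (x - a) (b - x) by rewrite lt_min !subr_gt0 ax xb.
    have /cvgrPdist_lt/(_ _ xa) := delc; apply: filterS => n; rewrite /= sub0r normrN ger0_norm ?(ltW (del0 n))//.
    by rewrite lt_min => /andP[h1 h2]; rewrite indicE mem_set//= in_itv/=; apply/andP; split; lra.
have e n : \int[mu]_(x in Om) (f x * \1_(`]a + del n, b - del n]%classic : set R) x) = v (b - del n) ^+ 3 - v (a + del n) ^+ 3.
  rewrite inc (@Rintegral_subset _ `]a + del n, b - del n]%classic).
  - by apply: eq_Rintegral => x xcd; rewrite indicE xcd mulr1.
  - by move=> x /=; rewrite !in_itv/= => /andP[cx xd]; rewrite (lt_trans (ac n) cx) (le_lt_trans xd (db n)).
  - by move=> x _ xcd; rewrite indicE memNset ?mulr0.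
have f0 : \int[mu]_(x in Om) f x = 0.
  apply: (cvg_unique _ c2) => //; rewrite /= (_ : (fun n => _) = (fun n => v (b - del n) ^+ 3 - v (a + del n) ^+ 3))//.
  by apply/funext => n; exact: e.
by move: f0; rewrite (RintegralZl 3 mOm wi) => /eqP; rewrite mulf_eq0 pnatr_eq0/= => /eqP.
Qed.

End WeakDerivative.

Section BurgersTerm.
Context {R : realType}.
Notation mu := (@lebesgue_measure R).
Variables a b al : R.
Hypothesis ab : a < b.
Hypothesis al1 : 1 < al.
Hypothesis al2 : al < 2.
Notation Om := (`]a, b[%classic : set R).
Notation tf := (test_function Om).

Let mOm : measurable (Om : set (measurableTypeR R)). Proof. exact: measurable_itv. Qed.

Lemma energy_lim_uniformly_continuous (phi_ : nat -> R -> R) (v : R -> R) : energy_lim a b al phi_ v ->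
  forall e : R, 0 < e -> exists2 r : R, 0 < r & forall x y : R, `|x - y| <= r -> `|v x - v y| <= e.
Proof.
move=> [tp _ _ [d d0 hd]] e e0; have e3 : 0 < e / 3 by rewrite divr_gt0.
have /cvgrPdist_le/(_ _ e3)[N _ hN] := d0.
have dN : d N <= e / 3 by apply: le_trans (hN N (leqnn N)); rewrite /= sub0r normrN ler_norm.
have [L L0 hL] := tf_lipschitz (ltW ab) (tp N).
have L1 : 0 < L + 1 by lra.
exists (e / 3 / (L + 1)) => [|x y xy]; first by rewrite divr_gt0.
have [_ hv _] := hd N; have h1 := hv x; have h2 := hv y.
have h3 : `|phi_ N x - phi_ N y| <= e / 3.
  apply: (le_trans (hL x y)); apply: (@le_trans _ _ (L * (e / 3 / (L + 1)))); first exact: ler_wpM2l.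
  by rewrite mulrA ler_pdivrMr// mulrC ler_wpM2l ?(ltW e3)//; lra.
have -> : v x - v y = (phi_ N x - phi_ N y) - (phi_ N x - v x) + (phi_ N y - v y) by ring.
apply: le_trans (ler_normD _ _) _; have := ler_normB (phi_ N x - phi_ N y) (phi_ N x - v x).
lra.
Qed.

(** Passes from [u] to its continuous representative [v]. Integrability of [g * v ^ 2] up to the
    boundary comes from the product of [u * g] and [v], both in [L^2]. The eigenvalue serves to
    supply the smooth step. *)
Lemma burgers_nonlinear_eq0 (l : R) (u g : R -> R) : dirichlet_eigenvalue al Om l ->
  H0 (al / 2) Om u -> weak_derivative Om u g -> inL2 Om (fun x => u x * g x) ->
  \int[mu]_(x in Om) (u x * g x * u x) = 0.
Proof.
move=> el Hu [_ gl hg] ugL.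
have [phi_ [v [lv uv]]] := H0_energy_lim ab al1 al2 Hu.
have [_ cv v0 _] := lv; have mv := energy_lim_measurable lv; have [mu_ _] := Hu.
have [mg _ _] := gl; have vL := continuous_supp_inL2 ab cv v0.
have [M M0 vM] := continuous_bounded_supp (ltW ab) cv v0.
have mOmf (f : R -> R) : measurable_fun [set: R] f -> measurable_fun Om f by exact: measurable_funTS.
have aeq := @filterS _ _ (ae_filter_ringOfSetsType mu).
have step := step_function_exists ab (dirichlet_eigenvalue_tf ab al1 al2 el).
have mM := @measurable_realfun.measurable_funM _ _ R Om.
have hv phi : tf phi -> \int[mu]_(x in Om) (v x * derive1 phi x) = - \int[mu]_(x in Om) (g x * phi x).
  move=> tp; rewrite -(hg _ tp); have md : measurable_fun Om (derive1 phi).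
    by apply: mOmf; apply: continuous_measurableR; exact: tf_continuous (tf_derive1 tp).
  apply: ae_eq_Rintegral; [exact: mOm|by apply: mM => //; exact: mOmf|by apply: mM => //; exact: mOmf|].
  by apply: aeq uv => x ->.
have vgv : mu.-integrable Om (EFin \o (fun x => g x * v x ^+ 2)).
  have i1 := inL2_mul mOm ugL vL.
  apply/integrableP; split.
    by apply/measurable_EFinP; apply: mM => //; apply: mOmf; exact: measurable_funX.
  have /integrableP[mi1] := i1; apply: le_lt_trans.
  rewrite le_eqVlt; apply/orP; left; apply/eqP; apply: ae_eq_integral => //.
  - apply: measurableT_comp => //; apply/measurable_EFinP.
    by apply: mM => //; apply: mOmf; exact: measurable_funX.
  - exact: measurableT_comp.
  - by apply: aeq uv => x ux _ /=; rewrite ux; congr (`| _ |%:E); ring.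
have -> : \int[mu]_(x in Om) (u x * g x * u x) = \int[mu]_(x in Om) (g x * v x ^+ 2).
  apply: ae_eq_Rintegral; first exact: mOm.
  - exact: (mM _ _ (mM _ _ (mOmf _ mu_) mg) (mOmf _ mu_)).
  - by apply: mM => //; apply: mOmf; exact: measurable_funX.
  - by apply: aeq uv => x ->; ring.
exact: (nonlinear_term_eq0 ab cv gl hv (energy_lim_uniformly_continuous lv) vM step v0 vgv).
Qed.

End BurgersTerm.

(** * Growth of the norm in time *)

Section Majorant.
Context {R : realType}.
Notation mu := (@lebesgue_measure R).
Local Open Scope ereal_scope.

(** The layer sum rounds [r] up to a multiple of [e] and truncates it at [N * e]; this and the next
    lemma bound it from above and below. *)
Lemma layer_sum_le (e r : R) N : (0 <= e)%R -> (0 <= r)%R ->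
  (\sum_(0 <= n < N) e * (n%:R * e < r)%R%:R <= Num.min (N%:R * e) (r + e))%R.
Proof.
move=> e0 r0; elim: N => [|N IH].
  by rewrite big_geq// mul0r le_min lexx addr_ge0.
rewrite big_nat_recr//=; move: IH; rewrite !le_min -natr1 mulrDl mul1r.
move: (\sum_(0 <= n < N) _)%R => S /andP[h1 h2].
have [h|h] := ltP; rewrite ?mulr1 ?mulr0; apply/andP; split; lra.
Qed.

Lemma layer_sum_ge (e r : R) N : (0 <= e)%R ->
  (Num.min (N%:R * e) r <= \sum_(0 <= n < N) e * (n%:R * e < r)%R%:R)%R.
Proof.
move=> e0; elim: N => [|N IH]; first by rewrite big_geq// mul0r ge_min lexx.
rewrite big_nat_recr//=; move: IH; rewrite !ge_min -natr1 mulrDl mul1r.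
move: (\sum_(0 <= n < N) _)%R => S h.
by have [h'|h'] := ltP; rewrite ?mulr1 ?mulr0; case/orP: h => h; apply/orP; first [left; lra|right; lra].
Qed.

(* Vitali-Caratheodory: the majorant is the layer sum of open neighbourhoods of
   the sets where [g] exceeds [n * e]. *)
Lemma lsc_majorant (T e : R) (g : R -> R) : (0 < e)%R -> (0 <= T)%R ->
  measurable_fun (`[0%R, T]%classic : set R) g -> (forall x : R, (0 <= x <= T)%R -> (0 <= g x)%R) ->
  exists h : R -> \bar R, [/\ measurable_fun [set: R] h, forall x, 0 <= h x,
    \int[mu]_(x in (`[0%R, T] : set R)) h x <= \int[mu]_(x in (`[0%R, T] : set R)) (g x)%:E + (e * (T + 1))%:E &
    forall t : R, (0 <= t <= T)%R -> exists2 r : R, (0 < r)%R & forall x : R, (`|x - t| < r)%R -> (g t)%:E <= h x].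
Proof.
move=> e0 T0 mg g0; pose I : set R := `[0%R, T]%classic.
have mI : measurable (I : set (measurableTypeR R)) by exact: measurable_itv.
pose A n : set R := I `&` [set x | (n%:R * e < g x)%R].
have mA n : measurable (A n : set (measurableTypeR R)).
  have -> : A n = I `&` (g @^-1` `](n%:R * e)%R, +oo[%classic).
    by apply/seteqP; split=> x [Ix /= h]; split => //; move: h; rewrite /= in_itv/= andbT.
  by apply: mg => //; exact: measurable_itv.
have muI : mu I = T%:E.
  by rewrite lebesgue_measure_itv/= lte_fin; case: ltgtP T0 => // [|<-]; rewrite ?sube0.
have Afin n : mu (A n) < +oo.
  apply: (@le_lt_trans _ _ (mu I)); last by rewrite muI ltry.
  by apply: le_measure; rewrite ?inE//; apply: subIsetl.
(* The excess measures are below [2 ^ (- (n + 1))], so the enlargement costs at most [e] in total;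
   rounding up to multiples of [e] costs another [e * T]. *)
have /(@boolp.choice _ _ _)[U hU] : forall n : nat, exists U : set R,
    [/\ open U, A n `<=` U & mu (U `\` A n) < (1 / (2 ^ n.+1)%:R)%:E].
  move=> n; have h : (0 < 1 / (2 ^ n.+1)%:R :> R)%R by rewrite divr_gt0// ltr0n expn_gt0.
  exact: (lebesgue_regularity_outer (mA n) (Afin n) h).
have mU n : measurable (U n : set (measurableTypeR R)) by apply: open_measurable; case: (hU n).
pose f n (x : R) := (e * \1_(U n) x)%:E.
have mf n : measurable_fun [set: R] (f n).
  by apply/measurable_EFinP; apply: measurable_realfun.measurable_funM => //; exact: measurable_indic (mU n).
have f0 n x : 0 <= f n x by rewrite lee_fin mulr_ge0 ?(ltW e0)//.
pose fA n (x : R) := (e * \1_(A n) x)%:E.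
have mfA n : measurable_fun [set: R] (fA n).
  by apply/measurable_EFinP; apply: measurable_realfun.measurable_funM => //; exact: measurable_indic (mA n).
have fA0 n x : 0 <= fA n x by rewrite lee_fin mulr_ge0 ?(ltW e0)//.
have mfAs : measurable_fun [set: R] (fun x => \sum_(n <oo) fA n x) by apply: ge0_emeasurable_sum.
have intf (B : set R) : measurable (B : set (measurableTypeR R)) ->
    \int[mu]_(x in I) (e * \1_B x)%:E = e%:E * mu (B `&` I).
  move=> mB; under eq_integral do rewrite EFinM; rewrite ge0_integralZl//.
  - by rewrite integral_indic.
  - by apply/measurable_EFinP; apply: measurable_funTS; exact: measurable_indic mB.
  - by rewrite lee_fin ltW.
exists (fun x => \sum_(n <oo) f n x); split.
- by apply: ge0_emeasurable_sum.
- by move=> x; apply: nneseries_ge0.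
- have mfI n : measurable_fun I (f n) by exact: measurable_funTS.
  rewrite integral_nneseries//.
  apply: (@le_trans _ _ (\sum_(n <oo) (e%:E * mu (A n) + (e / (2 ^ n.+1)%:R)%:E))).
    apply: lee_nneseries => [n _ _|n _]; first by apply: integral_ge0.
    rewrite intf//; have [_ AU hn] := hU n.
    have -> : (e / (2 ^ n.+1)%:R)%:E = e%:E * (1 / (2 ^ n.+1)%:R)%:E by rewrite -EFinM mul1r.
    have e2 : 0 <= (1 / (2 ^ n.+1)%:R : R)%:E by rewrite lee_fin divr_ge0.
    rewrite -(ge0_muleDr _ (measure_ge0 mu (A n)) e2).
    apply: lee_wpmul2l; first by rewrite lee_fin ltW.
    apply: (@le_trans _ _ (mu (U n))); first by apply: le_measure; rewrite ?inE//; exact: measurableI.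
    rewrite -(setDUK AU); apply: le_trans (measureU2 _ _ _) _ => //; first exact: measurableD.
    by rewrite leeD2l// ltW.
  apply: le_trans (epsilon_trick _ _ (ltW e0)) _.
    by move=> n; rewrite mule_ge0// lee_fin ltW.
  have -> : (e * (T + 1) = e * T + e)%R by rewrite mulrDr mulr1.
  rewrite EFinD addeA leeD2r//.
  have eA n : e%:E * mu (A n) = \int[mu]_(x in I) fA n x.
    by rewrite intf//; congr (_ * mu _); rewrite setIC setIA setIid.
  under eq_eseriesr do rewrite eA.
  have mfAI n : measurable_fun I (fA n) by exact: measurable_funTS.
  rewrite -integral_nneseries//.
  have -> : (e * T)%:E = \int[mu]_(x in I) e%:E by rewrite integral_cst// EFinM; congr (_ * _); exact/esym.
  have g0' x : I x -> 0 <= (g x)%:E by move=> Ix; rewrite lee_fin g0.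
  have mg' : measurable_fun I (fun x => (g x)%:E) by exact/measurable_EFinP.
  have e0' x : I x -> 0 <= e%:E by move=> _; rewrite lee_fin ltW.
  rewrite -ge0_integralD//.
  apply: ge0_le_integral => //.
  + by move=> x _; apply: nneseries_ge0.
  + exact: measurable_funTS mfAs.
  + by apply: emeasurable_funD; [exact/measurable_EFinP|exact: measurable_cst].
  move=> x Ix; apply: lime_le; first exact: is_cvg_nneseries.
  apply: nearW => N; rewrite /fA sumEFin -EFinD lee_fin.
  have gx0 : (0 <= g x)%R by apply: g0; move: Ix; rewrite /I/= in_itv.
  have := layer_sum_le N (ltW e0) gx0; rewrite le_min => /andP[_]; apply: le_trans.
  rewrite le_eqVlt; apply/orP; left; apply/eqP; apply: eq_bigr => n _; congr (_ * _)%R.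
  rewrite indicE; case: ltP => h; first by rewrite mem_set.
  by rewrite memNset// => -[_ /=]; rewrite ltNge h.
- move=> t tT; have gt0 := g0 _ tT.
  (* The first [N + 1] layers already reach [g t], so only finitely many open sets have to be
     intersected around [t]. *)
  pose N := (Num.truncn (g t / e)).
  have r0 : (0 <= g t / e)%R by rewrite divr_ge0// ltW.
  have /andP[t1 t2] := Num.Theory.truncn_itv r0.
  have near_all M : exists2 r : R, (0 < r)%R & forall n, (n < M)%N -> A n t -> forall x : R, (`|x - t| < r)%R -> U n x.
    elim: M => [|M [r r0' hr]]; first by exists 1%R.
    have [AM|AM] := pselect (A M t); last first.
      exists r => // n; rewrite ltnS leq_eqVlt => /predU1P[-> //|]; exact: hr.
    have [oU AU _] := hU M.
    have /nbhs_ballP[r' /= r'0 hr'] := open_nbhs_nbhs (conj oU (AU _ AM)).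
    exists (Num.min r r') => [|n]; first by rewrite lt_min r0'.
    rewrite ltnS leq_eqVlt => /predU1P[-> _ x|nM An x]; rewrite lt_min => /andP[h1 h2].
      by apply: hr'; rewrite /ball /= distrC.
    exact: hr h1.
  have [r r0' hr] := near_all N.+1.
  exists r => // x xt.
  apply: (@le_trans _ _ (\sum_(0 <= n < N.+1 | true) f n x)); last first.
    exact: (@nneseries_lim_ge R (f ^~ x) xpredT 0%N N.+1 (fun n _ _ => f0 n x)).
  rewrite /f sumEFin lee_fin.
  have := layer_sum_ge (g t) N.+1 (ltW e0).
  have -> : (Num.min (N.+1%:R * e) (g t) = g t)%R by apply/min_idPr; rewrite -ler_pdivrMr// ltW.
  move/le_trans; apply; rewrite big_nat_cond [leRHS]big_nat_cond; apply: ler_sum => n /andP[/andP[_ nN] _].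
  rewrite ler_pM2l// indicE; case: ltP => // h; rewrite mem_set//.
  by apply: (hr n nN) => //; split => //; rewrite /I /= in_itv.
Qed.

End Majorant.

(** * Comparison through an upper Dini derivative *)

Section Comparison.
Context {R : realType}.
Notation mu := (@lebesgue_measure R).

(** Continuous induction: the set of times up to which [z] stays below the comparison function [C]
    contains its supremum and can be extended beyond it. The derivative bound is assumed only where
    [z] is positive. *)
Lemma dini_comparison (T : R) (z g : R -> R) : 0 <= T ->
  (forall t : R, 0 <= t <= T -> 0 <= z t) ->
  (forall t e : R, 0 <= t <= T -> 0 < e -> exists2 r : R, 0 < r &
     forall s : R, 0 <= s <= T -> `|s - t| < r -> `|z s - z t| <= e) ->
  (forall t : R, 0 <= t <= T -> 0 <= g t) -> measurable_fun (`[0, T]%classic : set R) g ->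
  (forall t e : R, 0 <= t <= T -> 0 < z t -> 0 < e -> exists2 r : R, 0 < r &
     forall s : R, t < s -> s <= T -> s < t + r -> z s <= z t + (s - t) * (g t + e)) ->
  ((z T)%:E <= (z 0)%:E + \int[mu]_(x in (`[0%R, T]%classic : set R)) (g x)%:E)%E.
Proof.
move=> T0 z0 cz g0 mg dz.
have [fin|] := boolP ((\int[mu]_(x in (`[0%R, T]%classic : set R)) (g x)%:E)%E \is a fin_num); last first.
  rewrite ge0_fin_numE; last by apply: integral_ge0 => x /=; rewrite in_itv/= => xT; rewrite lee_fin g0.
  by rewrite -leNgt leye_eq => /eqP ->; rewrite addey// leey.
have := fineK fin; move: (fine _) => G GE; rewrite -GE.
apply/lee_addgt0Pr => e e0.
(* The slack is spent as [e1] at the start, [e1 * (T + 1)] in the majorant and [e1 * T] for the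
   derivative, which is [e] altogether. *)
pose e1 := e / (2 * T + 2).
have T2 : 0 < 2 * T + 2 by lra.
have e10 : 0 < e1 by rewrite divr_gt0.
have [h [mh h0 hI hl]] := lsc_majorant e10 T0 mg g0.
rewrite -GE in hI.
pose J (x : R) := (\int[mu]_(t in (`]0%R, x]%classic : set R)) h t)%E.
have J0 x : (0 <= J x)%E by apply: integral_ge0 => t _; exact: h0.
have moc (x y : R) : measurable (`]x, y]%classic : set (measurableTypeR R)) by exact: measurable_itv.
have mcc (x y : R) : measurable (`[x, y]%classic : set (measurableTypeR R)) by exact: measurable_itv.
have JT : (J T <= G%:E + (e1 * (T + 1))%:E)%E.
  apply: le_trans hI; apply: ge0_subset_integral => //; first exact: measurable_funTS.
  by move=> x /=; rewrite !in_itv/= => /andP[/ltW -> ->].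
have Jsub (x y : R) : x <= y -> (J x <= J y)%E.
  move=> xy; apply: ge0_subset_integral => //; first exact: measurable_funTS.
  by move=> t /=; rewrite !in_itv/= => /andP[-> tx]; exact: le_trans xy.
have Jfin (x : R) : x <= T -> J x \is a fin_num.
  move=> xT; rewrite ge0_fin_numE//; apply: (le_lt_trans (Jsub _ _ xT)); apply: (le_lt_trans JT).
  by rewrite -EFinD ltry.
have Jadd (x y : R) : 0 <= x -> x <= y -> (J y = J x + \int[mu]_(t in (`]x, y]%classic : set R)) h t)%E.
  move=> x0 xy; have hs : `]0%R, y]%classic = `]0%R, x]%classic `|` `]x, y]%classic :> set R.
    apply/seteqP; split=> t /=; rewrite !in_itv/=.
      by move=> /andP[t0 ty]; case: (leP t x) => tx; [left|right]; rewrite ?t0 ?tx.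
    by case=> /andP[h1 h2]; [rewrite h1 (le_trans h2)|rewrite h2 (le_lt_trans x0)].
  rewrite /J hs ge0_integral_setU//; first exact: measurable_funTS.
  by apply/disj_setPLR => t /=; rewrite !in_itv/= => /andP[_ tx] /andP[xt _]; move: (lt_le_trans xt tx); rewrite ltxx.
(* The constant [e1] keeps [C] away from 0, which handles zeros of [z]; the term [e1 * x] absorbs
   the error of the derivative bound. *)
pose C (x : R) := z 0 + e1 + fine (J x) + e1 * x.
have C0 x : 0 <= x -> e1 <= C x.
  move=> x0; have z00 : 0 <= z 0 by apply: z0; rewrite lexx.
  have := fine_ge0 (J0 x); have : 0 <= e1 * x by rewrite mulr_ge0// ltW.
  by rewrite /C; move: (fine _) (e1 * x) => *; lra.
have Cmono (x y : R) : x <= y -> y <= T -> C x <= C y.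
  move=> xy yT; rewrite /C; apply: lerD; last by rewrite ler_pM2l.
  by rewrite lerD2l fine_le ?Jfin ?Jsub// (le_trans xy).
pose S := [set x : R | 0 <= x <= T /\ forall y : R, 0 <= y <= x -> z y <= C y].
have S0 : S 0.
  split; first by rewrite lexx.
  move=> y /andP[y0 y0']; have -> : y = 0 by apply/le_anti; rewrite y0 y0'.
  have := fine_ge0 (J0 0); rewrite /C mulr0; move: (fine _) => *; lra.
have hS : has_sup S by split; [exists 0|exists T => x [/andP[]]].
pose s := sup S.
have s0 : 0 <= s by apply: ub_le_sup => //; case: hS.
have sT : s <= T by apply: ge_sup => [|x [/andP[]]//]; exists 0.
have Sbelow y : 0 <= y -> y < s -> z y <= C y.
  move=> y0 ys; have sy0 : 0 < s - y by rewrite subr_gt0.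
  have [x [_ hx] yx] := sup_adherent sy0 hS.
  by apply: hx; rewrite y0 ltW// (_ : y = sup S - (s - y))// /s; ring.
(* Continuity of [z] and monotonicity of [C] suffice: an excess at [s] would already be visible
   slightly to the left. *)
have Ss : S s.
  split; first by rewrite s0.
  move=> y /andP[y0]; rewrite le_eqVlt => /predU1P[->|ys]; last exact: Sbelow.
  move: (s0); rewrite le_eqVlt => /predU1P[<-|s_gt0]; first by have [_ ->] := S0; rewrite ?lexx.
  rewrite leNgt; apply/negP => Cz.
  have zp : 0 < (z s - C s) / 2 by rewrite divr_gt0// subr_gt0.
  have sI : 0 <= s <= T by rewrite s0.
  have [r r0 hr] := cz s _ sI zp.
  pose y' := Num.max 0 (s - r / 2).
  have y's : y' < s by rewrite gt_max s_gt0/= ltrBlDr ltrDl divr_gt0.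
  have y'0 : 0 <= y' by rewrite le_max lexx.
  have y'r : s - r / 2 <= y' by rewrite le_max lexx orbT.
  have := hr y'; rewrite y'0 (le_trans (ltW y's) sT) => /(_ isT).
  have : `|y' - s| < r by rewrite ltr0_norm ?subr_lt0//; move: y'r r0; clear => *; lra.
  move=> h1 /(_ h1); rewrite ler_norml => /andP[h2 _].
  have := Sbelow y' y'0 y's; have := Cmono y' s (ltW y's) sT; move: Cz h2; move: (C s) (C y') (z s) (z y'); clear => *; lra.
suff sE : s = T.
  have := Ss.2 T; rewrite sE T0 lexx => /(_ isT) zT.
  have : (z T <= z 0 + e1 + fine (J T) + e1 * T) by [].
  rewrite -lee_fin => /le_trans; apply; rewrite !EFinD fineK ?Jfin//.
  have -> : ((z 0)%:E + G%:E + e%:E = (z 0)%:E + e1%:E + (G%:E + (e1 * (T + 1))%:E) + (e1 * T)%:E)%E.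
    rewrite -!EFinD; congr EFin.
    have : e1 * (2 * T + 2) = e by rewrite /e1 divfK// gt_eqF.
    by move=> <-; ring.
  by apply: leeD => //; apply: leeD.
apply/eqP; rewrite eq_le sT leNgt; apply/negP => s_lt.
have [r r0 hr] : exists2 r : R, 0 < r & forall y : R, s < y -> y <= T -> y < s + r -> z y <= C y.
  have sI : 0 <= s <= T by rewrite s0.
  (* At a zero of [z] there is no derivative bound, but by continuity [z] stays below [e1], hence
     below [C], for a while. *)
  have [zs|zs] := eqVneq (z s) 0.
    have [r r0 hr] := cz s e1 sI e10; exists r => // y sy yT yr.
    have y0 : 0 <= y by apply: le_trans s0 (ltW sy).
    have := hr y; rewrite y0 yT => /(_ isT).
    have h1 : `|y - s| < r by rewrite gtr0_norm ?subr_gt0// ltrBlDl.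
    by move=> /(_ h1); rewrite zs subr0 ler_norml => /andP[_ ze]; exact: le_trans ze (C0 y y0).
  have zs0 : 0 < z s by rewrite lt0r zs z0.
  have [r1 r10 h1] := dz s e1 sI zs0 e10; have [r2 r20 h2] := hl s sI.
  exists (Num.min r1 r2) => [|y sy yT]; first by rewrite lt_min r10.
  rewrite -ltrBlDl lt_min => /andP[y1 y2].
  have yz : z y <= z s + (y - s) * (g s + e1) by apply: h1 => //; rewrite -ltrBlDl.
  have zC : z s <= C s by apply: Ss.2; rewrite s0 lexx.
  (* This is what the semicontinuous majorant is for: [h] is at least [g s] on a whole neighbourhood
     of [s], which a merely measurable [g] would not ensure. *)
  have JJ : fine (J s) + (y - s) * g s <= fine (J y).
    rewrite -lee_fin EFinD (fineK (Jfin _ sT)) (fineK (Jfin _ yT)) (Jadd s y s0 (ltW sy)) leeD2l//.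
    apply: (@le_trans _ _ (\int[mu]_(t in (`]s, y]%classic : set R)) (g s)%:E)%E).
      by rewrite integral_cst// /= lebesgue_measure_itv/= lte_fin sy -EFinD -EFinM mulrC.
    apply: ge0_le_integral => //.
    - by move=> t _; rewrite lee_fin g0.
    - exact: measurable_funTS.
    - move=> t /=; rewrite in_itv/= => /andP[st ty]; apply: h2.
      by rewrite gtr0_norm ?subr_gt0//; move: ty y2; clear => *; lra.
  move: yz zC JJ; rewrite /C; move: (fine _) (fine _) (z y) (z s) (g s); clear => *; lra.
pose s' := Num.min T (s + r / 2).
have ss' : s < s' by rewrite lt_min s_lt/= ltrDl divr_gt0.
have s'T : s' <= T by rewrite ge_min lexx.
have s'r : s' <= s + r / 2 by rewrite ge_min lexx orbT.
have Ss' : S s'.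
  split; first by rewrite (le_trans s0 (ltW ss')).
  move=> y /andP[y0 ys']; have [ys|sy] := leP y s; first by apply: Ss.2; rewrite y0.
  apply: hr => //; first exact: le_trans ys' s'T.
  by move: ys' s'r r0; clear => *; lra.
have : s' <= s by apply: ub_le_sup => //; case: hS.
by rewrite leNgt ss'.
Qed.

End Comparison.

Section L2Triangle.
Context {R : realType}.
Notation mu := (@lebesgue_measure R).
Variable D : set R.
Hypothesis mD : measurable (D : set (measurableTypeR R)).
Implicit Types f g : R -> R.

Lemma L2norm_sqr_expand f g (t : R) : inL2 D f -> inL2 D g ->
  L2norm D (fun x => f x + t * g x) ^+ 2 =
  L2norm D f ^+ 2 + 2 * t * \int[mu]_(x in D) (f x * g x) + t ^+ 2 * L2norm D g ^+ 2.
Proof. by move=> fL gL; rewrite !L2norm_sqr; exact: Rintegral_sqr_expand. Qed.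

Lemma L2norm_eq f g : (forall x, D x -> f x = g x) -> L2norm D f = L2norm D g.
Proof. by move=> fg; rewrite !L2normE; congr (Num.sqrt _); apply: eq_Rintegral => x /set_mem /fg ->. Qed.

Lemma L2normZ (k : R) f : inL2 D f -> L2norm D (fun x => k * f x) = `|k| * L2norm D f.
Proof.
move=> /(inL2P mD)[_ fi]; rewrite !L2normE.
have -> : \int[mu]_(x in D) ((k * f x) ^+ 2) = k ^+ 2 * \int[mu]_(x in D) (f x ^+ 2).
  by rewrite -(RintegralZl (k ^+ 2) mD fi); apply: eq_Rintegral => x _; rewrite exprMn.
by rewrite sqrtrM ?sqr_ge0// sqrtr_sqr.
Qed.

Lemma L2normD f g : inL2 D f -> inL2 D g -> L2norm D (fun x => f x + g x) <= L2norm D f + L2norm D g.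
Proof.
move=> fL gL; rewrite -(@ler_pXn2r _ 2) ?nnegrE ?addr_ge0 ?L2norm_ge0//.
have -> : L2norm D (fun x => f x + g x) = L2norm D (fun x => f x + 1 * g x).
  by apply: L2norm_eq => x _; rewrite mul1r.
rewrite (L2norm_sqr_expand 1 fL gL).
have := L2_cauchy_schwarz mD fL gL; have := ler_norm (\int[mu]_(x in D) (f x * g x)).
move: (\int[mu]_(x in D) (f x * g x)) (L2norm D f) (L2norm D g) => p q r h1 h2.
by have := le_trans h1 h2; nra.
Qed.

Lemma L2norm_sum (n : nat) (f : 'I_n -> R -> R) : (forall i, inL2 D (f i)) ->
  L2norm D (fun x => \sum_i f i x) <= \sum_i L2norm D (f i).
Proof.
elim: n f => [|n IH] f fL.
  rewrite big_ord0 L2normE /Rintegral integral0_eq ?sqrtr0// => x _.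
  by rewrite big_ord0 expr0n.
rewrite big_ord_recl; have -> : L2norm D (fun x => \sum_i f i x) =
    L2norm D (fun x => f ord0 x + \sum_i f (lift ord0 i) x).
  by apply: L2norm_eq => x _; rewrite big_ord_recl.
have fL' i : inL2 D (f (lift ord0 i)) by exact: fL.
by apply: le_trans (L2normD (fL ord0) (inL2_sum mD fL')) _; rewrite lerD2l; exact: IH.
Qed.

Lemma tangent_map_inL2 (n : nat) (d : 'I_n -> R -> R) (gam : 'rV[R]_n) : (forall j, inL2 D (d j)) ->
  inL2 D (tangent_map d gam).
Proof. by move=> dL; apply: inL2_sum => // i; exact: inL2Z. Qed.

Lemma tangent_map_le (n : nat) (d : 'I_n -> R -> R) (gam : 'rV[R]_n) (e : R) : (forall j, inL2 D (d j)) ->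
  (forall j, `|gam 0 j| <= e) -> L2norm D (tangent_map d gam) <= e * \sum_j L2norm D (d j).
Proof.
move=> dL ge; have dL' j : inL2 D (fun x => gam 0 j * d j x) by exact: inL2Z.
apply: le_trans (L2norm_sum dL') _; rewrite mulr_sumr; apply: ler_sum => j _.
by rewrite L2normZ// ler_wpM2r// L2norm_ge0.
Qed.

End L2Triangle.

(** * Differentiability of the curve of functions in [L^2] *)

Section Curve.
Context {R : realType} {N : nat}.

Lemma l2norm_le (gam : 'rV[R]_N) : l2norm gam <= \sum_j `|gam 0 j|.
Proof.
rewrite /l2norm -(@ler_pXn2r _ 2) ?nnegrE ?sqrtr_ge0 ?sumr_ge0//.
rewrite sqr_sqrtr; last by apply: sumr_ge0 => j _; exact: sqr_ge0.
suff : forall s : seq 'I_N, \sum_(j <- s) gam 0 j ^+ 2 <= (\sum_(j <- s) `|gam 0 j|) ^+ 2 by exact.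
elim=> [|i s IH]; first by rewrite !big_nil expr0n.
rewrite !big_cons; have : 0 <= \sum_(j <- s) `|gam 0 j| by apply: sumr_ge0.
have := normr_ge0 (gam 0 i); rewrite -(real_normK (num_real (gam 0 i))).
by move: IH; move: (\sum_(j <- s) _) (\sum_(j <- s) _) (`|_|) => p q r; nra.
Qed.

Lemma curve_diff (q : R -> 'rV[R]_N) (t : R) (gam : 'rV[R]_N) (e : R) : 0 < e ->
  curve_deriv_within (`[0, +oo[)%classic q t gam ->
  exists2 r : R, 0 < r & forall s : R, 0 <= s -> `|s - t| < r -> s != t ->
    forall j, `|(q s - q t - (s - t) *: gam) 0 j| <= e * `|s - t|.
Proof.
move=> e0 dq.
have h j : \forall s \near within (`[0, +oo[)%classic t^', `|(q s 0 j - q t 0 j) / (s - t) - gam 0 j| <= e.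
  by have /cvgrPdist_le/(_ _ e0) := dq j; apply: filterS => s; rewrite distrC.
have hF : nbhs t (fun s : R => s != t -> (`[0, +oo[)%classic s ->
    forall j, `|(q s 0 j - q t 0 j) / (s - t) - gam 0 j| <= e).
  exact: (filter_forall _ h).
have [r /= r0 hr] := (nbhs_ballP _ _).1 hF.
exists r => // s s0 sr st j; have st0 : s - t != 0 by rewrite subr_eq0.
have := hr s; rewrite /ball /= distrC in_itv/= andbT => /(_ sr st s0 j) h1.
rewrite !mxE -(@ler_pM2r _ `|s - t|^-1) ?invr_gt0 ?normr_gt0// mulfK ?normr_eq0//.
by rewrite -normfV -normrM mulrBl mulrAC divff// mul1r.
Qed.

End Curve.

Section ParametricCurve.
Context {R : realType} {N : nat}.
Notation mu := (@lebesgue_measure R).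
Variable D : set R.
Hypothesis mD : measurable (D : set (measurableTypeR R)).

(** The chain rule. The error is the remainder of [Phi] along the displacement plus the tangent map
    applied to the remainder [zeta] of the curve; each receives half of [e]. *)
Lemma param_curve_diff (Q : set 'rV[R]_N) (Phi : 'rV[R]_N -> R -> R) (dPhi : 'rV[R]_N -> 'I_N -> R -> R)
    (q : R -> 'rV[R]_N) (t : R) (gam : 'rV[R]_N) (e : R) :
  param_differentiable D Q Phi dPhi -> (forall s, 0 <= s -> Q (q s)) -> 0 <= t -> 0 < e ->
  curve_deriv_within (`[0, +oo[)%classic q t gam ->
  exists2 r : R, 0 < r & forall s : R, 0 <= s -> `|s - t| < r ->
    L2norm D (fun x => Phi (q s) x - Phi (q t) x - (s - t) * tangent_map (dPhi (q t)) gam x) <= e * `|s - t|.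
Proof.
move=> PhiD Qq t0 e0 dq; have [PL dL hd] := PhiD _ (Qq t t0).
pose S := \sum_j L2norm D (dPhi (q t) j); pose L := \sum_j `|gam 0 j|.
have S0 : 0 <= S by apply: sumr_ge0 => j _; exact: L2norm_ge0.
have L0 : 0 <= L by apply: sumr_ge0.
(* [S] bounds the tangent map on vectors with entries at most 1 in absolute value, and [B] below
   bounds the speed of the curve; adding 1 keeps the denominators positive. *)
pose e1 := e / 2 / (S + 1); have S1 : 0 < S + 1 by lra.
have e10 : 0 < e1 by rewrite !divr_gt0.
pose B := L + N%:R * e1; have B0 : 0 <= B by rewrite addr_ge0// mulr_ge0// ltW.
have B1 : 0 < B + 1 by lra.
pose e2 := e / 2 / (B + 1); have e20 : 0 < e2 by rewrite !divr_gt0.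
have [d d0 hd'] := hd _ e20.
have [r1 r10 hr1] := curve_diff e10 dq.
exists (Num.min r1 (d / (B + 1))) => [|s s0]; first by rewrite lt_min r10 divr_gt0.
rewrite lt_min => /andP[sr1 sr2].
have tL := tangent_map_inL2 mD gam dL.
have [->|st] := eqVneq s t.
  rewrite subrr normr0 mulr0 (@L2norm_eq _ _ _ (fun x => 0 * tangent_map (dPhi (q t)) gam x)).
    by rewrite L2normZ// normr0 mul0r.
  by move=> x _; rewrite subrr sub0r mul0r oppr0.
have hz := hr1 s s0 sr1 st; set tau := s - t in sr1 sr2 hz *.
pose zeta := q s - q t - tau *: gam.
have qE : q s - q t = tau *: gam + zeta by rewrite /zeta [RHS]addrC subrK.
have tau0 : 0 < `|tau| by rewrite normr_gt0 subr_eq0.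
have lB : l2norm (q s - q t) <= B * `|tau|.
  apply: le_trans (l2norm_le _) _; rewrite qE /B mulrDl.
  apply: (@le_trans _ _ (\sum_(j < N) (`|tau| * `|gam 0 j| + e1 * `|tau|))).
    apply: ler_sum => j _; rewrite !mxE; apply: le_trans (ler_normD _ _) _; rewrite normrM lerD2l.
    by have := hz j; rewrite !mxE.
  rewrite big_split/= -mulr_sumr sumr_const card_ord -/L mulr_natl mulrC.
  by rewrite lerD2l mulrnAl.
have lBd : l2norm (q s - q t) < d.
  apply: le_lt_trans lB _; apply: (@le_lt_trans _ _ ((B + 1) * `|tau|)).
    by apply: ler_wpM2r => //; rewrite lerDl ler01.
  by rewrite mulrC -ltr_pdivlMr.
have h1 := hd' _ (Qq s s0) lBd.
have [PsL _ _] := PhiD _ (Qq s s0).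
have zL := tangent_map_inL2 mD zeta dL.
have dqL := tangent_map_inL2 mD (q s - q t) dL.
have -> : L2norm D (fun x => Phi (q s) x - Phi (q t) x - tau * tangent_map (dPhi (q t)) gam x) =
    L2norm D (fun x => (Phi (q s) x - Phi (q t) x - tangent_map (dPhi (q t)) (q s - q t) x) +
      tangent_map (dPhi (q t)) zeta x).
  apply: L2norm_eq => x _; rewrite -[LHS]addr0 -addrA -[RHS]addrA; congr (_ + _).
  rewrite addr0 /tangent_map mulr_sumr -!sumrN -big_split/=; apply: eq_bigr => j _.
  by rewrite qE !mxE; ring.
apply: le_trans (L2normD mD _ zL) _.
  by apply: inL2B => //; apply: inL2B.
have h2 : L2norm D (tangent_map (dPhi (q t)) zeta) <= e / 2 * `|tau|.
  apply: le_trans (tangent_map_le mD dL hz) _; rewrite -/S mulrAC; apply: ler_wpM2r => //.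
  by rewrite /e1 mulrAC ler_pdivrMr// ler_pM2l ?divr_gt0// lerDl ler01.
have h3 : e2 * l2norm (q s - q t) <= e / 2 * `|tau|.
  apply: (@le_trans _ _ (e2 * (B * `|tau|))); first by rewrite ler_pM2l.
  rewrite mulrA; apply: ler_wpM2r => //.
  by rewrite /e2 mulrAC ler_pdivrMr// ler_pM2l ?divr_gt0// lerDl ler01.
by have := lerD (le_trans h1 h3) h2; rewrite -mulrDl -splitr.
Qed.

End ParametricCurve.

Section Growth.
Context {R : realType}.
Notation mu := (@lebesgue_measure R).

Lemma is_derive_upper (B : R -> R) (t d e : R) : is_derive t 1 B d -> 0 < e ->
  exists2 r : R, 0 < r & forall s, t < s -> s < t + r -> B s <= B t + (s - t) * (d + e).
Proof.
move=> [dB Bd] e0; have := derivableP dB.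
move=> [dB' _]; have /cvgrPdist_le/(_ _ e0) := dB'.
rewrite /= => /nbhs_ballP[r /= r0 hr]; exists r => // s ts sr.
have st0 : 0 < s - t by rewrite subr_gt0.
have := hr (s - t); rewrite /ball /= sub0r normrN gtr0_norm//.
have h1 : s - t < r by lra.
move=> /(_ h1); rewrite gt_eqF// => /(_ isT).
have -> : lim (h^-1 *: ((B \o shift t) (h *: 1) - B t) @[h --> 0^']) = d by exact: Bd.
rewrite /= /shift/= scaler1 subrK ler_norml => /andP[h2 _].
move: h2; rewrite lerNl opprB lerBlDl.
have -> : (s - t)^-1 *: (B s - B t) = (B s - B t) / (s - t) by rewrite mulrC.
by rewrite ler_pdivrMr// lerBlDl mulrC.
Qed.

Variable D : set R.
Hypothesis mD : measurable (D : set (measurableTypeR R)).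

(** Differentiates the norm from the right by way of its square; positivity of the norm at [t] is
    needed to divide by it. *)
Lemma L2norm_growth (u : R -> R -> R) (w : R -> R) (t k r e : R) :
  (forall s, 0 <= s -> inL2 D (u s)) -> inL2 D w -> 0 <= t -> 0 < L2norm D (u t) ->
  (forall e, 0 < e -> exists2 rho : R, 0 < rho & forall s : R, 0 <= s -> `|s - t| < rho ->
    L2norm D (fun x => u s x - u t x - (s - t) * w x) <= e * `|s - t|) ->
  \int[mu]_(x in D) (u t x * w x) <= - k * L2norm D (u t) ^+ 2 + L2norm D (u t) * r -> 0 < e ->
  exists2 rho : R, 0 < rho & forall s : R, t < s -> s < t + rho ->
    L2norm D (u s) <= L2norm D (u t) + (s - t) * (- k * L2norm D (u t) + r + e).
Proof.
move=> uL wL t0 n0 du en e0.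
have e2 : 0 < e / 2 by rewrite divr_gt0.
have [r1 r10 h1] := du _ e2.
pose W := L2norm D w; set n := L2norm D (u t) in n0 en *.
have W1 : 0 < W ^+ 2 + 1 by rewrite ltr_wpDl// sqr_ge0.
(* The second bound makes the quadratic term [tau ^ 2 * W ^ 2] at most [tau * (e * n)]. *)
exists (Num.min r1 (e * n / (W ^+ 2 + 1))) => [|s ts]; first by rewrite lt_min r10 divr_gt0// mulr_gt0.
rewrite -ltrBlDl lt_min => /andP[s1 s2].
have tau0 : 0 < s - t by rewrite subr_gt0.
have s0 : 0 <= s by lra.
have := h1 s s0; rewrite gtr0_norm// => /(_ s1).
set tau := s - t in tau0 s1 s2 *; move=> h2.
have twL := inL2Z mD tau wL.
have uwL := inL2D mD (uL t t0) twL.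
have h3 : L2norm D (u s) <= L2norm D (fun x => u t x + tau * w x) + e / 2 * tau.
  apply: (@le_trans _ _ (L2norm D (fun x => (u t x + tau * w x) + (u s x - u t x - tau * w x)))).
    by rewrite le_eqVlt; apply/orP; left; apply/eqP; apply: L2norm_eq => x _; ring.
  apply: le_trans (L2normD mD uwL _) _; last by rewrite lerD2l.
  by apply: inL2B => //; apply: inL2B => //; exact: uL.
have h4 := L2norm_sqr_expand mD tau (uL t t0) wL.
(* [2 * n * y <= n ^ 2 + y ^ 2] linearizes the square root at [n], so that the expansion of the
   squared norm can be used directly. *)
have h5 : L2norm D (fun x => u t x + tau * w x) * (2 * n) <= n ^+ 2 + L2norm D (fun x => u t x + tau * w x) ^+ 2.
  have := sqr_ge0 (n - L2norm D (fun x => u t x + tau * w x)).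
  by move: (L2norm D (fun x => u t x + tau * w x)) => y; nra.
have W2 : tau * W ^+ 2 <= e * n.
  move: s2; rewrite ltr_pdivlMr// => /ltW; apply: le_trans; rewrite ler_pM2l//; lra.
apply: (le_trans h3).
suff h6 : L2norm D (fun x => u t x + tau * w x) <= n + tau * (- k * n + r + e / 2).
  apply: (le_trans (lerD h6 (lexx (e / 2 * tau)))); rewrite le_eqVlt; apply/orP; left; apply/eqP; by field.
have n2 : 0 < 2 * n by lra.
have tW : tau ^+ 2 * W ^+ 2 <= tau * (e * n) by rewrite expr2 -mulrA ler_pM2l.
have ti := ler_wpM2l (ltW tau0) en.
rewrite h4 -/n -/W in h5.
have h7 : n ^+ 2 + (n ^+ 2 + 2 * tau * \int[mu]_(x in D) (u t x * w x) + tau ^+ 2 * W ^+ 2) <=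
    (n + tau * (- k * n + r + e / 2)) * (2 * n).
  have -> : (n + tau * (- k * n + r + e / 2)) * (2 * n) =
     n ^+ 2 + (n ^+ 2 + 2 * (tau * (- k * n ^+ 2 + n * r)) + tau * (e * n)) by field.
  rewrite lerD2l; apply: lerD => //; rewrite -mulrA lerD2l; exact: ler_wpM2l.
by move: (le_trans h5 h7); rewrite ler_pM2r.
Qed.

End Growth.

(** * Gronwall's inequality for the norm *)

Section GronwallInequality.
Context {R : realType}.
Notation mu := (@lebesgue_measure R).
Variable D : set R.
Hypothesis mD : measurable (D : set (measurableTypeR R)).

(** The integrating factor [exp (k * t)] removes the decay term, leaving a Dini derivative at most
    [exp (k * t) * r t]. Since [r] is only measurable and nonnegative, the integral may be infinite
    and the conclusion lives in the extended reals. *)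
Lemma L2norm_gronwall (u w : R -> R -> R) (r : R -> R) (k T : R) :
  (forall s, 0 <= s -> inL2 D (u s)) -> (forall s, 0 <= s -> inL2 D (w s)) ->
  (forall t e, 0 <= t -> 0 < e -> exists2 rho : R, 0 < rho & forall s : R, 0 <= s -> `|s - t| < rho ->
    L2norm D (fun x => u s x - u t x - (s - t) * w t x) <= e * `|s - t|) ->
  (forall t, 0 <= t ->
    \int[mu]_(x in D) (u t x * w t x) <= - k * L2norm D (u t) ^+ 2 + L2norm D (u t) * r t) ->
  (forall t, 0 <= t -> 0 <= r t) -> measurable_fun (`[0, +oo[%classic : set R) r -> 0 <= T ->
  ((L2norm D (u T))%:E <= (expR (- (k * T)) * L2norm D (u 0))%R%:E +
   \int[mu]_(s in (`[0%R, T] : set R)) (expR (- (k * (T - s))) * r s)%R%:E)%E.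
Proof.
move=> uL wL du en r0 mr T0.
pose z t := expR (k * t) * L2norm D (u t).
pose g t := expR (k * t) * r t.
have z0 t : 0 <= z t by rewrite mulr_ge0 ?expR_ge0 ?L2norm_ge0.
have dexp (t : R) : is_derive t 1 (fun s => expR (k * s)) (k * expR (k * t)).
  have h := @is_derive_expR R (k * t + 0).
  have := @is_derive_affine _ expR k 0 t (expR (k * t + 0)) h.
  by under eq_fun do rewrite addr0; rewrite addr0.
have mexp : measurable_fun [set: R] (fun s => expR (k * s)).
  by apply: continuous_measurableR => t; exact: is_derive_continuous (dexp t).
have mI : measurable_fun (`[0, T]%classic : set R) r.
  by apply: measurable_funS mr => // x /=; rewrite !in_itv/= => /andP[->].
have mg : measurable_fun (`[0, T]%classic : set R) g.
  apply: measurable_realfun.measurable_funM => //.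
  exact: measurable_funTS.
have g0 t : 0 <= t -> 0 <= g t by move=> t0; rewrite mulr_ge0 ?expR_ge0 ?r0.
have cn (t : R) : 0 <= t -> (fun s : R => L2norm D (u s)) @ within (`[0, +oo[)%classic (nbhs t) --> L2norm D (u t).
  move=> t0; apply/cvgrPdist_le => e e0.
  have [rho rho0 h] := du t 1 t0 ltr01.
  pose C := L2norm D (w t) + 1; have C0 : 0 < C by rewrite ltr_wpDl ?L2norm_ge0.
  rewrite /within /=; apply/nbhs_ballP; exists (Num.min rho (e / C)) => [|s] /=; first by rewrite lt_min rho0 divr_gt0.
  rewrite /ball /= distrC lt_min => /andP[h1 h2]; rewrite in_itv/= andbT => s0.
  have hs := h s s0 h1; rewrite mul1r in hs.
  have dL : inL2 D (fun x => u s x - u t x - (s - t) * w t x).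
    by apply: inL2B => //; [apply: inL2B => //; exact: uL|apply: inL2Z => //; exact: wL].
  have twL : inL2 D (fun x => (s - t) * w t x) by apply: inL2Z => //; exact: wL.
  have ntw := L2normZ mD (s - t) (wL t t0).
  have d1L : inL2 D (fun x => u s x - u t x) by apply: inL2B => //; exact: uL.
  have nd : L2norm D (fun x => u s x - u t x) <= e.
    apply: (@le_trans _ _ (L2norm D (fun x => (u s x - u t x - (s - t) * w t x) + (s - t) * w t x))).
      by rewrite le_eqVlt; apply/orP; left; apply/eqP; apply: L2norm_eq => x _; rewrite subrK.
    apply: le_trans (L2normD mD dL twL) _; rewrite ntw.
    apply: (@le_trans _ _ (C * `|s - t|)); first by rewrite /C mulrDl mul1r addrC mulrC lerD2l.
    by rewrite mulrC -ler_pdivlMr// ltW.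
  have n1 : L2norm D (u s) <= L2norm D (u t) + L2norm D (fun x => u s x - u t x).
    apply: le_trans _ (L2normD mD (uL t t0) d1L).
    by rewrite le_eqVlt; apply/orP; left; apply/eqP; apply: L2norm_eq => x _; rewrite addrC subrK.
  have n2 : L2norm D (u t) <= L2norm D (u s) + L2norm D (fun x => u s x - u t x).
    have <- : L2norm D (fun x => (-1) * (u s x - u t x)) = L2norm D (fun x => u s x - u t x).
      by rewrite (L2normZ mD _ d1L) normrN1 mul1r.
    apply: le_trans _ (L2normD mD (uL s s0) (inL2Z mD (-1) d1L)).
    by rewrite le_eqVlt; apply/orP; left; apply/eqP; apply: L2norm_eq => x _; ring.
  by rewrite ler_norml; apply/andP; split; lra.
have cz (t e : R) : 0 <= t <= T -> 0 < e -> exists2 rho : R, 0 < rho &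
    forall s : R, 0 <= s <= T -> `|s - t| < rho -> `|z s - z t| <= e.
  move=> /andP[t0 tT] e0.
  have ce : (fun s => expR (k * s)) @ within (`[0, +oo[)%classic (nbhs t) --> expR (k * t).
    apply: cvg_trans (is_derive_continuous (dexp t)); apply: cvg_app; exact: cvg_within.
  have czt : z @ within (`[0, +oo[)%classic (nbhs t) --> z t by apply: cvgM => //; exact: cn.
  have /cvgrPdist_le/(_ _ e0) := czt; rewrite /within /= => /nbhs_ballP[rho /= rho0 h].
  exists rho => // s /andP[s0 sT] st; have := h s; rewrite /ball /= distrC => /(_ st).
  by rewrite in_itv/= s0 distrC => /(_ isT).
have dz (t e : R) : 0 <= t <= T -> 0 < z t -> 0 < e -> exists2 rho : R, 0 < rho &
     forall s : R, t < s -> s <= T -> s < t + rho -> z s <= z t + (s - t) * (g t + e).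
  move=> /andP[t0 tT] zt e0.
  have n0 : 0 < L2norm D (u t) by move: zt; rewrite /z pmulr_rgt0// expR_gt0.
  set n := L2norm D (u t) in n0.
  have e2 : 0 < e / 2 by rewrite divr_gt0.
  pose E := expR (k * t); have E0 : 0 < E := expR_gt0 _.
  pose e1 := e / 2 / E; have e10 : 0 < e1 by rewrite divr_gt0.
  have [r1 r10 h1] := L2norm_growth mD uL (wL t t0) t0 n0 (fun e e0 => du t e t0 e0) (en t t0) e10.
  pose c := - k * n + r t + e1.
  (* A differentiable function that touches [z] at [t] and lies above it just after [t]. In its
     derivative the growth of the exponential cancels the term [- k * n] of [c], leaving
     [E * (r t + e1)]. *)
  pose B s := expR (k * s) * (n + (s - t) * c).
  have dB : is_derive t 1 B (E * (r t + e1)).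
    have dlin : is_derive t 1 (fun s : R => n + (s - t) * c) c.
      have h := @is_derive_affine _ id c (n - t * c) t 1 (is_derive_id _ _).
      have -> : (fun s : R => n + (s - t) * c) = (fun y => id (c * y + (n - t * c))).
        by apply/funext => s /=; ring.
      by rewrite mulr1 in h.
    apply: (is_derive_eq (is_deriveM (dexp t) dlin)).
    by rewrite subrr mul0r addr0 /GRing.scale/= -/E /c; ring.
  have [r2 r20 h2] := is_derive_upper dB e2.
  exists (Num.min r1 r2) => [|s ts sT]; first by rewrite lt_min r10.
  rewrite -ltrBlDl lt_min => /andP[s1 s2].
  have hB : z s <= B s.
    by rewrite /z /B ler_pM2l ?expR_gt0//; apply: h1 => //; lra.
  have BE : B t = z t by rewrite /B subrr mul0r addr0.
  apply: (le_trans hB); apply: le_trans (h2 s ts _) _; first by lra.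
  rewrite BE lerD2l ler_pM2l ?subr_gt0// /g -/E mulrDr.
  have -> : E * e1 = e / 2 by rewrite /e1 mulrC divfK// gt_eqF.
  lra.
have main := dini_comparison T0 (fun t _ => z0 t) cz _ mg dz.
have gT t : 0 <= t <= T -> 0 <= g t by move=> /andP[t0 _]; exact: g0.
have {main} := main gT; rewrite {1 2}/z mulr0 expR0 mul1r => main.
have E0 : 0 < expR (- (k * T)) := expR_gt0 _.
have EE : expR (- (k * T)) * expR (k * T) = 1 by rewrite -expRD addNr expR0.
have := lee_wpmul2l (ltW E0 : (0 <= (expR (- (k * T)))%:E)%E) main.
rewrite -EFinM mulrA EE mul1r => /le_trans; apply.
have mgE : measurable_fun (`[0, T]%classic : set R) (fun x => (g x)%:E) by exact/measurable_EFinP.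
have gE0 (x : R) : `[0, T]%classic x -> (0 <= (g x)%:E)%E.
  by rewrite /= in_itv/= => xT; rewrite lee_fin gT.
have E0' : (0 <= (expR (- (k * T)))%:E)%E by rewrite lee_fin ltW.
have I0 : (0 <= \int[mu]_(x in (`[0%R, T]%classic : set R)) (g x)%:E)%E by exact: integral_ge0.
have N0 : (0 <= (L2norm D (u 0))%:E)%E by rewrite lee_fin L2norm_ge0.
rewrite (ge0_muleDr _ N0 I0) -EFinM; apply: leeD; first exact: lexx.
have mseg : measurable (`[0, T]%classic : set (measurableTypeR R)) by exact: measurable_itv.
rewrite -(ge0_integralZl mu mseg mgE gE0 E0').
rewrite le_eqVlt; apply/orP; left; apply/eqP; apply: eq_integral => s _.
rewrite -EFinM /g mulrA -expRD; congr (expR _ * _)%:E; ring.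
Qed.

End GronwallInequality.

(** * The energy estimate for the projected dynamics *)

Theorem theorem5p1 (R : realType) (a b : R) (ab : a < b)
  (alpha eps lambda h : R)
  (alpha_gt1 : 1 < alpha) (alpha_lt2 : alpha < 2)
  (eps_gt0 : 0 < eps) (lambda_gt0 : 0 < lambda) (h_gt0 : 0 < h)
  (lambda_star : R) (lambda_star_gt0 : 0 < lambda_star)
  (lambda_starP : smallest_dirichlet_eigenvalue alpha (`]a, b[)%classic lambda_star)
  (N : nat) (Q : set 'rV[R]_N)
  (Phi : 'rV[R]_N -> R -> R) (dPhi : 'rV[R]_N -> 'I_N -> R -> R)
  (Phi_diff : param_differentiable (`]a, b[)%classic Q Phi dPhi)
  (c : int -> R -> R)
  (q qdot : R -> 'rV[R]_N)
  (Dx_u fracLap_u : R -> R -> R) :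
  let Omega : set R := (`]a, b[)%classic in
  let u (t : R) := Phi (q t) in
  let f (t : R) := burgers_field eps (fracLap_u t) (u t) (Dx_u t) in
  let fh (t : R) := burgers_field eps (finite_difference h c (u t)) (u t) (Dx_u t) in
  let Rh (t x : R) : R := f t x - fh t x in
  let J (t : R) := least_squares Omega lambda (dPhi (q t)) (fh t) in
  let delta (t : R) : R := Num.sqrt (J t (qdot t)) in
  (forall t, 0 <= t -> Q (q t)) ->
  (forall t, 0 <= t -> curve_deriv_within (`[0, +oo[)%classic q t (qdot t)) ->
  (forall t, 0 <= t -> is_argmin Q (J t) (qdot t)) ->
  (forall t, 0 <= t -> forall x, ~ Omega x -> u t x = 0) ->
  (forall t, 0 <= t -> H0 (alpha / 2) Omega (u t)) ->
  (forall t, 0 <= t -> fracLap alpha Omega (u t) (fracLap_u t)) ->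
  (forall t, 0 <= t -> weak_derivative Omega (u t) (Dx_u t)) ->
  (forall t, 0 <= t -> inL2 Omega (fun x => u t x * Dx_u t x)) ->
  (forall t, 0 <= t -> inL2 Omega (fh t)) ->
  measurable_fun (`[0, +oo[%classic : set R) (fun s => delta s + L2norm Omega (Rh s)) ->
  forall t : R, 0 <= t ->
  ((L2norm Omega (u t))%:E <=
   (expR (- (lambda_star * eps * t)) * L2norm Omega (u 0))%R%:E +
   \int[lebesgue_measure]_(s in (`[0%R, t] : set R))
     (expR (- (lambda_star * eps * (t - s))) *
      (delta s + L2norm Omega (Rh s)))%R%:E)%E.
Proof.
move=> Omega u f fh Rh J delta Qq dq _ u0 uH uw ug ugL fhL mr t t0.
have mOm : measurable (Omega : set (measurableTypeR R)) by exact: measurable_itv.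
have elam := lambda_starP.1.
have uL s : 0 <= s -> inL2 Omega (u s) by move=> s0; have [] := Phi_diff _ (Qq s s0).
have dL s : 0 <= s -> forall j, inL2 Omega (dPhi (q s) j) by move=> s0; have [] := Phi_diff _ (Qq s s0).
(* The projected field, which is the time derivative of [u] in [L^2]. *)
pose w s := tangent_map (dPhi (q s)) (qdot s).
have wL s : 0 <= s -> inL2 Omega (w s) by move=> s0; exact: tangent_map_inL2 (dL s s0).
have du s e : 0 <= s -> 0 < e -> exists2 rho : R, 0 < rho & forall s' : R, 0 <= s' -> `|s' - s| < rho ->
    L2norm Omega (fun x => u s' x - u s x - (s' - s) * w s x) <= e * `|s' - s|.
  by move=> s0 e0; exact: (param_curve_diff mOm Phi_diff Qq s0 e0 (dq s s0)).
(* The regularization term under the square root is nonnegative, so dropping it leaves the distance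
   of the projected field from [fh]. *)
have delta_ge s : L2norm Omega (fun x => w s x - fh s x) <= delta s.
  rewrite /delta /J /least_squares -[leLHS]ger0_norm ?L2norm_ge0// -sqrtr_sqr.
  by apply: ler_wsqrtr; rewrite lerDl mulr_ge0// sqr_ge0.
have r0 s : 0 <= s -> 0 <= delta s + L2norm Omega (Rh s).
  by move=> _; rewrite addr_ge0 ?sqrtr_ge0 ?L2norm_ge0.
apply: (L2norm_gronwall mOm uL wL du _ r0 mr t0) => s s0.
have [wfL _] := uw s s0.
have fL : inL2 Omega (f s) by apply: inL2B (ugL s s0) => //; exact: inL2Z.
have RL : inL2 Omega (Rh s) by exact: inL2B fL (fhL s s0).
have dfL : inL2 Omega (fun x => w s x - fh s x) by exact: inL2B (wL s s0) (fhL s s0).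
have i1 := inL2_mul mOm dfL (uL s s0); have i2 := inL2_mul mOm wfL (uL s s0).
have i3 := inL2_mul mOm (ugL s s0) (uL s s0); have i4 := inL2_mul mOm RL (uL s s0).
have i2' := intZ_on (- eps) mOm i2.
have i12 := intD_on mOm i1 i2'.
have i34 := intD_on mOm i3 i4.
have -> : \int[lebesgue_measure]_(x in Omega) (u s x * w s x) =
    \int[lebesgue_measure]_(x in Omega) ((w s x - fh s x) * u s x)
    - eps * \int[lebesgue_measure]_(x in Omega) (fracLap_u s x * u s x)
    - \int[lebesgue_measure]_(x in Omega) (u s x * Dx_u s x * u s x)
    - \int[lebesgue_measure]_(x in Omega) (Rh s x * u s x).
  rewrite -mulNr -(RintegralZl (- eps) mOm i2) -(RintegralD mOm i1 i2') -addrA -opprD.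
  rewrite -(RintegralD mOm i3 i4) -(RintegralB mOm i12 i34).
  by apply: eq_Rintegral => x _; rewrite /Rh /f /burgers_field; ring.
rewrite (burgers_nonlinear_eq0 ab alpha_gt1 alpha_lt2 elam (uH s s0) (ug s s0) (ugL s s0)) subr0.
have c1 := L2_cauchy_schwarz mOm dfL (uL s s0).
have c2 := L2_cauchy_schwarz mOm RL (uL s s0).
have c3 := smallest_eigenvalue_coercive ab alpha_gt1 alpha_lt2 lambda_starP (uH s s0) (uw s s0).
rewrite -L2norm_sqr in c3.
have n0 := L2norm_ge0 Omega (u s); have hd := delta_ge s.
have c1' := le_trans (le_trans (ler_norm _) c1) (ler_wpM2r n0 hd).
have c2' := le_trans (ler_norm _) (eq_ind_r (fun x => x <= _) c2 (normrN _)).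
have c3' := ler_wpM2l (ltW eps_gt0) c3.
move: c1' c2' c3'.
move: (\int[lebesgue_measure]_(x in Omega) ((w s x - fh s x) * u s x))
  (\int[lebesgue_measure]_(x in Omega) (fracLap_u s x * u s x))
  (\int[lebesgue_measure]_(x in Omega) (Rh s x * u s x)) (L2norm Omega (u s)) (delta s) (L2norm Omega (Rh s)).
move=> p1 p2 p3 n d rh h1 h2 h3.
have -> : - (lambda_star * eps) * n ^+ 2 + n * (d + rh) = d * n - eps * (lambda_star * n ^+ 2) + rh * n by ring.
by move: h1 h2 h3; clear => *; lra.
Qed.
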